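(* Let $\Gamma=(V,E,(w_v)_{v\in V})$ be a plumbing graph of the following shape, for some integers $2\le N'\le N$: $V=\{1,\dots,N\}$, and the edges are $\{1,2\}$, the pairs $\{1,i\}$ for $3\le i\le N'$, and the pairs $\{2,j\}$ for $N'+1\le j\le N$, with arbitrary integer weights $w_1,\dots,w_N$. Assume that the linking matrix $W$ of $\Gamma$ is negative definite and that $\det W=\pm1$ (equivalently, the plumbed 3-manifold $M(\Gamma)$ is an integral homology sphere). Then for every integer $k\ge 2$ the radial limit of $\widehat Z_\Gamma(q)$ as $q\to\zeta_k$ exists and $$\mathrm{WRT}_k(M(\Gamma))=\frac{1}{2(\zeta_{2k}-\zeta_{2k}^{-1})}\lim_{q\to\zeta_k}\widehat Z_\Gamma(q).$$
   Context: Put $\mathbf e(z)=e^{2\pi i z}$ and $\zeta_m=e^{2\pi i/m}$. A plumbing graph is a finite tree $(V,E)$ with integer weights $w_v$ ($v\in V$). Its linking matrix $W$ is the symmetric $V\times V$ integer matrix with $W_{vv}=w_v$, $W_{vv'}=1$ if $\{v,v'\}\in E$, and $W_{vv'}=0$ for other $v\ne v'$. $M(\Gamma)$ is the closed oriented 3-manifold obtained from $S^3$ by surgery along the framed link defined by $\Gamma$ (one unknot with framing $w_v$ for each vertex, two of them forming a Hopf link exactly when the vertices are adjacent). $\deg(v)$ is the degree of $v$. $\mathrm{WRT}_k(M)$ is the ($SU(2)$) Witten--Reshetikhin--Turaev invariant at the root of unity $\zeta_k$, normalised by $\mathrm{WRT}_k(S^3)=1$. For negative definite $W$ it is given by $$\mathrm{WRT}_k(M(\Gamma))=\frac{\mathbf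 e(|V|/8)\,\zeta_{4k}^{-\sum_{v\in V}(w_v+3)}}{2\sqrt{2k}^{\,|V|}(\zeta_{2k}-\zeta_{2k}^{-1})}\sum_{\mu\in(\mathbb Z\setminus k\mathbb Z)^V/2k\mathbb Z^V}\zeta_{4k}^{{}^t\mu W\mu}\prod_{v\in V}\left(\zeta_{2k}^{\mu_v}-\zeta_{2k}^{-\mu_v}\right)^{2-\deg(v)}.$$ For $|q|<1$ the homological block is $$\widehat Z_\Gamma(q)=2^{-|V|}q^{-\sum_{v\in V}(w_v+3)/4}\ \mathrm{p.v.}\!\int_{|z_v|=1,\,v\in V}\Theta_{-W,\delta}(q;z)\prod_{v\in V}(z_v-1/z_v)^{2-\deg(v)}\frac{dz_v}{2\pi i z_v},$$ where $\delta=(\deg(v))_{v\in V}$, $\Theta_{-W,\delta}(q;z)=\sum_{l\in2\mathbb Z^V+\delta}q^{-{}^tlW^{-1}l/4}\prod_{v}z_v^{l_v}$, and in each variable $\mathrm{p.v.}\int_{|z|=1}:=\lim_{\varepsilon\to+0}\left(\int_{|z|=1+\varepsilon}+\int_{|z|=1-\varepsilon}\right)$. Fractional powers: write $q=e^{2\pi i\tau}$, $\mathrm{Im}\,\tau>0$, and $q^x=e^{2\pi i\tau x}$. The radial limit $q\to\zeta_k$ means $\tau=\frac1k+is$, $s\to+0$; i.e. $q=\zeta_k e^{-t}$, $t\to+0$, with $q^x=\mathbf e(x/k)e^{-tx}$. *)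

(* Defs.v *)
From HB Require Import structures.
From mathcomp Require Import all_boot all_order all_algebra complex.
From mathcomp Require Import all_classical all_reals all_analysis.
From mathcomp.analysis.showcase Require summability.

Set Implicit Arguments.
Unset Strict Implicit.
Unset Printing Implicit Defensive.

Import Order.TTheory GRing.Theory Num.Theory.
Import numFieldNormedType.Exports.

Local Open Scope classical_set_scope.
Local Open Scope ring_scope.

(* The library puts a topology on abstract numFieldTypes only; this transports
   the norm topology to R[i], so that limits can be taken there. *)
HB.instance Definition _ (R : rcfType) :=
  NormedModule.copy R[i] (R[i] : numClosedFieldType)^o.

Definition is_tree (T : finType) (e : rel T) : Prop :=
  (forall x y, connect e x y) /\
  (forall c : seq T, (2 < size c)%N -> ~ ucycle e c).

Record plumbing_graph (N : nat) := PlumbingGraph {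
  adj : rel 'I_N;
  adj_sym : symmetric adj;
  adj_irr : irreflexive adj;
  adj_tree : is_tree adj;
  weight : 'I_N -> int }.

(* With the vertices labelled 1, ..., N, the edges are {1, 2}, the {1, b} with
   3 <= b <= N' and the {2, b} with N' < b <= N.  The element i of 'I_N carries
   the label i.+1. *)
Definition H_edge (N N' a b : nat) : bool :=
  [|| (a == 1) && (b == 2),
      (a == 1) && (3 <= b <= N')
    | (a == 2) && (N' < b <= N)]%N.

Definition H_shaped (N N' : nat) (G : plumbing_graph N) : Prop :=
  forall i j : 'I_N,
    adj G i j = H_edge N N' i.+1 j.+1 || H_edge N N' j.+1 i.+1.

Section Graph.
Variables (N : nat) (G : plumbing_graph N).

Definition degree (v : 'I_N) : nat := #|[set u | adj G v u]%SET|.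

Definition linking : 'M[int]_N :=
  \matrix_(i, j) (if i == j then weight G i else (adj G i j : nat)%:Z).

End Graph.

Definition qform (A : pzRingType) (n : nat) (M : 'M[A]_n) (x : 'cV[A]_n) : A :=
  (x^T *m M *m x) 0 0.

Definition negative_definite (R : realType) (n : nat) (M : 'M[int]_n) : Prop :=
  forall x : 'cV[R]_n, x != 0 -> qform (map_mx intr M) x < 0.

Section ComplexAnalysis.
Variable R : realType.
Implicit Types (z : R[i]) (g : R[i] -> R[i]).

Definition cexp z : R[i] :=
  (expR (complex.Re z))%:C%C * Complex (cos (complex.Im z)) (sin (complex.Im z)).

Definition two_pi_i : R[i] := Complex 0 (2 * pi).

Definition e2pi z : R[i] := cexp (two_pi_i * z).

Definition zeta (m : nat) : R[i] := e2pi (m%:R^-1).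

Definition integral01 (f : R -> R[i]) : R[i] :=
  Complex (\int[lebesgue_measure]_(t in `[0, 1]) complex.Re (f t))
          (\int[lebesgue_measure]_(t in `[0, 1]) complex.Im (f t)).

(* The integral of g(z) dz over |z| = r, by the parametrisation z = r e(t). *)
Definition circle_integral (r : R) g : R[i] :=
  integral01 (fun t =>
    let z := r%:C%C * e2pi t%:C%C in g z * (two_pi_i * z)).

Definition pv_integral g : R[i] :=
  lim ((circle_integral (1 + eps) g + circle_integral (1 - eps) g)
       @[eps --> (0 : R)^'+]).

Section Torus.
Variable N : nat.
Implicit Types (F : ('I_N -> R[i]) -> R[i]).

Fixpoint pv_iterated (s : seq 'I_N) F (z : 'I_N -> R[i]) : R[i] :=
  if s is v :: s' then
    pv_integral (fun x => pv_iterated s' F [eta z with v |-> x])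
  else F z.

(* Every coordinate is integrated out, so the base point 1 plays no role. *)
Definition pv_torus F : R[i] := pv_iterated (enum 'I_N) F (fun=> 1).

End Torus.
End ComplexAnalysis.

Section Invariants.
Variables (R : realType) (N : nat) (G : plumbing_graph N).

(* q ^ x for q = e(tau) *)
Definition qpow (tau : R[i]) (x : R) : R[i] := e2pi (tau * x%:C%C).

(* The sum over l in 2 Z^V + delta, written l = 2 m + delta with m in Z^V, is
   the limit of the finite partial sums along the net of finite subsets. *)
Definition theta (tau : R[i]) (z : 'I_N -> R[i]) : R[i] :=
  summability.sum (fun m : 'cV[int]_N =>
    let l : 'cV[int]_N := \col_v (2 * m v 0 + (degree G v)%:Z) in
    qpow tau (- qform (invmx (map_mx intr (linking G))) (map_mx intr l) / 4)
    * \prod_v z v ^ l v 0).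

Definition Zhat (tau : R[i]) : R[i] :=
  2 ^- N * qpow tau (- (\sum_v (weight G v + 3))%:~R / 4) *
  pv_torus (fun z => theta tau z *
    \prod_v ((z v - (z v)^-1) ^ (2 - (degree G v)%:Z) / (two_pi_i R * z v))).

(* The value of the invariant for a negative definite linking matrix; each
   class of (Z \ kZ)^V / 2kZ^V is represented in {0, ..., 2k - 1}^V. *)
Definition WRT (k : nat) : R[i] :=
  e2pi (N%:R / 8) * zeta R (4 * k) ^ (- \sum_v (weight G v + 3))
  / (2 * (Num.sqrt (2 * k)%:R)%:C%C ^+ N
       * (zeta R (2 * k) - (zeta R (2 * k))^-1))
  * \sum_(mu : {ffun 'I_N -> 'I_(2 * k)} | [forall v, ~~ (k %| mu v)%N])
      (zeta R (4 * k) ^ qform (linking G) (\col_v (mu v : nat)%:Z)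
       * \prod_v (zeta R (2 * k) ^+ mu v - zeta R (2 * k) ^- mu v)
                   ^ (2 - (degree G v)%:Z)).

(* q = e(1/k + i s) *)
Definition Zhat_radial (k : nat) (s : R) : R[i] := Zhat (Complex k%:R^-1 s).

End Invariants.

(* Main.v *)
Require Import Defs.
From mathcomp Require Import all_boot all_order all_algebra complex finmap.
From mathcomp Require Import all_classical all_reals all_analysis.
From mathcomp Require Import ring lra zify.
From mathcomp.analysis.showcase Require summability.

Set Implicit Arguments.
Unset Strict Implicit.
Unset Printing Implicit Defensive.

Import Order.TTheory GRing.Theory Num.Theory.
Import numFieldNormedType.Exports.

Local Open Scope classical_set_scope.
Local Open Scope ring_scope.

(* Write the block as a sum over l in Z^V.  The principal value of
   z^l (z - 1/z)^(2 - deg) does not depend on the radius of the circles, and its values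
   c_deg(l) satisfy c_{d+1}(l+1) - c_{d+1}(l-1) = c_d(l), c_2 = 2 [l = 0].  At
   q = zeta_k e^{-t} the coefficient q^{Q(l)/4}, Q = - W^{-1}, is e(Q(l)/4k) times a Gaussian.
   As W is unimodular, a finite Fourier transform turns e(Q(l)/4k) into an average over mu
   modulo 2k of zeta_4k^{mu W mu} zeta_2k^{- mu l}, normalised by a Gauss sum, which is
   evaluated by diagonalising W on a sublattice of finite index.  For fixed mu, summation by
   parts in each l_v shows that the Gaussian sum of prod c(l_v) zeta_2k^{- mu_v l_v} tends to
   2^N prod (zeta_2k^{mu_v} - zeta_2k^{- mu_v})^{2 - deg v} if k divides no mu_v.  The other mu
   must not contribute: a vertex v of degree d >= 2 with k | mu_v costs a factor
   t^{-(d-2)/2}.  But then the sum over the mu_i at the d - 1 leaves i of v makes the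
   coefficient even in the l_i = +-1, so that one may set these l_i to 1; the sum over l_i
   of c_1(l_i) times a function of sqrt(t) l_i is then a difference, and each leaf
   wins a factor sqrt(t). *)

(** * Modulus and exponential *)

Section Cabs.
Variable R : realType.
Implicit Types (z w : R[i]) (x y : R).

(** The delicate point is the phase of the Gauss sum. Its modulus is elementary; the phase comes
    from the remark that passing from level [k] to level [k * M * M] on a sublattice multiplies the
    sum by a natural number. In several variables this reduces the phase to that of a diagonal form;
    in one variable it makes the phase constant along the levels [k * M * M], which can be compared
    with squares and hence with level 1. The limits use neither Poisson summation nor asymptotic
    expansions. Each summation by parts is an exact identity whose error terms are sums of the same
    kind, with the Gaussian multiplied by a family smaller by a factor [s], where [s] is of order
    sqrt(t). Absolute estimates lose a fixed power of [s], so finitely many steps repair them. The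
    shape of the graph enters through one count: a hub has exactly one neighbour outside the leaves.
    A pole at a hub with [n > 0] leaves costs [n - 1] factors [s] and its tied leaves win [n], so
    the balance stays positive even when both hubs carry poles. *)

Definition cabs z : R := ComplexField.Normc.normc z.

Lemma normr_cabs z : `|z| = (cabs z)%:C%C. Proof. by []. Qed.
Lemma cabs_ge0 z : 0 <= cabs z.
Proof. by case: z => a b; rewrite /cabs /= sqrtr_ge0. Qed.
Lemma cabs0 : cabs 0 = 0. Proof. exact: ComplexField.Normc.normc0. Qed.
Lemma cabs1 : cabs 1 = 1. Proof. exact: ComplexField.Normc.normc1. Qed.
Lemma cabsM z w : cabs (z * w) = cabs z * cabs w.
Proof. exact: ComplexField.Normc.normcM. Qed.
Lemma cabsV z : cabs z^-1 = (cabs z)^-1.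
Proof. exact: ComplexField.Normc.normcV. Qed.
Lemma cabsN z : cabs (- z) = cabs z. Proof. exact: normcN. Qed.
Lemma cabsD z w : cabs (z + w) <= cabs z + cabs w.
Proof. exact: le_normcD. Qed.
Lemma cabsB z w : cabs (z - w) <= cabs z + cabs w.
Proof. by rewrite -(cabsN w) cabsD. Qed.
Lemma cabs_distC z w : cabs (z - w) = cabs (w - z).
Proof. by rewrite -cabsN opprB. Qed.
Lemma cabs_eq0 z : (cabs z == 0) = (z == 0).
Proof.
apply/eqP/eqP => [|->]; last exact: cabs0.
exact: ComplexField.Normc.eq0_normc.
Qed.
Lemma cabs_real x : cabs x%:C%C = `|x|.
Proof. by rewrite /cabs /= expr0n addr0 sqrtr_sqr. Qed.
Lemma cabs_nat (n : nat) : cabs n%:R = n%:R.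
Proof. by rewrite -(rmorph_nat (real_complex R)) cabs_real normr_nat. Qed.
Lemma cabs_sum (I : Type) (r : seq I) (P : pred I) (f : I -> R[i]) :
  cabs (\sum_(i <- r | P i) f i) <= \sum_(i <- r | P i) cabs (f i).
Proof.
elim/big_rec2: _ => [|i y x _ h]; first by rewrite cabs0.
by apply: le_trans (cabsD _ _) _; rewrite lerD2l.
Qed.
Lemma cabs_prod (I : Type) (r : seq I) (P : pred I) (f : I -> R[i]) :
  cabs (\prod_(i <- r | P i) f i) = \prod_(i <- r | P i) cabs (f i).
Proof. by apply: (big_morph cabs); [exact: cabsM | exact: cabs1]. Qed.
Lemma cabsX z (n : nat) : cabs (z ^+ n) = cabs z ^+ n.
Proof. by elim: n => [|n IH]; rewrite ?expr0 ?cabs1// !exprS cabsM IH. Qed.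
Lemma cabsXz z (n : int) : cabs (z ^ n) = cabs z ^ n.
Proof. by case: n => n; rewrite ?NegzE -?exprnN ?cabsV -?exprnP cabsX. Qed.

Lemma Re_le_cabs z : `|complex.Re z| <= cabs z.
Proof. by have := normc_ge_Re z; rewrite normr_cabs lecR. Qed.
Lemma Im_le_cabs z : `|complex.Im z| <= cabs z.
Proof.
case: z => a b; rewrite /cabs /= -sqrtr_sqr ler_sqrt; last by rewrite addr_ge0 ?sqr_ge0.
by rewrite lerDr sqr_ge0.
Qed.
Lemma cabs_le_ReIm z : cabs z <= `|complex.Re z| + `|complex.Im z|.
Proof.
case: z => a b; have -> : Complex a b = a%:C%C + Complex 0 b.
  by apply/eqP; rewrite eq_complex /= addr0 add0r !eqxx.
apply: le_trans (cabsD _ _) _; rewrite cabs_real /= addr0 add0r.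
by rewrite /cabs /= expr0n add0r sqrtr_sqr lexx.
Qed.

(* Limits in R[i] can be tested with real radii. *)
Lemma cvg_cabsP (T : Type) (F : set_system T) (FF : Filter F) (f : T -> R[i]) l :
  f @ F --> l <-> forall e : R, 0 < e -> \forall t \near F, cabs (f t - l) <= e.
Proof.
split => [/cvgrPdist_le h e e0|h].
  have := h e%:C%C; rewrite ltcR => /(_ e0); apply: filterS => t.
  by rewrite normr_cabs lecR cabs_distC.
apply/cvgrPdist_le => e e0.
have eR : e = (complex.Re e)%:C%C by rewrite RRe_real// gtr0_real.
move: e0; rewrite eR ltcR => /h; apply: filterS => t.
by rewrite normr_cabs lecR cabs_distC.
Qed.

End Cabs.

Section Exponential.
Variable R : realType.
Implicit Types (z w : R[i]) (x y : R).

Definition ee x : R[i] := Complex (cos (2 * pi * x)) (sin (2 * pi * x)).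

Lemma e2piE x y : e2pi (Complex x y) = (expR (- (2 * pi * y)))%:C%C * ee x.
Proof.
rewrite /e2pi.
have -> : two_pi_i R * Complex x y = Complex (- (2 * pi * y)) (2 * pi * x).
  by apply/eqP; rewrite eq_complex /= !mul0r sub0r add0r !eqxx.
by [].
Qed.
Lemma e2pi_real x : e2pi x%:C%C = ee x.
Proof. by rewrite e2piE mulr0 oppr0 expR0 mul1r. Qed.

Lemma eeD x y : ee (x + y) = ee x * ee y.
Proof.
rewrite /ee mulrDr cosD sinD; apply/eqP; rewrite eq_complex /= eqxx /=.
by apply/eqP; ring.
Qed.
Lemma ee0 : ee 0 = 1.
Proof. by rewrite /ee mulr0 cos0 sin0. Qed.
Lemma cabs_ee x : cabs (ee x) = 1.
Proof. by rewrite /cabs /= cos2Dsin2 sqrtr1. Qed.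
Lemma ee_neq0 x : ee x != 0.
Proof. by rewrite -cabs_eq0 cabs_ee oner_eq0. Qed.
Lemma eeN x : ee (- x) = (ee x)^-1.
Proof. by apply: (mulIf (ee_neq0 x)); rewrite -eeD addNr ee0 mulVf// ee_neq0. Qed.
Lemma eeMn x (n : nat) : ee (x *+ n) = ee x ^+ n.
Proof. by elim: n => [|n IH]; rewrite ?mulr0n ?ee0// mulrS eeD IH exprS. Qed.
Lemma eeMz x (n : int) : ee (x * n%:~R) = ee x ^ n.
Proof.
rewrite mulrzr; case: n => n; first by rewrite -pmulrn eeMn.
by rewrite NegzE mulrNz eeN -pmulrn eeMn -exprnN.
Qed.
Lemma ee1 : ee 1 = 1.
Proof. by rewrite /ee mulr1 mulr_natl cos2pi sin2pi. Qed.
Lemma ee_int (n : int) : ee n%:~R = 1.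
Proof. by rewrite -[n%:~R]mul1r eeMz ee1 exp1rz. Qed.
Lemma ee_sum (I : Type) (r : seq I) (P : pred I) (f : I -> R) :
  ee (\sum_(i <- r | P i) f i) = \prod_(i <- r | P i) ee (f i).
Proof. by apply: (big_morph ee); [exact: eeD | exact: ee0]. Qed.
Lemma conj_ee x : (ee x)^*%C = ee (- x).
Proof. by rewrite /ee mulrN cosN sinN. Qed.

Lemma zetaE (m : nat) : zeta R m = ee m%:R^-1.
Proof. by rewrite /zeta -(rmorph_nat (real_complex R)) -fmorphV e2pi_real. Qed.
Lemma zeta_exp (m : nat) (n : int) : zeta R m ^ n = ee (n%:~R / m%:R).
Proof. by rewrite zetaE -eeMz mulrC. Qed.

End Exponential.

(** * Quadratic forms and quadratic Gauss sums *)

Section QuadraticForms.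

Definition bform (A : pzRingType) n (M : 'M[A]_n) (x y : 'cV[A]_n) : A :=
  (x^T *m M *m y) 0 0.

Lemma bformDr (A : pzRingType) n (M : 'M[A]_n) x y z :
  bform M x (y + z) = bform M x y + bform M x z.
Proof. by rewrite /bform mulmxDr mxE. Qed.
Lemma bformDl (A : pzRingType) n (M : 'M[A]_n) x y z :
  bform M (x + y) z = bform M x z + bform M y z.
Proof. by rewrite /bform linearD /= !mulmxDl mxE. Qed.
Lemma bformZr (A : comPzRingType) n (M : 'M[A]_n) a x y :
  bform M x (a *: y) = a * bform M x y.
Proof. by rewrite /bform -scalemxAr mxE. Qed.
Lemma bformZl (A : comPzRingType) n (M : 'M[A]_n) a x y :
  bform M (a *: x) y = a * bform M x y.
Proof. by rewrite /bform linearZ /= -!scalemxAl mxE. Qed.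
Lemma bformC (A : comPzRingType) n (M : 'M[A]_n) x y :
  M^T = M -> bform M x y = bform M y x.
Proof.
move=> sM; rewrite /bform.
have -> : y^T *m M *m x = (x^T *m M *m y)^T by rewrite !trmx_mul trmxK sM mulmxA.
by rewrite [RHS]mxE.
Qed.
Lemma qformD (A : comPzRingType) n (M : 'M[A]_n) x y : M^T = M ->
  qform M (x + y) = qform M x + 2 * bform M x y + qform M y.
Proof.
move=> sM; rewrite -[LHS]/(bform M (x + y) (x + y)) bformDl !bformDr.
by rewrite (bformC y x sM) -![qform _ _]/(bform _ _ _); ring.
Qed.
Lemma qformZ (A : comPzRingType) n (M : 'M[A]_n) a x :
  qform M (a *: x) = a ^+ 2 * qform M x.
Proof. by rewrite -[LHS]/(bform M _ _) bformZl bformZr mulrA expr2. Qed.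
Lemma qform_mulmx (A : comPzRingType) n (M U : 'M[A]_n) x :
  qform M (U *m x) = qform (U^T *m M *m U) x.
Proof. by rewrite /qform trmx_mul !mulmxA. Qed.
Lemma qformN (A : pzRingType) n (M : 'M[A]_n) x : qform (- M) x = - qform M x.
Proof. by rewrite /qform mulmxN mulNmx mxE. Qed.
Lemma qform_diag (A : comPzRingType) n (M : 'M[A]_n) x : is_diag_mx M ->
  qform M x = \sum_i M i i * x i 0 ^+ 2.
Proof.
move=> /is_diag_mxP dM; rewrite /qform mxE; apply: eq_bigr => i _.
rewrite mxE (bigD1 i)//= big1 ?addr0 => [|j ji]; last by rewrite dM ?mulr0.
by rewrite mxE expr2; ring.
Qed.
Lemma bformE (A : comPzRingType) n (M : 'M[A]_n) x y :
  bform M x y = \sum_i x i 0 * (M *m y) i 0.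
Proof.
by rewrite /bform -mulmxA mxE; apply: eq_bigr => i _; rewrite mxE.
Qed.

Definition posdef n (A : 'M[int]_n) := forall x : 'cV[int]_n, x != 0 -> 0 < qform A x.

(* Gram-Schmidt orthogonalization, with the denominators cleared. *)
Lemma posdef_diagonalize n (A : 'M[int]_n) : A^T = A -> posdef A ->
  exists2 U : 'M[int]_n, \det U != 0 & is_diag_mx (U^T *m A *m U).
Proof.
elim: n A => [|n IH] A sA pA.
  by exists 1%:M; rewrite ?det1//; apply/is_diag_mxP => - [].
rewrite -[n.+1]/(1 + n)%N in A sA pA *.
pose a := ulsubmx A 0 0; pose r := ursubmx A; pose B := drsubmx A.
have EA : A = block_mx a%:M r r^T B.
  rewrite -[LHS]submxK; congr block_mx; first by rewrite [LHS]mx11_scalar.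
  by rewrite /r trmx_ursub sA.
have sB : B^T = B by rewrite /B trmx_drsub sA.
pose U1 : 'M[int]_(1 + n) := block_mx 1%:M (- r) 0 a%:M.
have E1 : U1^T *m A *m U1 = block_mx a%:M 0 0 (a *: (a *: B - r^T *m r)).
  rewrite EA /U1 tr_block_mx !mulmx_block !tr_scalar_mx !linear0 !mul0mx !addr0.
  have -> : (- r)^T = - r^T by rewrite linearN.
  rewrite !mul1mx !mulmx1 !mul_mx_scalar !mul_scalar_mx !scalerN !addNr.
  by rewrite mul0mx add0r mulNmx addrC.
have a0 : 0 < a.
  have := pA (col_mx 1%:M 0); rewrite /qform EA tr_col_mx mul_row_block.
  rewrite tr_scalar_mx !mul1mx linear0 !mul0mx !addr0 mul_row_col mulmx0 addr0 mulmx1.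
  rewrite !mxE eqxx mulr1n; apply; apply/eqP => /matrixP/(_ (lshift n 0) 0).
  by rewrite col_mxEu !mxE.
set B' := a *: _ in E1.
have sB' : B'^T = B'.
  by rewrite /B' linearZ /= linearB /= linearZ /= trmx_mul trmxK sB.
have pB' : posdef B'.
  move=> x x0; have := pA (U1 *m col_mx 0 x).
  rewrite qform_mulmx E1 /qform tr_col_mx mul_row_block !mulmx0 !addr0.
  rewrite linear0 mul0mx add0r mul_row_col mul0mx add0r; apply.
  rewrite /U1 mul_block_col mulmx0 mul0mx mul_scalar_mx !add0r.
  apply: contra x0 => /eqP/matrixP h; apply/eqP/matrixP => i j.
  have := h (rshift 1 i) j; rewrite col_mxEd !mxE => /eqP.
  by rewrite mulf_eq0 gt_eqF//= => /eqP.
have [U' dU' dU'A] := IH B' sB' pB'.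
exists (U1 *m block_mx 1%:M 0 0 U').
  by rewrite det_mulmx !det_ublock det1 mul1r mul1r det_scalar mulf_neq0// expf_neq0 ?gt_eqF.
rewrite trmx_mul -!mulmxA [A *m _]mulmxA [U1^T *m _]mulmxA [U1^T *m _]mulmxA E1.
rewrite tr_block_mx !linear0 tr_scalar_mx !mulmx_block.
rewrite !(mul0mx, mulmx0, mul1mx, mulmx1, addr0, add0r) mulmxA.
apply/is_diag_mxP => i j; rewrite -(splitK i) -(splitK j).
case: (fintype.split i) => i'; case: (fintype.split j) => j' /= ij.
- by move: ij; rewrite (ord1 i') (ord1 j') eqxx.
- by rewrite block_mxEur mxE.
- by rewrite block_mxEdl mxE.
- rewrite block_mxEdr; move/is_diag_mxP: dU'A; apply.
  by apply: contra ij => /eqP ->.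
Qed.
End QuadraticForms.

(** * Integer vectors modulo n and their representatives *)

Section CongruentVectors.
Variable N : nat.
Implicit Types (x y z : 'cV[int]_N) (n : nat).

Definition cong n x y := [forall v, (n %| (x v 0 - y v 0)%R)%Z].

Lemma congP n x y : reflect (exists z, x = y + n%:Z *: z) (cong n x y).
Proof.
apply: (iffP forallP) => [h|[z ->] v]; last first.
  by rewrite !mxE addrAC subrr add0r dvdz_mulr.
exists (\col_v ((x v 0 - y v 0)%R %/ n)%Z); apply/matrixP => v j.
by rewrite !mxE ord1 mulrC divzK// addrC subrK.
Qed.
Lemma cong_sym n x y : cong n x y = cong n y x.
Proof. by apply: eq_forallb => v; rewrite -opprB rpredN. Qed.
Lemma cong_trans n y x z : cong n x y -> cong n y z -> cong n x z.
Proof.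
move=> /forallP h1 /forallP h2; apply/forallP => v.
by have -> : x v 0 - z v 0 = (x v 0 - y v 0) + (y v 0 - z v 0); [ring | rewrite rpredD].
Qed.
Lemma congB n x y : cong n x y = cong n (x - y) 0.
Proof. by apply: eq_forallb => v; rewrite !mxE subr0. Qed.
Lemma cong_mulmx n (M : 'M[int]_N) x y : cong n x y -> cong n (M *m x) (M *m y).
Proof.
case/congP => z ->; apply/congP; exists (M *m z).
by rewrite mulmxDr -scalemxAr.
Qed.
Lemma cong_scale n m x y : (0 < m)%N -> cong (m * n) (m%:Z *: x) (m%:Z *: y) = cong n x y.
Proof.
move=> m0; apply: eq_forallb => v; rewrite !mxE -mulrBr PoszM dvdz_mul2l// eqz_nat -lt0n//.
Qed.

Definition bvec n (mu : {ffun 'I_N -> 'I_n}) : 'cV[int]_N := \col_v (mu v : nat)%:Z.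

(** The outer reduction acts on a number that is already below [n]; it supplies the bound that an
    ordinal requires. *)
Definition bred n (n0 : (0 < n)%N) x : {ffun 'I_N -> 'I_n} :=
  [ffun v => Ordinal (ltn_pmod `|((x v 0)%R %% n%:Z)%Z|%N n0)].

Lemma bred_cong n (n0 : (0 < n)%N) x : cong n (bvec (bred n0 x)) x.
Proof.
apply/forallP => v; rewrite mxE ffunE /=.
have m0 : 0 <= ((x v 0)%R %% n)%Z by rewrite modz_ge0// -lt0n.
rewrite modn_small; last by rewrite -ltz_nat gez0_abs// ltz_pmod.
by rewrite gez0_abs// -opprB rpredN -eqz_mod_dvd modz_mod.
Qed.
Lemma bvec_inj n (mu nu : {ffun 'I_N -> 'I_n}) : cong n (bvec mu) (bvec nu) -> mu = nu.
Proof.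
move=> /forallP h; apply/ffunP => v; apply/val_inj => /=.
have := h v; rewrite !mxE -eqz_mod_dvd !modz_nat eqz_nat => /eqP.
by rewrite !modn_small.
Qed.

End CongruentVectors.

(** * Finite Fourier analysis on Z^N modulo n *)

Section BoxSums.
Variables (R : realType) (N : nat).
Implicit Types (x y z : 'cV[int]_N) (n : nat) (f : 'cV[int]_N -> R[i]).

(** For a [periodic] summand this is the sum over Z^N / n Z^N. Summands stay functions of integer
    vectors, on which the quadratic forms are defined. *)
Definition boxsum n f : R[i] := \sum_(mu : {ffun 'I_N -> 'I_n}) f (bvec mu).

Definition periodic n f := forall x y, cong n x y -> f x = f y.

(** An injective self-map of the finite box is bijective, so injectivity modulo [n] suffices. *)
Lemma boxsum_reindex n f (h : 'cV[int]_N -> 'cV[int]_N) : (0 < n)%N -> periodic n f ->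
  (forall x y, cong n (h x) (h y) -> cong n x y) ->
  boxsum n (f \o h) = boxsum n f.
Proof.
move=> n0 pf hinj; rewrite /boxsum.
have inj : injective (fun mu : {ffun 'I_N -> 'I_n} => bred n0 (h (bvec mu))).
  move=> mu nu e; apply/bvec_inj/hinj.
  apply: (cong_trans (y := bvec (bred n0 (h (bvec mu))))).
    by rewrite cong_sym bred_cong.
  by rewrite e bred_cong.
rewrite [RHS](reindex_inj inj); apply: eq_bigr => mu _.
by apply: pf; rewrite cong_sym bred_cong.
Qed.
Lemma boxsum_shift n f a : (0 < n)%N -> periodic n f ->
  boxsum n (fun x => f (x + a)) = boxsum n f.
Proof.
move=> n0 pf; apply: (boxsum_reindex (h := fun x => x + a)) => // x y.
by rewrite congB opprD addrACA subrr addr0 -congB.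
Qed.
Lemma eq_boxsum n f g : f =1 g -> boxsum n f = boxsum n g.
Proof. by move=> fg; apply: eq_bigr. Qed.
Lemma boxsumZ n c f : boxsum n (fun x => c * f x) = c * boxsum n f.
Proof. by rewrite /boxsum mulr_sumr. Qed.
Lemma boxsum1 n : boxsum n (fun=> 1) = n%:R ^+ N.
Proof. by rewrite /boxsum sumr_const card_ffun !card_ord natrX. Qed.
Lemma exchange_boxsum n m (F : 'cV[int]_N -> 'cV[int]_N -> R[i]) :
  boxsum n (fun x => boxsum m (F x)) = boxsum m (fun y => boxsum n (F^~ y)).
Proof. exact: exchange_big. Qed.
Lemma boxsum_delta n f a : (0 < n)%N -> periodic n f ->
  boxsum n (fun x => (cong n x a)%:R * f x) = f a.
Proof.
move=> n0 pf; rewrite /boxsum (bigD1 (bred n0 a))//= bred_cong mul1r.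
rewrite big1 ?addr0 => [|mu mua]; first by apply: pf; exact: bred_cong.
case: (boolP (cong _ _ _)) => [h|_]; last by rewrite mul0r.
case/eqP: mua; apply: bvec_inj; apply: cong_trans h _.
by rewrite cong_sym bred_cong.
Qed.

Lemma boxsum_prod n (F : 'I_N -> int -> R[i]) :
  boxsum n (fun x => \prod_v F v (x v 0)) = \prod_v \sum_(j < n) F v j%:Z.
Proof.
rewrite bigA_distr_bigA /boxsum; apply: eq_bigr => mu _.
by apply: eq_bigr => v _; rewrite mxE.
Qed.

(** For the remainder r of [b] and t = pi r / n, cos(2t) = 1 forces sin t = 0, whereas sine is
    positive strictly between 0 and pi; hence r = 0. *)
Lemma ee_eq1 (b : int) n : (0 < n)%N -> ee (b%:~R / n%:R : R) = 1 -> (n %| b)%Z.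
Proof.
move=> n0; have nR : n%:R != 0 :> R by rewrite pnatr_eq0 -lt0n.
rewrite {1}(divz_eq b n) intrD intrM mulrDl eeD mulfK ?ee_int ?mul1r//.
move=> e; apply/dvdz_mod0P; move: e; set r := (b %% n)%Z => e.
have r0 : 0 <= r by rewrite modz_ge0// -lt0n.
have rn : r < n by rewrite ltz_pmod.
apply/eqP; rewrite eq_le r0 andbT leNgt; apply/negP => rp.
have : 0 < sin (pi * (r%:~R / n%:R)) :> R.
  have nP : 0 < n%:R :> R by rewrite ltr0n.
  apply: sin_gt0_pi; rewrite mulr_gt0 ?pi_gt0 ?divr_gt0 ?ltr0z//=.
  by rewrite gtr_pMr ?pi_gt0// ltr_pdivrMr// mul1r -[n%:R]/(n%:~R) ltr_int.
move: e => [+ _]; rewrite -mulrA mulr_natl cos_mulr2n => c1.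
set t := pi * _ in c1 *.
have : sin t ^+ 2 = 0 by rewrite sin2cos2; move: c1; lra.
by move/eqP; rewrite sqrf_eq0 => /eqP ->; rewrite ltxx.
Qed.

Lemma ee_eqmod (a b : int) n : (0 < n)%N -> (n %| (a - b)%R)%Z ->
  ee (a%:~R / n%:R : R) = ee (b%:~R / n%:R).
Proof.
move=> n0 /dvdzP[c e]; have nR : n%:R != 0 :> R by rewrite pnatr_eq0 -lt0n.
have -> : a = b + c * n by rewrite -e addrC subrK.
by rewrite intrD intrM mulrDl mulfK// eeD ee_int mulr1.
Qed.

Definition dot (b x : 'cV[int]_N) : int := \sum_v b v 0 * x v 0.

Lemma dotDr b x y : dot b (x + y) = dot b x + dot b y.
Proof. by rewrite -big_split; apply: eq_bigr => v _; rewrite mxE mulrDr. Qed.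
Lemma dotZr b (c : int) x : dot b (c *: x) = c * dot b x.
Proof. by rewrite /dot mulr_sumr; apply: eq_bigr => v _; rewrite mxE; ring. Qed.

Lemma dot_periodic n b : (0 < n)%N -> periodic n (fun x => ee ((dot b x)%:~R / n%:R)).
Proof.
move=> n0 x y /congP[z ->]; apply: ee_eqmod => //.
by rewrite dotDr dotZr addrAC subrr add0r dvdz_mulr.
Qed.

(** Orthogonality of characters: if [b v 0] is not divisible by [n], translation by the unit vector
    at [v] multiplies the sum by a number other than 1. *)
Lemma boxsum_dot n b : (0 < n)%N ->
  boxsum n (fun x => ee ((dot b x)%:~R / n%:R)) = (cong n b 0)%:R * n%:R ^+ N.
Proof.
move=> n0; have [/forallP h|] := boolP (cong n b 0).
  rewrite mul1r -boxsum1; apply: eq_boxsum => x.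
  rewrite (ee_eqmod (b := 0)) ?mul0r ?ee0// subr0 rpred_sum// => v _.
  by have := h v; rewrite mxE subr0 => ?; rewrite dvdz_mulr.
case/forallPn => v; rewrite mxE subr0 mul0r => nb; set S := LHS.
pose a : 'cV[int]_N := delta_mx v 0.
have : S = ee ((b v 0)%:~R / n%:R) * S.
  rewrite -boxsumZ -[LHS](boxsum_shift a n0); last exact: dot_periodic.
  apply: eq_boxsum => x; rewrite dotDr intrD mulrDl eeD mulrC; congr (ee (_%:~R / _) * _).
  rewrite /dot (bigD1 v)//= big1 => [|w wv]; first by rewrite mxE !eqxx mulr1 addr0.
  by rewrite mxE (negbTE wv) mulr0.
move/eqP; rewrite -subr_eq0 -[X in X - _]mul1r -mulrBl mulf_eq0 => /orP[|/eqP//].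
by rewrite subr_eq0 => /eqP/esym/(ee_eq1 n0) h; rewrite h in nb.
Qed.

End BoxSums.

(** * Gauss sums of unimodular forms: modulus, Fourier transform, sublattices *)

Section GaussSums.
Variables (R : realType) (N : nat) (W : 'M[int]_N).
Hypothesis sW : W^T = W.
Implicit Types (x y z : 'cV[int]_N) (K k M : nat).

Definition psi K x : R[i] := ee ((qform W x)%:~R / (4 * K)%:R).
Definition gauss K : R[i] := boxsum (2 * K) (psi K).

(** The denominator is [4 * K] but the period is [2 * K], because the cross term of a symmetric form
    is doubled. *)
Lemma psi_periodic K : (0 < K)%N -> periodic (2 * K) (psi K).
Proof.
move=> K0 x y /congP[z ->]; apply: ee_eqmod; first by rewrite muln_gt0.
rewrite qformD// qformZ bformZr.
have -> : qform W y + 2 * ((2 * K)%N%:Z * bform W y z) +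
    (2 * K)%N%:Z ^+ 2 * qform W z - qform W y =
   (4 * K)%N%:Z * (bform W y z + K%:Z * qform W z) by rewrite !PoszM; ring.
by rewrite dvdz_mulr.
Qed.

Hypothesis uW : W \in unitmx.

Lemma cong_unit n x y : cong n (W *m x) (W *m y) -> cong n x y.
Proof. by move/(cong_mulmx (invmx W)); rewrite !mulKmx. Qed.

Lemma bform_dot x y : bform W x y = dot (W *m x) y.
Proof. by rewrite (bformC _ _ sW) bformE; apply: eq_bigr => v _; rewrite mulrC. Qed.

(** In the product with the conjugate, replacing [x] by [x + y] leaves [psi K x] times a character
    of [y]. Summing over [y] keeps only [x = 0], as [W] is invertible modulo [2 * K]. *)
Lemma gauss_norm K : (0 < K)%N -> cabs (gauss K) ^+ 2 = (2 * K)%:R ^+ N.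
Proof.
move=> K0; have K2 : (0 < 2 * K)%N by rewrite muln_gt0.
have K4 : (4 * K)%:R != 0 :> R by rewrite pnatr_eq0 muln_eq0/= -lt0n.
have h : gauss K * (gauss K)^*%C = (2 * K)%:R ^+ N.
  rewrite {2}/gauss /boxsum rmorph_sum /= mulr_sumr.
  transitivity (boxsum (2 * K) (fun y => boxsum (2 * K)
     (fun x => psi K x * ee ((dot (W *m x) y)%:~R / (2 * K)%:R)))).
    apply: eq_bigr => nu _; set y := bvec nu.
    rewrite -[X in _ * X]/((psi K y)^*%C) {1}/psi conj_ee mulrC -boxsumZ.
    rewrite -(boxsum_shift y K2); last first.
      by move=> a b ab; rewrite (psi_periodic K0 ab).
    apply: eq_boxsum => x; rewrite /psi -!eeD -bform_dot; congr ee.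
    rewrite qformD// !intrD intrM !natrM; field.
    by move: K0; rewrite -(ltr_nat R) => /lt0r_neq0.
  rewrite exchange_boxsum.
  rewrite [LHS](@eq_boxsum _ _ _ _ (fun x => (cong (2 * K) x 0)%:R * (psi K x * (2 * K)%:R ^+ N))).
    rewrite boxsum_delta//.
      by rewrite /psi /qform mulmx0 mxE mul0r ee0 mul1r.
    by move=> x y xy; rewrite (psi_periodic K0 xy).
  move=> x; rewrite boxsumZ boxsum_dot// mulrCA; congr ((nat_of_bool _)%:R * _).
  apply/idP/idP => [h|/(cong_mulmx W)]; last by rewrite mulmx0.
  by apply: cong_unit; rewrite mulmx0.
apply: (@complexI R); rewrite !rmorphXn /= -normr_cabs.
by rewrite sqr_normc rmorph_nat.
Qed.

Lemma gauss_neq0 K : (0 < K)%N -> gauss K != 0.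
Proof.
move=> K0; rewrite -cabs_eq0 -sqrf_eq0 gauss_norm// expf_neq0// pnatr_eq0 muln_eq0/=.
by rewrite -lt0n.
Qed.

(** Completing the square: the shift of [x] by [invmx W *m l] is integral because [W] is
    unimodular. *)
Lemma gauss_fourier K (l : 'cV[int]_N) : (0 < K)%N ->
  boxsum (2 * K) (fun x => psi K x * ee (- ((dot l x)%:~R / (2 * K)%:R))) =
  gauss K * ee ((qform (- invmx W) l)%:~R / (4 * K)%:R).
Proof.
move=> K0; have K2 : (0 < 2 * K)%N by rewrite muln_gt0.
have KR : K%:R != 0 :> R by move: K0; rewrite -(ltr_nat R) => /lt0r_neq0.
rewrite mulrC -boxsumZ -[LHS](boxsum_shift (invmx W *m l) K2); last first.
  move=> x y xy; rewrite (psi_periodic K0 xy); congr (_ * _).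
  by rewrite !eeN (dot_periodic R l K2 xy).
apply: eq_boxsum => x; rewrite /psi -!eeD; congr ee.
have e1 : qform W (invmx W *m l) = qform (invmx W) l.
  by rewrite qform_mulmx trmx_inv sW mulVmx// mul1mx.
have e2 : bform W x (invmx W *m l) = dot l x.
  by rewrite (bformC _ _ sW) bform_dot mulKVmx.
have e3 : dot l (invmx W *m l) = qform (invmx W) l.
  by rewrite -[RHS]/(bform _ _ _) bformE.
rewrite qformD// e1 e2 dotDr e3 qformN !natrM !intrD intrM rmorphN/=.
by field.
Qed.

Section Sublattice.
Variables (U V : 'M[int]_N) (M k : nat).
Hypotheses (UV : U *m V = M%:Z%:M) (M0 : (0 < M)%N) (k0 : (0 < k)%N).
Let K := (k * M * M)%N.
Let f y := psi K (U *m y).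

Let K0 : (0 < K)%N. Proof. by rewrite !muln_gt0 k0 M0. Qed.
Let K2 : (0 < 2 * K)%N. Proof. by rewrite muln_gt0. Qed.

Let f_periodic : periodic (2 * K) f.
Proof. by move=> x y xy; apply: psi_periodic => //; exact: cong_mulmx. Qed.

Let f_shift u y :
  f (y + (2 * k)%N%:Z *: (V *m u)) = f y * ee ((dot (W *m (U *m y)) u)%:~R / M%:R).
Proof.
have MR : M%:R != 0 :> R by move: M0; rewrite -(ltr_nat R) => /lt0r_neq0.
have kR : k%:R != 0 :> R by move: k0; rewrite -(ltr_nat R) => /lt0r_neq0.
rewrite /f /psi mulmxDr -scalemxAr [U *m (V *m u)]mulmxA UV mul_scalar_mx scalerA qformD// qformZ
  bformZr.
rewrite -bform_dot -!eeD -[RHS]mulr1 -(ee_int R (k%:Z * qform W u)) -eeD.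
congr ee; rewrite /K !natrM !PoszM expr2 !intrD !intrM.
by rewrite -!pmulrn; field; rewrite MR kR.
Qed.

(* Averaging over the translations by [2 k M U^-1 u] kills all [y] but those
   with [U y] in [M Z^N]. *)
Lemma gauss_sublattice : exists c : nat, boxsum (2 * K) f = c%:R * gauss k.
Proof.
have MR : M%:R ^+ N != 0 :> R[i].
  by rewrite expf_neq0// pnatr_eq0 -lt0n.
have kM : (2 * K = M * (2 * k * M))%N by rewrite /K; ring.
have k2 : (0 < 2 * k)%N by rewrite muln_gt0.
have k2M : (2 * k * M = M * (2 * k))%N by rewrite mulnC.
have S1 : boxsum (2 * K) f = boxsum (2 * K) (fun y => (cong M (U *m y) 0)%:R * f y).
  apply: (mulfI MR); rewrite -[X in X * _ = _]boxsum1 mulrC -boxsumZ.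
  transitivity (boxsum M (fun u => boxsum (2 * K)
      (fun y => f y * ee ((dot (W *m (U *m y)) u)%:~R / M%:R)))).
    apply: eq_boxsum => u; rewrite mulr1 -(boxsum_shift ((2 * k)%N%:Z *: (V *m u)) K2 f_periodic).
    by apply: eq_boxsum => y; rewrite f_shift.
  rewrite exchange_boxsum -boxsumZ; apply: eq_boxsum => y.
  rewrite boxsumZ boxsum_dot// [LHS]mulrC mulrA [X in X * _]mulrC; congr (_ * _ * _).
  congr ((nat_of_bool _)%:R); apply/idP/idP => [h|/(cong_mulmx W)]; last by rewrite mulmx0.
  by apply: cong_unit; rewrite mulmx0.
(* For each class [x] modulo [2 * k], the [y] with [U y] congruent to [M x] modulo [2 * k * M] are
   the translates by [V x] of those counted by [c]. The value of [c] is left open here and can be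
   recovered from the moduli of both sides. *)
pose c := (\sum_(nu : {ffun 'I_N -> 'I_(2 * K)}) nat_of_bool (cong (2 * k * M) (U *m bvec nu) 0))%N.
have cE : c%:R = boxsum (2 * K) (fun y => (cong (2 * k * M) (U *m y) 0)%:R) :> R[i].
  by rewrite /c natr_sum.
exists c; rewrite S1 /gauss -boxsumZ.
transitivity (boxsum (2 * K) (fun y => boxsum (2 * k) (fun x =>
    (cong (2 * k * M) (U *m y) (M%:Z *: x))%:R * psi k x))).
  apply: eq_boxsum => y; have [/congP[z]|ny] := boolP (cong M _ 0).
    rewrite add0r => e; rewrite /f e mul1r.
    have -> : psi K (M%:Z *: z) = psi k z.
      rewrite /psi qformZ; congr ee; rewrite /K !natrM intrM expr2 intrM.
      have MR' : M%:R != 0 :> R by move: M0; rewrite -(ltr_nat R) => /lt0r_neq0.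
      have kR : k%:R != 0 :> R by move: k0; rewrite -(ltr_nat R) => /lt0r_neq0.
      by rewrite -!pmulrn; field; rewrite MR' kR.
    rewrite -[LHS](boxsum_delta _ k2 (psi_periodic k0)); apply: eq_boxsum => x.
    by rewrite k2M cong_scale// cong_sym.
  rewrite mul0r /boxsum big1// => mu _; set x := bvec mu.
  case: (boolP (cong _ _ _)) => [/congP[z e]|_]; last by rewrite mul0r.
  case/negP: ny; apply/congP; exists (x + (2 * k)%N%:Z *: z).
  by rewrite e add0r k2M PoszM scalerDr scalerA.
rewrite exchange_boxsum; apply: eq_boxsum => x.
rewrite cE mulrC -boxsumZ.
rewrite -[RHS](boxsum_shift (- (V *m x)) K2); last first.
  move=> y z /(cong_mulmx U) yz; congr (_ * (nat_of_bool _)%:R).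
  have yz' : cong (2 * k * M) (U *m y) (U *m z).
    case/congP: yz => w ->; apply/congP; exists (M%:Z *: w).
    by rewrite kM mulnC PoszM scalerA.
  by apply/idP/idP; apply: cong_trans; rewrite // cong_sym.
apply: eq_boxsum => y; rewrite mulrC; congr (_ * (nat_of_bool _)%:R).
by rewrite [LHS]congB mulmxDr mulmxN mulmxA UV mul_scalar_mx.
Qed.

End Sublattice.

End GaussSums.

(** * Incomplete quadratic exponential sums in one variable *)

Section GaussSumDimensionOne.
Variable R : realType.
Implicit Types (x t : R) (n k m a b : nat).

Lemma abs_sin_le t : `|sin t| <= `|t|.
Proof.
wlog t0 : t / 0 <= t => [h|].
  have [|/ltW t0] := leP 0 t; first exact: h.
  by rewrite -normrN -sinN -[leRHS]normrN; apply: h; rewrite oppr_ge0.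
have [|c _] := MVT_segment t0 (fun x _ => is_derive_sin x).
  by apply: continuous_subspaceT => x; exact: continuous_sin.
by rewrite sin0 !subr0 => ->; rewrite normrM ler_piMl// cos_max.
Qed.

Lemma cabs_ee_sub1 x : cabs (ee x - 1) = `|2 * sin (pi * x)|.
Proof.
rewrite /cabs /ee /= subr0 -sqrtr_sqr; congr Num.sqrt.
have -> : 2 * pi * x = (pi * x) *+ 2 by ring.
rewrite cos_mulr2n sin_mulr2n; set s := sin _; set c := cos _.
have e : c ^+ 2 = 1 - s ^+ 2 by rewrite /c /s cos2sin2.
transitivity ((c ^+ 2 *+ 2 - 1 - 1) ^+ 2 + 4 * c ^+ 2 * s ^+ 2); first by ring.
by rewrite e; ring.
Qed.

Lemma pi_le4 : pi <= 4 :> R.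
Proof. by have [/andP[_ h] _] := pihalf_02_cos_pihalf R; lra. Qed.

Lemma cabs_ee_sub1_le x : cabs (ee x - 1) <= 8 * `|x|.
Proof.
rewrite cabs_ee_sub1 normrM (@ger0_norm _ 2)//.
apply: le_trans (_ : 2 * (pi * `|x|) <= _).
  by rewrite ler_wpM2l// (le_trans (abs_sin_le _))// normrM (ger0_norm (pi_ge0 R)).
by have := ler_wpM2r (normr_ge0 x) pi_le4; lra.
Qed.

Lemma cabs_ee_dist x y : cabs (ee x - ee y) <= 8 * `|x - y|.
Proof.
have -> : ee x - ee y = ee y * (ee (x - y) - 1).
  by rewrite mulrBr mulr1 -eeD [y + _]addrC subrK.
by rewrite cabsM cabs_ee mul1r cabs_ee_sub1_le.
Qed.

Lemma sin_pi4 : 1 / 2 <= sin (pi / 4) :> R /\ cos (pi / 4) = sin (pi / 4) :> R.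
Proof.
have p0 := @pi_gt0 R.
have e : cos (pi / 4) = sin (pi / 4) :> R.
  rewrite -[LHS]cosN -(@sinDpihalf R); congr sin; lra.
have s0 : 0 < sin (pi / 4) :> R by apply: sin_gt0_pi; apply/andP; split; lra.
split=> //; have := cos2Dsin2 (pi / 4 : R); rewrite e.
set s := sin _ in s0 *; rewrite leNgt => h; apply/negP => sh.
by have : s ^+ 2 < (1 / 2) * (1 / 2); [rewrite expr2 ltr_pM ?ltW | move: h; lra].
Qed.

(** A crude form of Jordan's inequality. Up to 1/4 the derivative of sine is at least 1/2 and pi is
    at least 2; beyond 1/4 sine is at least sin(pi/4), hence at least 1/2. *)
Lemma sin_pi_ge x : 0 < x <= 1 / 2 -> x <= sin (pi * x).
Proof.
move=> /andP[x0 xh]; have p0 := @pi_gt0 R; have p2 := @pi_ge2 R.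
have [s4 c4] := sin_pi4.
have [x4|x4] := leP x (1 / 4).
  have t0 : 0 <= pi * x by rewrite mulr_ge0// ltW.
  have [|c] := MVT_segment t0 (fun x _ => is_derive_sin x).
    by apply: continuous_subspaceT => y; exact: continuous_sin.
  rewrite sin0 !subr0 in_itv/= => /andP[c0 cx] ->.
  have cc : 1 / 2 <= cos c.
    apply: le_trans s4 _; rewrite -c4.
    have [->//|ne] := eqVneq c (pi / 4).
    have cp : c < pi / 4.
      rewrite lt_neqAle ne/=; apply: le_trans cx _.
      by have := ler_wpM2l (ltW p0) x4; lra.
    by apply: ltW; rewrite ltr_cos// in_itv/=; apply/andP; split; lra.
  apply: le_trans (_ : (1 / 2) * (pi * x) <= _); last by rewrite ler_wpM2r.
  by have := ler_wpM2r (ltW x0) p2; lra.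
have := xh; move/le_trans; apply; apply: le_trans s4 _; apply: ltW; rewrite ltr_sin.
- by rewrite ltr_pM2l//; lra.
- by rewrite in_itv/=; apply/andP; split; lra.
- rewrite in_itv/=; apply/andP; split; first by have := mulr_gt0 p0 x0; lra.
  by have := ler_wpM2l (ltW p0) xh; lra.
Qed.

Lemma cabs_ee_sub1_ge x : 0 < x <= 1 / 2 -> 2 * x <= cabs (ee x - 1).
Proof.
move=> hx; rewrite cabs_ee_sub1 normrM (@ger0_norm _ 2)// ler_wpM2l//.
by apply: le_trans (sin_pi_ge hx) _; exact: ler_norm.
Qed.

Lemma ee_neq1 x : 0 < x <= 1 / 2 -> ee x - 1 != 0.
Proof.
move=> hx; rewrite -cabs_eq0 gt_eqF//; apply: lt_le_trans (cabs_ee_sub1_ge hx).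
by case/andP: hx => x0 _; lra.
Qed.

Definition quad_ee n (j : nat) : R[i] := ee (j%:R ^+ 2 / (4 * n)%:R).

Section Tail.
Variable n : nat.
Hypothesis n0 : (0 < n)%N.
Let nR : 0 < n%:R :> R. Proof. by rewrite ltr0n. Qed.
Let nN : n%:R != 0 :> R. Proof. by rewrite gt_eqF. Qed.
(** The phase increment from [j] to [j.+1]. For [j < n] it lies in the interval from 0 to 1/2, where
    [ee (th j) - 1] is bounded below linearly. *)
Let th (j : nat) : R := (2 * j + 1)%:R / (4 * n)%:R.

Let thE j : th j = (2 * j%:R + 1) / (4 * n%:R).
Proof. by rewrite /th natrD !natrM. Qed.

Let th_itv j : (j < n)%N -> 0 < th j <= 1 / 2.
Proof.
have j0 : 0 <= j%:R :> R by [].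
rewrite -(ler_nat R) -natr1 thE => jn; apply/andP; split.
  by rewrite divr_gt0 ?mulr_gt0//; lra.
by rewrite ler_pdivrMr ?mulr_gt0//; lra.
Qed.

Let quad_eeS j : quad_ee n j.+1 - quad_ee n j = (ee (th j) - 1) * quad_ee n j.
Proof.
rewrite mulrBl mul1r -eeD; congr (ee _ - _).
by rewrite thE -natr1 natrM; field.
Qed.

Let c j := (ee (th j) - 1)^-1.

Let c_le j : (j < n)%N -> (0 < j)%N -> cabs (c j) <= n%:R / j%:R.
Proof.
move=> jn j0; have jR : 0 < j%:R :> R by rewrite ltr0n.
have h := th_itv jn.
have jn_le : j%:R / n%:R <= cabs (ee (th j) - 1).
  apply: le_trans (cabs_ee_sub1_ge h).
  have -> : 2 * th j = (j%:R + 1 / 2) / n%:R by rewrite thE; field.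
  by rewrite ler_pM2r ?invr_gt0//; lra.
by rewrite cabsV -invf_div lef_pV2// posrE ?divr_gt0// (lt_le_trans _ jn_le)// divr_gt0.
Qed.

(** The bound is written as a difference of reciprocals so that it telescopes. *)
Let c_dist j : (j.+1 < n)%N -> (0 < j)%N ->
  cabs (c j.+1 - c j) <= 4 * n%:R * (j%:R^-1 - j.+1%:R^-1).
Proof.
move=> jn j0; have jR : 0 < j%:R :> R by rewrite ltr0n.
have -> : c j.+1 - c j = c j.+1 * c j * (ee (th j) - ee (th j.+1)).
  by rewrite /c; field; rewrite !ee_neq1// th_itv// ltnW.
rewrite !cabsM.
apply: le_trans (_ : (n%:R / j.+1%:R) * (n%:R / j%:R) * (4 / n%:R) <= _).
  apply: ler_pM; rewrite ?mulr_ge0 ?cabs_ge0//.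
    by apply: ler_pM; rewrite ?cabs_ge0 ?c_le// ltnW.
  apply: le_trans (cabs_ee_dist _ _) _.
  have -> : th j - th j.+1 = - ((1 / 2) / n%:R).
    by rewrite !thE -natr1; field.
  by rewrite normrN ger0_norm ?divr_ge0//; rewrite mulrA ler_pM2r ?invr_gt0//; lra.
rewrite -natr1 le_eqVlt; apply/orP; left; apply/eqP; field.
by rewrite natr1 !pnatr_eq0 -!lt0n j0 n0.
Qed.

(* Summation by parts against [quad_ee j = c j * (quad_ee j.+1 - quad_ee j)]. *)
Lemma quad_ee_tail a b : (0 < a)%N -> (a <= b)%N -> (b <= n)%N ->
  cabs (\sum_(a <= j < b) quad_ee n j) <= 7 * n%:R / a%:R.
Proof.
move=> a0 ab bn; have aR : 0 < a%:R :> R by rewrite ltr0n.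
have uE j : (j < n)%N -> quad_ee n j = c j * (quad_ee n j.+1 - quad_ee n j).
  by move=> jn; rewrite quad_eeS mulrA mulVf ?mul1r// ee_neq1// th_itv.
have cu j m : cabs (c j * quad_ee n m) = cabs (c j) by rewrite cabsM cabs_ee mulr1.
(* The partial sum without its upper boundary term is bounded by the lower boundary term plus the
   telescoped variation of [c]. *)
have H d : (a + d < n)%N ->
    cabs (\sum_(a <= j < (a + d).+1) quad_ee n j - c (a + d) * quad_ee n (a + d).+1) <=
    n%:R / a%:R + 4 * n%:R * (a%:R^-1 - (a + d)%:R^-1).
  elim: d => [|d IH] adn.
    rewrite addn0 in adn *; rewrite big_nat1 subrr mulr0 addr0 {1}uE// mulrBr addrAC subrr.
    by rewrite add0r cabsN cu c_le.
  rewrite addnS in adn *; rewrite big_nat_recr ?leqW ?leq_addr//=.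
  set S := \sum_(_ <= _ < _) _ in IH *; set m := (a + d).+1 in adn IH *.
  have -> : S + quad_ee n m - c m * quad_ee n m.+1 =
      (S - c (a + d) * quad_ee n m) - (c m - c (a + d)) * quad_ee n m.
    by rewrite {1}(uE m)//; ring.
  apply: le_trans (cabsB _ _) _; rewrite cabsM cabs_ee mulr1.
  have m0 : (0 < a + d)%N by rewrite addn_gt0 a0.
  have := lerD (IH (ltnW adn)) (c_dist adn m0).
  by move/le_trans; apply; rewrite -/m; lra.
have [<-|ab'] := eqVneq a b.
  by rewrite big_geq// cabs0 divr_ge0// mulr_ge0.
have ltab : (a < b)%N by rewrite ltn_neqAle ab'.
have Eb : b = (a + (b.-1 - a)).+1 by lia.
have dn : (a + (b.-1 - a) < n)%N by lia.
have := H _ dn; rewrite -Eb; have -> : (a + (b.-1 - a) = b.-1)%N by lia.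
set S := \sum_(_ <= _ < _) _ => h.
have -> : S = (S - c b.-1 * quad_ee n b) + c b.-1 * quad_ee n b by ring.
apply: le_trans (cabsD _ _) _; rewrite cu.
have b1 : (0 < b.-1)%N by lia.
have cb : cabs (c b.-1) <= n%:R / a%:R.
  apply: le_trans (c_le _ b1) _; first by lia.
  by rewrite ler_pM2l// lef_pV2 ?posrE ?ltr0n// ler_nat; lia.
apply: le_trans (lerD h cb) _.
have bi : 0 <= b.-1%:R^-1 :> R by rewrite invr_ge0.
have := mulr_ge0 (ltW nR) bi; have : 0 <= n%:R / a%:R :> R by rewrite divr_ge0.
by rewrite -mulrA; lra.
Qed.
End Tail.

End GaussSumDimensionOne.

(** * The phase of the one-dimensional quadratic Gauss sum *)

Section QuadraticGaussSum.
Variable R : realType.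
Implicit Types (x t : R) (n k m a b : nat).

Local Notation quad_ee := (@quad_ee R).

Definition quad_gauss n : R[i] := \sum_(j < 2 * n) quad_ee n j.

Lemma boxsum_psi_diag N (W U : 'M[int]_N) n : is_diag_mx (U^T *m W *m U) ->
  boxsum (2 * n) (fun y : 'cV[int]_N => psi R W n (U *m y)) =
  \prod_v \sum_(j < 2 * n) ee (((U^T *m W *m U) v v * j%:Z ^+ 2)%:~R / (4 * n)%:R).
Proof.
move=> dU; rewrite -(boxsum_prod (2 * n) (fun v z =>
  ee (((U^T *m W *m U) v v * z ^+ 2)%:~R / (4 * n)%:R))).
apply: eq_boxsum => z; rewrite /psi qform_mulmx qform_diag// raddf_sum /= mulr_suml.
exact: ee_sum.
Qed.

Let gauss1E n : gauss R (1%:M : 'M[int]_1) n = quad_gauss n.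
Proof.
rewrite /gauss; have := @boxsum_psi_diag 1 1%:M 1%:M n.
rewrite trmx1 !mulmx1 big_ord1 mxE eqxx => h.
transitivity (boxsum (2 * n) (fun y : 'cV[int]_1 => psi R 1%:M n (1%:M *m y))).
  by apply: eq_boxsum => y; rewrite mul1mx.
rewrite h ?scalar_mx_is_diag//; apply: eq_bigr => j _.
by rewrite mul1r /quad_ee rmorphXn.
Qed.

Lemma quad_gauss_norm n : (0 < n)%N -> cabs (quad_gauss n) = Num.sqrt (2 * n)%:R.
Proof.
move=> n0; have := @gauss_norm R 1 1%:M (trmx1 _ _) (unitmx1 _ _) n n0.
by rewrite gauss1E expr1 => <-; rewrite sqrtr_sqr ger0_norm ?cabs_ge0.
Qed.

(** [gauss_sublattice] with [U = 1] and [V = M]; comparing moduli identifies the unknown natural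
    factor as [M]. *)
Lemma quad_gauss_mulsq k M : (0 < k)%N -> (0 < M)%N ->
  quad_gauss (k * M * M) = M%:R * quad_gauss k.
Proof.
move=> k0 M0.
have [c] := @gauss_sublattice R 1 1%:M (trmx1 _ _) (unitmx1 _ _) 1%:M M%:Z%:M M k
  (mul1mx _) M0 k0.
have -> : boxsum (2 * (k * M * M)) (fun y : 'cV[int]_1 => psi R 1%:M (k * M * M) (1%:M *m y)) =
    gauss R (1%:M : 'M[int]_1) (k * M * M).
  by apply: eq_boxsum => y; rewrite mul1mx.
rewrite !gauss1E => e; rewrite e; congr (_ * _).
have := quad_gauss_norm (_ : 0 < k * M * M)%N; rewrite e cabsM cabs_nat quad_gauss_norm//.
have -> : (2 * (k * M * M))%:R = M%:R ^+ 2 * (2 * k)%:R :> R by rewrite !natrM; ring.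
rewrite sqrtrM ?sqr_ge0// sqrtr_sqr normr_nat !muln_gt0 k0 M0 => /(_ isT)/mulIf h.
congr (_%:R); apply/eqP; rewrite -(eqr_nat R); apply/eqP/h.
by rewrite sqrtr_eq0 -ltNge ltr0n muln_gt0.
Qed.

(** The reflection of [j] to [2 * n - j] preserves the terms. Its fixed points 0 and [n] occur only
    once, which accounts for the correction [- 1 + quad_ee n n]. *)
Lemma quad_gauss_split n : (0 < n)%N ->
  quad_gauss n = 2 * \sum_(0 <= j < n) quad_ee n j - 1 + quad_ee n n.
Proof.
move=> n0; have nN : n%:R != 0 :> R by rewrite pnatr_eq0 -lt0n.
have e0 : quad_ee n 0 = 1 by rewrite /quad_ee/= expr0n mul0r ee0.
have hS : \sum_(0 <= j < n) quad_ee n j.+1 = \sum_(0 <= j < n) quad_ee n j - 1 + quad_ee n n.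
  have : \sum_(0 <= j < n.+1) quad_ee n j = 1 + \sum_(0 <= j < n) quad_ee n j.+1.
    by rewrite big_nat_recl// e0.
  by rewrite big_nat_recr//= addrAC => ->; ring.
have h2 : \sum_(n <= j < 2 * n) quad_ee n j = \sum_(0 <= j < n) quad_ee n j.+1.
  rewrite -{1}[n]add0n big_addn big_nat_rev/=.
  have -> : (2 * n - n = n)%N by lia.
  rewrite !big_nat; apply: eq_bigr => j /andP[_ jn].
  have -> : (0 + n - j.+1 + n = 2 * n - j.+1)%N by lia.
  rewrite /quad_ee natrB; last by lia.
  rewrite natrM.
  have -> : (2 * n%:R - j.+1%:R) ^+ 2 / (4 * n)%:R =
      j.+1%:R ^+ 2 / (4 * n)%:R + ((n%:Z - j.+1%:Z)%:~R) :> R.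
    by rewrite natrM intrB -!pmulrn; field.
  by rewrite eeD ee_int mulr1.
rewrite /quad_gauss -(big_mkord xpredT (quad_ee n)) (@big_cat_nat _ _ _ n)//=; last by lia.
by rewrite h2 hS; ring.
Qed.

(** If [a] is a large multiple of the square root of [n], this error is small against the modulus
    [Num.sqrt (2 * n)%:R] of the whole sum. *)
Lemma quad_gauss_approx n a : (0 < a)%N -> (a <= n)%N ->
  cabs (quad_gauss n - 2 * \sum_(0 <= j < a) quad_ee n j) <= 14 * n%:R / a%:R + 2.
Proof.
move=> a0 an; have n0 : (0 < n)%N by apply: leq_trans an.
rewrite quad_gauss_split// (@big_cat_nat _ _ _ a 0 n)//=.
set S := \sum_(0 <= j < a) _; set T := \sum_(a <= j < n) _.
have -> : 2 * (S + T) - 1 + quad_ee n n - 2 * S = 2 * T - (1 - quad_ee n n) by ring.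
apply: le_trans (cabsB _ _) _; apply: lerD; last first.
  by apply: le_trans (cabsB _ _) _; rewrite cabs1 cabs_ee; lra.
rewrite cabsM cabs_nat.
have h := quad_ee_tail R n0 a0 an (leqnn n).
by have := ler_wpM2l (ler0n R 2) h; rewrite -/T; lra.
Qed.

Lemma quad_sum_dist n m a : (0 < m)%N -> (m <= n)%N ->
  cabs (\sum_(0 <= j < a) quad_ee n j - \sum_(0 <= j < a) quad_ee m j) <=
  2 * a%:R ^+ 3 * (n - m)%:R / (n%:R * m%:R).
Proof.
move=> m0 mn; have n0 : (0 < n)%N by apply: leq_trans mn.
have nR : 0 < n%:R :> R by rewrite ltr0n.
have mR : 0 < m%:R :> R by rewrite ltr0n.
rewrite -sumrB; apply: le_trans (cabs_sum _ _ _) _.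
apply: le_trans (_ : \sum_(0 <= j < a) 2 * a%:R ^+ 2 * ((n - m)%:R / (n%:R * m%:R)) <= _).
  rewrite !big_nat; apply: ler_sum => j /andP[_ ja].
  apply: le_trans (cabs_ee_dist _ _) _.
  have -> : j%:R ^+ 2 / (4 * n)%:R - j%:R ^+ 2 / (4 * m)%:R =
     - (j%:R ^+ 2 / 4 * ((n - m)%:R / (n%:R * m%:R))) :> R.
    by rewrite natrB// !natrM; field; rewrite !gt_eqF.
  rewrite normrN ger0_norm ?mulr_ge0 ?divr_ge0 ?sqr_ge0 ?mulr_ge0//.
  rewrite [leLHS]mulrA ler_wpM2r ?divr_ge0 ?mulr_ge0//.
  have : (j%:R : R) ^+ 2 <= a%:R ^+ 2 by rewrite lerXn2r ?nnegrE ?ler_nat// ltnW.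
  by lra.
rewrite sumr_const_nat subn0 -mulr_natr le_eqVlt; apply/orP; left; apply/eqP.
by field; rewrite !gt_eqF.
Qed.

Lemma sqrt_nat_floor n : exists m, (m * m <= n < m.+1 * m.+1)%N.
Proof.
elim: n => [|n [m /andP[h1 h2]]]; first by exists 0%N.
have [e|ne] := eqVneq n.+1 (m.+1 * m.+1)%N.
  by exists m.+1; apply/andP; split; [rewrite e | rewrite e; nia].
by exists m; apply/andP; split; [exact: leqW | rewrite ltn_neqAle ne].
Qed.

(** The phase of the Gauss sum: the denominator is its modulus by [quad_gauss_norm]. *)
Let gam n : R[i] := quad_gauss n / (Num.sqrt (2 * n)%:R)%:C%C.

Let gam_mulsq k M : (0 < k)%N -> (0 < M)%N -> gam (k * M * M) = gam k.
Proof.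
move=> k0 M0; rewrite /gam quad_gauss_mulsq//.
have -> : (2 * (k * M * M))%:R = M%:R ^+ 2 * (2 * k)%:R :> R by rewrite !natrM; ring.
rewrite sqrtrM ?sqr_ge0// sqrtr_sqr normr_nat rmorphM/= rmorph_nat.
rewrite invfM mulrACA divff ?mul1r// pnatr_eq0 -lt0n//.
Qed.

(* [gam] is constant along [n = k M^2], and two consecutive such sequences
   come relatively close to each other. *)
Let gam_close k L : (0 < k)%N -> (0 < L)%N ->
  cabs (gam k - gam 1) <= 200 / L%:R.
Proof.
(* The fourth power ensures [m >= L ^ 4] for the integer square root [m] of [n]. Cutting the sums at
   [a = L * m] costs O(1/L), and passing from level [n] to [m * m], at distance at most [2 * m],
   costs O(L^3 / m). *)
move=> k0 L0; pose M := (L ^ 4)%N; have M0 : (0 < M)%N by rewrite expn_gt0 L0.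
set n := (k * M * M)%N.
have [m /andP[m1 m2]] := sqrt_nat_floor n.
have mM : (M <= m)%N.
  rewrite leqNgt; apply/negP => mM.
  have : (m.+1 * m.+1 <= M * M)%N by apply: leq_mul.
  have : (M * M <= n)%N by rewrite /n -mulnA leq_pmull.
  by lia.
have m2' : (n <= m * m + 2 * m)%N.
  by move: m2; rewrite mulSn mulnS; clearbody n; clear; lia.
have Lm : (L <= m)%N by apply: leq_trans mM; rewrite /M -[leqLHS]expn1 leq_pexp2l.
rewrite -(gam_mulsq k0 M0) -/n -(@gam_mulsq 1 m)//; last by lia.
rewrite mul1n; set n' := (m * m)%N.
have n'0 : (0 < n')%N by rewrite muln_gt0; lia.
have n0 : (0 < n)%N by lia.
pose a := (L * m)%N.
have a0 : (0 < a)%N by rewrite muln_gt0; lia.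
have an' : (a <= n')%N by rewrite leq_mul.
pose P := 2 * \sum_(0 <= j < a) quad_ee n j; pose P' := 2 * \sum_(0 <= j < a) quad_ee n' j.
have hP : cabs (quad_gauss n - P) <= 14 * n%:R / a%:R + 2.
  by apply: quad_gauss_approx => //; lia.
have hP' : cabs (quad_gauss n' - P') <= 14 * n'%:R / a%:R + 2.
  exact: quad_gauss_approx.
have hPP : cabs (P - P') <= 2 * (2 * a%:R ^+ 3 * (n - n')%:R / (n%:R * n'%:R)).
  by rewrite -mulrBr cabsM cabs_nat ler_wpM2l// quad_sum_dist.
have hP'1 : cabs P' <= 2 * a%:R.
  rewrite cabsM cabs_nat ler_wpM2l//; apply: le_trans (cabs_sum _ _ _) _.
  rewrite (eq_bigr (fun=> 1)) => [|j _]; last by rewrite cabs_ee.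
  by rewrite sumr_const_nat subn0.
have LR : 0 < L%:R :> R by rewrite ltr0n.
have mR : 0 < m%:R :> R by rewrite ltr0n; lia.
have Lm1 : L%:R <= m%:R :> R by rewrite ler_nat.
have Lm4 : L%:R ^+ 4 <= m%:R :> R by rewrite -natrX ler_nat.
have L1 : 1 <= L%:R :> R by rewrite ler1n.
have n'E : n'%:R = m%:R ^+ 2 :> R by rewrite natrM expr2.
have nn' : m%:R ^+ 2 <= n%:R :> R by rewrite -n'E ler_nat.
have n4 : n%:R <= 4 * m%:R ^+ 2 :> R.
  have : (n <= 4 * (m * m))%N.
    apply: leq_trans m2' _; have : (m <= m * m)%N by rewrite leq_pmull// (leq_trans L0).
    by clear; lia.
  by rewrite -(ler_nat R) !natrM expr2.
have ndif : (n - n')%:R <= 2 * m%:R :> R by rewrite -natrM ler_nat /n' leq_subLR.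
have aE : a%:R = L%:R * m%:R :> R by rewrite natrM.
pose r : R := Num.sqrt (2 * n)%:R; pose r' : R := Num.sqrt (2 * n')%:R.
have r2 : r ^+ 2 = 2 * n%:R by rewrite sqr_sqrtr// natrM.
have r2' : r' ^+ 2 = 2 * m%:R ^+ 2 by rewrite sqr_sqrtr// natrM n'E.
have rm' : m%:R <= r'.
  by rewrite -(@ler_pXn2r _ 2) ?nnegrE ?sqrtr_ge0// r2'; have := sqr_ge0 (m%:R : R); lra.
have rr' : r' <= r by rewrite ler_wsqrtr// ler_nat leq_mul2l.
have rm : m%:R <= r by apply: le_trans rr'.
have r0 : 0 < r by apply: lt_le_trans rm.
have r0' : 0 < r' by apply: lt_le_trans rm'.
have rd : r - r' <= 2.
  have e : (r - r') * (r + r') = 2 * (n - n')%:R.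
    by rewrite natrB// n'E -subr_sqr r2 r2'; ring.
  rewrite leNgt; apply/negP => h.
  have : 2 * (2 * m%:R) < (r - r') * (r + r') by rewrite ltr_pM//; lra.
  by rewrite e; lra.
have invB (x y B : R) : 0 <= x -> x <= B -> m%:R <= y -> x / y <= B / m%:R.
  move=> x0 xB my; apply: ler_pM => //; first by rewrite invr_ge0; apply: le_trans my; exact: ltW.
  by rewrite lef_pV2// posrE//; apply: lt_le_trans my.
(* Four errors: the tail at level [n], the change of level in the cut sum, the change of
   normalisation, and the tail at level [n']. *)
have -> : gam n - gam n' = (quad_gauss n - P) / r%:C%C + (P - P') / r%:C%C
     + P' * (r%:C%C^-1 - r'%:C%C^-1) - (quad_gauss n' - P') / r'%:C%C.
  by rewrite /gam -/r -/r'; ring.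
have cabsr (t : R) : 0 < t -> cabs (t%:C%C^-1) = t^-1.
  by move=> t0; rewrite cabsV cabs_real gtr0_norm.
apply: le_trans (cabsB _ _) _; apply: le_trans (lerD (cabsD _ _) (lexx _)) _.
apply: le_trans (lerD (lerD (cabsD _ _) (lexx _)) (lexx _)) _.
rewrite ![cabs (_ / _)]cabsM [cabs (P' * _)]cabsM !cabsr//.
have m1L : m%:R^-1 <= L%:R^-1 :> R by rewrite lef_pV2.
have T1 : cabs (quad_gauss n - P) / r <= 58 / L%:R.
  apply: le_trans (invB _ _ _ (cabs_ge0 _) hP rm) _.
  apply: le_trans (_ : 56 / L%:R + 2 / m%:R <= _); last by lra.
  have -> : 56 / L%:R + 2 / m%:R = (56 * (m%:R / L%:R) + 2) / m%:R :> R.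
    by field; rewrite !gt_eqF.
  rewrite ler_pM2r ?invr_gt0// lerD2r aE.
  have -> : 56 * (m%:R / L%:R) = 14 * (4 * m%:R ^+ 2) / (L%:R * m%:R) :> R.
    by field; rewrite !gt_eqF.
  by rewrite ler_pM2r ?invr_gt0 ?mulr_gt0//; lra.
have T4 : cabs (quad_gauss n' - P') / r' <= 16 / L%:R.
  apply: le_trans (invB _ _ _ (cabs_ge0 _) hP' rm') _.
  apply: le_trans (_ : 14 / L%:R + 2 / m%:R <= _); last by lra.
  rewrite aE n'E le_eqVlt; apply/orP; left; apply/eqP.
  by field; rewrite !gt_eqF.
have mL4 : m%:R^-1 <= (L%:R ^+ 4)^-1 :> R by rewrite lef_pV2 ?posrE ?exprn_gt0.
have T2 : cabs (P - P') / r <= 8 / L%:R.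
  apply: le_trans (invB _ _ (8 * L%:R ^+ 3) (cabs_ge0 _) _ rm) _.
    apply: le_trans hPP _; rewrite n'E aE.
    apply: le_trans (_ : 4 * (L%:R * m%:R) ^+ 3 * (2 * m%:R) / (m%:R ^+ 2 * m%:R ^+ 2) <= _).
      rewrite !mulrA; apply: ler_pM; rewrite ?mulr_ge0 ?exprn_ge0 ?invr_ge0 ?mulr_ge0 ?exprn_ge0
        ?(ltW LR)//.
        have -> : 2 * 2 = 4 :> R by ring.
        by rewrite -[leRHS]mulrA ler_wpM2l ?mulr_ge0 ?exprn_ge0 ?mulr_ge0 ?(ltW LR)//.
      have mm : 0 < m%:R * m%:R :> R by rewrite mulr_gt0.
      rewrite -[n%:R * _ * _]mulrA -[m%:R ^+ 2 * _ * _]mulrA lef_pV2.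
      - by rewrite ler_pM2r.
      - by rewrite posrE mulr_gt0// ltr0n.
      - by rewrite posrE mulr_gt0// exprn_gt0.
    rewrite le_eqVlt; apply/orP; left; apply/eqP.
    by field; rewrite !gt_eqF.
  have := ler_wpM2l (_ : 0 <= 8 * L%:R ^+ 3) mL4.
  rewrite mulr_ge0 ?exprn_ge0 ?(ltW LR)// => /(_ isT)/le_trans; apply.
  by rewrite le_eqVlt; apply/orP; left; apply/eqP; field; rewrite !gt_eqF.
have T3 : cabs P' * cabs (r%:C%C^-1 - r'%:C%C^-1) <= 4 / L%:R.
  have -> : r%:C%C^-1 - r'%:C%C^-1 = (r^-1 - r'^-1)%:C%C by rewrite rmorphB !fmorphV.
  rewrite cabs_real distrC ger0_norm; last by rewrite subr_ge0 lef_pV2.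
  have -> : r'^-1 - r^-1 = (r - r') / (r' * r) by field; rewrite !gt_eqF.
  apply: le_trans (_ : (2 * (L%:R * m%:R)) * (2 / (m%:R * m%:R)) <= _).
    apply: ler_pM; rewrite ?cabs_ge0 ?divr_ge0 ?mulr_ge0 ?subr_ge0 ?(ltW r0) ?(ltW r0') -?aE//.
    apply: ler_pM; rewrite ?subr_ge0 ?invr_ge0 ?mulr_ge0 ?(ltW r0) ?(ltW r0')//.
    by rewrite lef_pV2 ?posrE ?mulr_gt0// ler_pM// ltW.
  have -> : 2 * (L%:R * m%:R) * (2 / (m%:R * m%:R)) = 4 * L%:R * m%:R^-1 :> R.
    by field; rewrite !gt_eqF.
  have := ler_wpM2l (_ : 0 <= 4 * L%:R :> R) mL4.
  rewrite mulr_ge0 ?(ltW LR)// => /(_ isT)/le_trans; apply.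
  have -> : 4 * L%:R / L%:R ^+ 4 = 4 / L%:R * (L%:R ^+ 2)^-1 :> R by field; rewrite !gt_eqF.
  rewrite ler_piMr ?divr_ge0 ?(ltW LR)//.
  by rewrite invf_le1 ?exprn_gt0// exprn_ege1.
by have : 0 <= L%:R^-1 :> R; [rewrite invr_ge0 ltW | lra].
Qed.

(** Letting [L] grow in [gam_close] shows that the phase is that of level 1, where the sum is 1 +
    i. *)
Theorem quad_gaussE k : (0 < k)%N ->
  quad_gauss k = (Num.sqrt (2 * k)%:R)%:C%C * ee (1 / 8).
Proof.
move=> k0.
have g1 : quad_gauss 1 = (Num.sqrt (2 * 1)%:R)%:C%C * ee (1 / 8 : R).
  have [s4 c4] := @sin_pi4 R.
  have := cos2Dsin2 (pi / 4 : R); rewrite c4 => e.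
  rewrite /quad_gauss big_ord_recl big_ord1 /quad_ee /= expr0n mul0r ee0 muln1.
  rewrite expr1n /ee.
  have -> : 2 * pi * (1 / 4%:R) = pi / 2 :> R by field.
  have -> : 2 * pi * (1 / 8) = pi / 4 :> R by field.
  rewrite cos_pihalf sin_pihalf c4.
  have -> : sin (pi / 4) = (Num.sqrt 2%:R)^-1 :> R.
    apply/eqP; rewrite -(@eqrXn2 _ 2) ?invr_ge0 ?sqrtr_ge0//; last by lra.
    by rewrite exprVn sqr_sqrtr//; apply/eqP; lra.
  by apply/eqP; rewrite eq_complex /= !mul0r subr0 addr0 divff ?sqrtr_eq0 -?ltNge// addr0 add0r
    eqxx.
have S0 j : (0 < j)%N -> (Num.sqrt (2 * j)%:R : R)%:C%C != 0.
  move=> j0; rewrite (eq_complex) /= eqxx andbT sqrtr_eq0 -ltNge ltr0n muln_gt0//.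
have : cabs (gam k - gam 1) <= 0.
  apply/ler_addgt0Pr => eps e0; rewrite add0r.
  pose L := (Num.truncn (200 / eps)).+1.
  apply: le_trans (gam_close k0 (ltn0Sn _ : 0 < L)%N) _.
  rewrite ler_pdivrMr ?ltr0n// mulrC -ler_pdivrMr//.
  by apply: ltW; rewrite truncnS_gt.
rewrite le_eqVlt ltNge cabs_ge0 orbF cabs_eq0 subr_eq0 /gam g1 => /eqP e.
apply: (mulIf (invr_neq0 (S0 _ k0))); rewrite e [RHS]mulrAC [_ * ee _]mulrC.
by rewrite (mulfK (S0 1%N isT)) (mulfV (S0 _ k0)) !mul1r.
Qed.

End QuadraticGaussSum.

(** * The Gauss sum of a negative definite unimodular form *)

Section GaussSumOfUnimodularForm.
Variable R : realType.

Lemma sum_periodic (V : nmodType) (f : nat -> V) d n : (forall j, f (j + n)%N = f j) ->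
  \sum_(j < d * n) f j = (\sum_(j < n) f j) *+ d.
Proof.
move=> fn; elim: d => [|d IH]; first by rewrite mul0n big_ord0 mulr0n.
rewrite mulSn -(big_mkord xpredT f) (@big_cat_nat _ _ _ n)//= ?leq_addr//.
rewrite -{2}[n]add0n big_addn addnC addnK !big_mkord mulrS; congr (_ + _).
by rewrite -IH; apply: eq_bigr => j _; rewrite fn.
Qed.

(** After cancelling [D] the sum runs [D] times over a period of the conjugate one-dimensional Gauss
    sum of level [K]. *)
Lemma sum_quad_eeN (D K : nat) : (0 < D)%N -> (0 < K)%N ->
  \sum_(j < 2 * (D * K)) ee ((- D%:Z * j%:Z ^+ 2)%:~R / (4 * (D * K))%:R : R) =
  (D%:R * Num.sqrt (2 * K)%:R)%:C%C * ee (- (1 / 8)).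
Proof.
move=> D0 K0; have DR : D%:R != 0 :> R by rewrite pnatr_eq0 -lt0n.
have KR : K%:R != 0 :> R by rewrite pnatr_eq0 -lt0n.
rewrite mulnCA.
rewrite (eq_bigr (fun j : 'I_(D * (2 * K)) => (quad_ee R K j)^*%C)); last first.
  move=> j _; rewrite conj_ee; congr ee.
  by rewrite intrM !natrM rmorphXn/= rmorphN/= -!pmulrn; field; rewrite DR KR.
rewrite (@sum_periodic _ (fun j => (quad_ee R K j)^*%C)) => [|j]; last first.
  congr (_^*%C); rewrite /quad_ee natrD !natrM.
  have -> : (j%:R + 2 * K%:R) ^+ 2 / (4 * K%:R) =
      j%:R ^+ 2 / (4 * K%:R) + ((j%:Z + K%:Z)%:~R) :> R.
    by rewrite intrD -!pmulrn; field.
  by rewrite eeD ee_int mulr1.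
rewrite -(rmorph_sum (@conjc R)) /= -[X in X^*%C *+ _]/(quad_gauss R K) quad_gaussE//.
rewrite rmorphM [X in X *+ _](_ : _ = (Num.sqrt (2 * K)%:R)%:C%C * ee (- (1 / 8))); last first.
  by congr (_ * _); [exact: conjc_real | exact: conj_ee].
by rewrite -[LHS]mulr_natl mulrA rmorphM rmorph_nat.
Qed.

(** On a sublattice where the form is diagonal, the Gauss sum of level [k * M * M] is a product of
    one-dimensional ones, hence a positive number times e(-N/8). It is also a natural multiple of
    [gauss R W k], which therefore has the same phase; its modulus is known from [gauss_norm]. *)
Lemma gauss_negdef N (W : 'M[int]_N) k : W^T = W -> W \in unitmx -> posdef (- W) ->
  (0 < k)%N -> gauss R W k = (Num.sqrt (2 * k)%:R)%:C%C ^+ N * ee (- (N%:R / 8)).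
Proof.
move=> sW uW pW k0.
have sA : (- W)^T = - W by rewrite linearN /= sW.
have [U dU dA] := posdef_diagonalize sA pW.
set B := U^T *m _ *m U in dA.
have BE : U^T *m W *m U = - B by rewrite /B mulmxN mulNmx opprK.
have B0 v : 0 < B v v.
  have := pW (U *m delta_mx v 0); rewrite qform_mulmx -/B qform_diag//.
  rewrite (bigD1 v)//= big1 => [|w wv]; last by rewrite [delta_mx _ _ _ _]mxE (negbTE wv) expr0n
    mulr0.
  rewrite [delta_mx _ _ _ _]mxE !eqxx expr1n mulr1 addr0; apply;
    apply/eqP => /(congr1 (mulmx (\adj U))).
  rewrite mulmxA mul_adj_mx mulmx0 mul_scalar_mx => /matrixP/(_ v 0).
  by rewrite !mxE !eqxx mulr1 => /eqP; rewrite (negbTE dU).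
pose D v := `|B v v|%N.
have DE v : B v v = D v by rewrite gez0_abs// ltW.
have D0 v : (0 < D v)%N by rewrite absz_gt0 gt_eqF.
(* The factor [P] of [M] makes every diagonal entry [D v] divide [K]; the factor [|det U|] makes
   [V], which is [M] times the inverse of [U], integral. *)
pose P := (\prod_v D v)%N; have P0 : (0 < P)%N by rewrite prodn_gt0.
pose M := (`|\det U| * P)%N; have M0 : (0 < M)%N by rewrite muln_gt0 absz_gt0 dU.
pose V := (Num.sg (\det U) * P%:Z) *: \adj U.
have UV : U *m V = M%:Z%:M.
  rewrite /V -scalemxAr mul_mx_adj -scalemx1 scalerA mulrAC -normrEsg.
  by rewrite -abszE scalemx1 /M PoszM.
have [c] := gauss_sublattice R sW uW UV M0 k0.
set K := (k * M * M)%N.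
have K0 : (0 < K)%N by rewrite /K !(muln_gt0 _ M) k0 M0.
have DK v : K = (D v * (K %/ D v))%N.
  rewrite mulnC divnK// /K dvdn_mull// /M dvdn_mull// /P.
  by rewrite (bigD1 v)//= dvdn_mulr.
rewrite boxsum_psi_diag ?BE; last first.
  by apply/is_diag_mxP => i j ij; move/is_diag_mxP: dA => h; rewrite mxE h// oppr0.
have F v : \sum_(j < 2 * K) ee (((- B) v v * j%:Z ^+ 2)%:~R / (4 * K)%:R : R) =
    ((D v)%:R * Num.sqrt (2 * (K %/ D v))%:R)%:C%C * ee (- (1 / 8)).
  rewrite mxE DE; move: (DK v); move: (K %/ D v)%N => K' KE.
  have K'0 : (0 < K')%N by move: K0; rewrite KE muln_gt0 => /andP[].
  by rewrite KE sum_quad_eeN.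
rewrite (eq_bigr _ (fun v _ => F v)) big_split /= prodr_const card_ord.
rewrite -rmorph_prod /=; set r := \prod_v _.
have r0 : 0 < r.
  apply: prodr_gt0 => v _; rewrite mulr_gt0 ?ltr0n ?D0// sqrtr_gt0 ltr0n muln_gt0/=.
  by rewrite divn_gt0// dvdn_leq// [X in (_ %| X)%N](DK v) dvdn_mulr.
rewrite -eeMn.
have -> : - (1 / 8) *+ N = - (N%:R / 8) :> R by rewrite -mulr_natr; ring.
move=> e.
have c0 : c%:R != 0 :> R.
  apply/eqP => c0; move/(congr1 (@cabs R)): e.
  by rewrite !cabsM cabs_ee cabs_real cabs_nat c0 mul0r mulr1 gtr0_norm// => r00;
    rewrite r00 ltxx in r0.
have cC : c%:R != 0 :> R[i] by move: c0; rewrite !pnatr_eq0.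
have {}e : gauss R W k = (r / c%:R)%:C%C * ee (- (N%:R / 8)).
  apply: (mulfI cC); rewrite -e rmorphM fmorphV rmorph_nat mulrA mulrCA.
  by rewrite divff ?mulr1.
have := gauss_norm R sW uW k0; rewrite e cabsM cabs_ee mulr1 cabs_real.
have rc : 0 < r / c%:R by rewrite divr_gt0// lt0r c0 ler0n.
rewrite gtr0_norm// => e2; congr (_ * _); rewrite -rmorphXn /=; congr (_%:C%C).
apply/eqP; rewrite -(@eqrXn2 _ 2)// ?ltW ?exprn_ge0 ?sqrtr_ge0// e2.
by rewrite exprAC sqr_sqrtr.
Qed.

End GaussSumOfUnimodularForm.

(** * Unconditional sums over lattices *)

Section UnconditionalSums.
Variables (R : realType).
Local Open Scope fset_scope.
Local Open Scope ring_scope.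

(** Convergence along the net of finite subsets. Unlike an equation for [summability.sum], it also
    records that the limit exists. *)
Definition has_sum (I : choiceType) (f : I -> R[i]) (S : R[i]) : Prop :=
  summability.partial_sum f @ summability.totally --> S.

Lemma has_sumP (I : choiceType) (f : I -> R[i]) S : has_sum f S <->
  forall e : R, 0 < e -> exists A : {fset I}, forall B : {fset I}, (A `<=` B)%fset ->
    cabs (\sum_(i <- B) f i - S) <= e.
Proof.
have FF := @summability.totally_filter I.
rewrite /has_sum; split => [/(cvg_cabsP _ _ _).1 h e e0|h].
  have [A _ hA] := h e e0; exists A => B AB.
  by have := hA B AB; rewrite /summability.partial_sum big_seq_fsetE.
apply/(cvg_cabsP _ _ _).2 => e e0; have [A hA] := h e e0.
exists A => // B AB; have := hA B AB.
by rewrite /summability.partial_sum big_seq_fsetE.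
Qed.

Lemma has_sum_csum (I : choiceType) (f : I -> R[i]) S : has_sum f S ->
  summability.sum f = S.
Proof.
have FF := @summability.totally_filter I.
by move=> h; apply: (@cvg_lim R[i]) h.
Qed.

(** For nonnegative [M] this is summability with total at most [B], the form in which majorants are
    used throughout. *)
Definition bounded_sums (I : choiceType) (M : I -> R) (B : R) : Prop :=
  forall A : {fset I}, \sum_(i <- A) M i <= B.

Lemma sum_fset_setD (V : zmodType) (I : choiceType) (f : I -> V) (A B : {fset I}) :
  (A `<=` B)%fset -> \sum_(i <- B) f i - \sum_(i <- A) f i = \sum_(i <- (B `\` A)%fset) f i.
Proof.
move=> AB; rewrite (big_fsetID _ (mem A) B)/=.
have -> : [fset x in B | x \in A]%fset = A.
  apply/fsetP => x; rewrite !inE /= andbC; case: (boolP (x \in A)) => //= xA.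
  by rewrite (fsubsetP AB).
have -> : [fset x in B | x \notin A]%fset = (B `\` A)%fset.
  by apply/fsetP => x; rewrite !inE /= andbC.
by rewrite addrAC subrr add0r.
Qed.

Lemma bounded_sums_tail (I : choiceType) (M : I -> R) (B : R) : (forall i, 0 <= M i) ->
  bounded_sums M B -> forall e, 0 < e -> exists A : {fset I},
  forall C : {fset I}, (A `<=` C)%fset -> \sum_(i <- (C `\` A)%fset) M i <= e.
Proof.
move=> M0 MB e e0; pose E := [set x | exists A : {fset I}, x = \sum_(i <- A) M i].
have hE : has_sup E.
  split; first by exists (\sum_(i <- (fset0 : {fset I})) M i), fset0.
  by exists B => _ [A ->].
have [_ [A ->] hA] := sup_adherent e0 hE.
exists A => C AC; rewrite -sum_fset_setD//.
have : \sum_(i <- C) M i <= sup E by apply: (sup_upper_bound hE); exists C.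
by move: hA; lra.
Qed.

Lemma real_sum_ex (I : choiceType) (f : I -> R) (M : I -> R) (B : R) :
  (forall i, `|f i| <= M i) -> bounded_sums M B -> exists S : R,
  forall e : R, 0 < e -> exists A : {fset I}, forall C : {fset I}, (A `<=` C)%fset ->
    `|\sum_(i <- C) f i - S| <= e.
Proof.
move=> fM MB; have M0 i : 0 <= M i by apply: le_trans (fM i).
have FF := @summability.totally_filter I.
pose F := (fun A : {fset I} => \sum_(i <- A) f i) @ summability.totally.
have cF : cauchy F.
  apply: cauchy_exP => e e0; have e2 : 0 < e / 2 by rewrite divr_gt0.
  have [A hA] := bounded_sums_tail M0 MB e2.
  exists (\sum_(i <- A) f i); exists A => // C /= AC.
  rewrite /ball /= distrC sum_fset_setD//.
  apply: le_lt_trans (ler_norm_sum _ _ _) _.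
  apply: le_lt_trans (_ : e / 2 < e); last by lra.
  by apply: le_trans (hA C AC); apply: ler_sum.
have : cvg F by apply: cauchy_cvg.
case/cvg_ex => S /cvgrPdist_le h; exists S => e e0.
have [A _ hA] := h _ e0; exists A => C AC.
by rewrite distrC; exact: (hA C AC).
Qed.

Lemma has_sum_ex (I : choiceType) (f : I -> R[i]) (M : I -> R) (B : R) :
  (forall i, cabs (f i) <= M i) -> bounded_sums M B -> exists S, has_sum f S.
Proof.
move=> fM MB.
have [|S1 h1] := @real_sum_ex I (fun i => complex.Re (f i)) M B _ MB.
  by move=> i; apply: le_trans (fM i); exact: Re_le_cabs.
have [|S2 h2] := @real_sum_ex I (fun i => complex.Im (f i)) M B _ MB.
  by move=> i; apply: le_trans (fM i); exact: Im_le_cabs.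
exists (Complex S1 S2); apply/has_sumP => e e0.
have e2 : 0 < e / 2 by rewrite divr_gt0.
have [A1 hA1] := h1 _ e2; have [A2 hA2] := h2 _ e2.
exists (A1 `|` A2)%fset => C; rewrite fsubUset => /andP[/hA1 k1 /hA2 k2].
apply: le_trans (cabs_le_ReIm _) _; rewrite [leRHS](_ : e = e / 2 + e / 2); last by field.
apply: lerD; [move: k1|move: k2].
  by rewrite (_ : complex.Re _ = \sum_(i <- C) complex.Re (f i) - S1)//;
    rewrite raddfB/= (raddf_sum (@complex.Re R)).
by rewrite (_ : complex.Im _ = \sum_(i <- C) complex.Im (f i) - S2)//; rewrite raddfB/= raddf_sum.
Qed.

Lemma has_sum_unique (I : choiceType) (f : I -> R[i]) S S' :
  has_sum f S -> has_sum f S' -> S = S'.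
Proof. by move=> /has_sum_csum <- /has_sum_csum <-. Qed.

Lemma eq_has_sum (I : choiceType) (f g : I -> R[i]) S : f =1 g -> has_sum f S -> has_sum g S.
Proof. by move=> /funext ->. Qed.

Lemma has_sumD (I : choiceType) (f g : I -> R[i]) S T :
  has_sum f S -> has_sum g T -> has_sum (fun i => f i + g i) (S + T).
Proof.
move=> /has_sumP hf /has_sumP hg; apply/has_sumP => e e0.
have e2 : 0 < e / 2 by rewrite divr_gt0.
have [A hA] := hf _ e2; have [B hB] := hg _ e2.
exists (A `|` B)%fset => C; rewrite fsubUset => /andP[/hA k1 /hB k2].
rewrite big_split opprD addrACA; apply: le_trans (cabsD _ _) _; lra.
Qed.

Lemma has_sumZ (I : choiceType) (f : I -> R[i]) S c :
  has_sum f S -> has_sum (fun i => c * f i) (c * S).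
Proof.
move=> /has_sumP hf; apply/has_sumP => e e0.
have c0 : 0 < cabs c + 1 by rewrite ltr_wpDl ?cabs_ge0.
have [A hA] := hf (e / (cabs c + 1)) (divr_gt0 e0 c0).
exists A => B AB; rewrite -mulr_sumr -mulrBr cabsM.
apply: le_trans (ler_wpM2l (cabs_ge0 _) (hA B AB)) _.
rewrite mulrCA ger_pMr// ler_pdivrMr// mul1r; lra.
Qed.

Lemma has_sum0 (I : choiceType) : has_sum (fun _ : I => 0) 0.
Proof.
apply/has_sumP => e e0; exists fset0 => B _.
by rewrite big1// subrr cabs0 ltW.
Qed.

Lemma has_sum_sum (I : choiceType) (J : Type) (r : seq J) (P : pred J)
    (f : J -> I -> R[i]) (S : J -> R[i]) :
  (forall j, P j -> has_sum (f j) (S j)) ->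
  has_sum (fun i => \sum_(j <- r | P j) f j i) (\sum_(j <- r | P j) S j).
Proof.
move=> h; elim: r => [|j r IH].
  by rewrite big_nil; apply: eq_has_sum (has_sum0 I) => i; rewrite big_nil.
rewrite big_cons; case: ifP => Pj.
  by apply: eq_has_sum (has_sumD (h j Pj) IH) => i; rewrite big_cons Pj.
by apply: eq_has_sum IH => i; rewrite big_cons Pj.
Qed.

Lemma has_sum_le (I : choiceType) (f : I -> R[i]) (M : I -> R) B S :
  (forall i, cabs (f i) <= M i) -> bounded_sums M B -> has_sum f S -> cabs S <= B.
Proof.
move=> fM MB /has_sumP hf; apply/ler_addgt0Pr => e e0.
have [A hA] := hf _ e0.
have -> : S = \sum_(i <- A) f i - (\sum_(i <- A) f i - S) by ring.
apply: le_trans (cabsB _ _) _; apply: lerD; last exact: hA (fsubset_refl _).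
apply: le_trans (cabs_sum _ _ _) _; apply: le_trans (MB A).
by apply: ler_sum.
Qed.

(** Restricts a sum to the image of an injection that contains the support of [f]; it serves to pass
    from Z^N to the coset over which theta is summed. *)
Lemma has_sum_inj (I J : choiceType) (f : J -> R[i]) (h : I -> J) (g : J -> I) S :
  cancel h g -> (forall j, f j != 0 -> h (g j) = j) -> has_sum f S -> has_sum (f \o h) S.
Proof.
move=> hg fh /has_sumP hf; apply/has_sumP => e e0.
have [A hA] := hf _ e0; exists [fset g j | j in A]%fset => B AB.
pose C := ([fset h i | i in B] `|` A)%fset.
suff -> : \sum_(i <- B) (f \o h) i = \sum_(j <- C) f j by apply: hA; exact: fsubsetUr.
have -> : \sum_(i <- B) (f \o h) i = \sum_(j <- [fset h i | i in B]%fset) f j.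
  by rewrite big_imfset//= => i i' _ _ /(can_inj hg).
apply/eqP; rewrite eq_sym -subr_eq0 sum_fset_setD ?fsubsetUl//.
rewrite big_seq big1// => j; rewrite !inE => /andP[jB].
rewrite (negbTE jB)/= => jA; apply/eqP; apply: contraNT jB => fj.
apply/imfsetP; exists (g j); last by rewrite fh.
by rewrite /= (fsubsetP AB)//; apply: in_imfset.
Qed.

Lemma has_sum_reindex (I : choiceType) (f : I -> R[i]) (h g : I -> I) S :
  cancel h g -> cancel g h -> has_sum f S -> has_sum (f \o h) S.
Proof. by move=> hg gh; apply: (has_sum_inj hg) => j _; exact: gh. Qed.

End UnconditionalSums.

(** * Majorants on Z^N that are products of one-variable functions *)

Section SumsOverLattice.
Variables (R : realType).

Definition zsum (b : int -> R) (L : nat) : R := \sum_(j < (2 * L).+1) b (j%:Z - L%:Z).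

(** Every finite set of vectors lies in a cube, and over a cube the sum of products is the product
    of the sums. *)
Lemma bounded_sums_prod N (b : 'I_N -> int -> R) (B : 'I_N -> R) :
  (forall v l, 0 <= b v l) -> (forall v L, zsum (b v) L <= B v) ->
  bounded_sums (fun l : 'cV[int]_N => \prod_v b v (l v 0)) (\prod_v B v).
Proof.
move=> b0 bB A.
pose L := (\max_(l <- A) \max_(v < N) `|(l : 'cV[int]_N) v 0%R|)%N.
have hL l v : l \in A -> (`|l v 0%R| <= L)%N.
  move=> lA; rewrite /L; apply: leq_trans (leq_bigmax_seq _ lA isT).
  exact: (leq_bigmax (F := fun v => `|l v 0%R|%N)).
pose vec (mu : {ffun 'I_N -> 'I_((2 * L).+1)}) : 'cV[int]_N := \col_v ((mu v : nat)%:Z - L%:Z).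
have vinj : injective vec.
  move=> mu nu /matrixP e; apply/ffunP => v; apply/val_inj.
  by have := e v 0; rewrite !mxE => /addIr [].
apply: le_trans (_ : \sum_(l <- [fset vec mu | mu in {ffun 'I_N -> 'I_((2 * L).+1)}]%fset)
    \prod_v b v (l v 0) <= _).
  rewrite -subr_ge0 sum_fset_setD.
    by rewrite sumr_ge0// => l _; rewrite prodr_ge0.
  apply/fsubsetP => l lA; apply/imfsetP.
  have lt v : (`|(l v 0 + L%:Z)%R| < (2 * L).+1)%N by have := hL l v lA; lia.
  exists [ffun v => Ordinal (lt v)] => //.
  apply/matrixP => v j; rewrite ord1 mxE ffunE /=.
  by have := hL l v lA; move: (l v 0) => x; clear; lia.
rewrite big_imfset/=; last by move=> ? ? _ _; exact: vinj.
rewrite big_enum /=.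
apply: le_trans (_ : \prod_v zsum (b v) L <= _).
  rewrite bigA_distr_bigA /= le_eqVlt; apply/orP; left; apply/eqP.
  by apply: eq_bigr => mu _; apply: eq_bigr => v _; rewrite mxE.
by apply: ler_prod => v _; rewrite bB sumr_ge0.
Qed.

Lemma geometric_sum_le (r : R) n : 0 <= r < 1 -> \sum_(0 <= i < n) r ^+ i <= (1 - r)^-1.
Proof.
move=> /andP[r0 r1]; have h : 0 < 1 - r by lra.
rewrite -[leRHS]mul1r ler_pdivlMr// big_mkord.
have -> : (\sum_(i < n) r ^+ i) * (1 - r) = 1 - r ^+ n.
  by rewrite mulrC -[1 in RHS](expr1n _ n) subrXX; congr (_ * _); apply: eq_bigr => i _;
    rewrite expr1n mul1r.
by rewrite lerBlDr lerDl exprn_ge0.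
Qed.

Lemma zsum_le_geometric (b : int -> R) (r C : R) L : 0 <= r < 1 -> 0 <= C ->
  (forall l, b l <= C * r ^+ `|l|%N) -> zsum b L <= C * (2 / (1 - r)).
Proof.
move=> hr C0 bC; rewrite /zsum -(big_mkord xpredT (fun j => b (j%:Z - L%:Z))).
rewrite (@big_cat_nat _ _ _ L)//=; last by lia.
rewrite mulrDl mulrDr mul1r; apply: lerD.
  rewrite big_nat_rev /=; apply: le_trans (_ : \sum_(0 <= i < L) C * (r ^+ i) <= _).
    rewrite !big_nat; apply: ler_sum => j /andP[_ jL]; apply: le_trans (bC _) _.
    rewrite ler_wpM2l// ler_wiXn2l//; [by case/andP: hr | by case/andP: hr => _ /ltW| by lia].
  by rewrite -mulr_sumr ler_wpM2l// geometric_sum_le.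
rewrite -{1}[L]add0n big_addn /=; have -> : ((2 * L).+1 - L = L.+1)%N by lia.
apply: le_trans (_ : \sum_(0 <= i < L.+1) C * (r ^+ i) <= _).
  apply: ler_sum => j _; apply: le_trans (bC _) _.
  by rewrite PoszD addrK.
by rewrite -mulr_sumr ler_wpM2l// geometric_sum_le.
Qed.

Lemma expR_absn (s : R) (l : int) : expR (- (s * `|l|%:~R)) = expR (- s) ^+ `|l|%N.
Proof. by rewrite -expRM_natr mulNr -abszE. Qed.

(** Two geometric series of ratio [expR (- s)]; for [s <= 1] one has [s <= 2 * (1 - expR (- s))]. *)
Lemma zsum_expR (b : int -> R) (C s : R) L : 0 < s <= 1 -> 0 <= C ->
  (forall l, b l <= C * expR (- (s * `|l|%:~R))) -> s * zsum b L <= 4 * C.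
Proof.
move=> /andP[s0 s1] C0 h.
have e0 := expR_gt0 (- s); have e1 := expR_ge1Dx s.
have e2 : expR s * expR (- s) = 1 by rewrite -expRD subrr expR0.
have E : expR (- s) * (1 + s) <= 1 by rewrite -[leRHS]e2 mulrC ler_wpM2r// ltW.
have r1 : 0 <= expR (- s) < 1 by rewrite ltW//= -expR0 ltr_expR; lra.
have := @zsum_le_geometric b _ C L r1 C0.
move=> /(_ (fun l => le_trans (h l) _)) => k.
apply: le_trans (_ : s * (C * (2 / (1 - expR (- s)))) <= _).
  by rewrite (ler_wpM2l (ltW s0))//; apply: k => l; rewrite expR_absn.
have d0 : 0 < 1 - expR (- s) by case/andP: r1 => _; lra.
rewrite !mulrA ler_pdivrMr//.
have : s <= 2 * (1 - expR (- s)).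
  have : s * expR (- s) <= expR (- s) by rewrite ler_piMl// ltW.
  by nra.
by move=> /(ler_wpM2l C0); lra.
Qed.

(** The inequality [x / n <= expR (x / n)], raised to the power [n]. *)
Lemma pow_expRN (n : nat) (x : R) : 0 <= x -> x ^+ n * expR (- x) <= n%:R ^+ n.
Proof.
move=> x0; case: n => [|n]; first by rewrite !expr0 mul1r -expR0 ler_expR; lra.
have n0 : 0 < n.+1%:R :> R by [].
have h : x / n.+1%:R <= expR (x / n.+1%:R) by apply: le_trans (expR_ge1Dx _); rewrite lerDr.
have : x ^+ n.+1 <= n.+1%:R ^+ n.+1 * expR x.
  have -> : expR x = expR (x / n.+1%:R) ^+ n.+1 by rewrite -expRM_natr divfK// gt_eqF.
  rewrite -exprMn lerXn2r ?nnegrE ?mulr_ge0 ?expR_ge0//.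
  by rewrite mulrC -ler_pdivrMr.
move/(ler_wpM2r (expR_ge0 (- x))); rewrite -mulrA -expRD subrr expR0 mulr1.
by apply.
Qed.

End SumsOverLattice.

(** * Regularised lattice sums at roots of unity *)

Section SmoothFamilies.
Variables (R : realType) (N : nat) (A : 'M[int]_N).
Hypotheses (sA : A^T = A) (pA : posdef A).
Implicit Types (l a : 'cV[int]_N) (s C : R) (f : R -> 'cV[int]_N -> R) (n w : nat).

Definition l1norm l : R := \sum_v `|l v 0|%:~R.

Lemma l1norm_ge0 l : 0 <= l1norm l.
Proof. by apply: sumr_ge0 => v _; rewrite ler0z. Qed.
Lemma l1normD l a : l1norm (l + a) <= l1norm l + l1norm a.
Proof.
rewrite -big_split; apply: ler_sum => v _ /=.
by rewrite mxE -intrD ler_int ler_normD.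
Qed.
Lemma l1norm_mulmx (M : 'M[int]_N) : exists2 C, 0 <= C &
  forall l, l1norm (M *m l) <= C * l1norm l.
Proof.
exists (\sum_i \sum_j `|M i j|%:~R); first by rewrite sumr_ge0// => i _; rewrite sumr_ge0// => j _;
  rewrite ler0z.
move=> l; rewrite mulr_suml; apply: ler_sum => i _; rewrite mulr_suml.
apply: le_trans (_ : \sum_j (`|M i j| * `|l j 0|)%:~R <= _).
  rewrite -(raddf_sum (intr : int -> R)) /= ler_int mxE.
  by apply: le_trans (ler_norm_sum _ _ _) _; apply: ler_sum => j _; rewrite normrM.
apply: ler_sum => j _; rewrite intrM ler_wpM2l ?ler0z//.
by rewrite /l1norm (bigD1 j)//= lerDl sumr_ge0// => v _; rewrite ler0z.
Qed.

Lemma bform_le a : exists2 C, 0 <= C & forall l, `|(bform A l a)%:~R| <= C * l1norm l.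
Proof.
exists (\sum_i `|(A *m a) i 0|%:~R); first by rewrite sumr_ge0// => i _; rewrite ler0z.
move=> l; rewrite bformE -intr_norm mulr_suml.
apply: le_trans (_ : \sum_i (`|l i 0| * `|(A *m a) i 0|)%:~R <= _).
  rewrite -(raddf_sum (intr : int -> R)) /= ler_int.
  by apply: le_trans (ler_norm_sum _ _ _) _; apply: ler_sum => j _; rewrite normrM.
apply: ler_sum => j _; rewrite intrM mulrC ler_wpM2l ?ler0z//.
by rewrite /l1norm (bigD1 j)//= lerDl sumr_ge0// => v _; rewrite ler0z.
Qed.

(** In diagonal coordinates the left-hand side is dominated by a sum of quadratic polynomials in s
    |y_i| with negative leading coefficient. Completing the squares bounds it uniformly in [s] and
    [l], since only their product matters. *)
Lemma gaussian_decay B : 0 <= B -> exists C, forall s l, 0 <= s ->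
  B * s * l1norm l - s ^+ 2 * (qform A l)%:~R <= C.
Proof.
move=> B0; have [U dU dA] := posdef_diagonalize sA pA.
set D := U^T *m A *m U in dA.
have D1 v : 1 <= D v v.
  have : 0 < D v v; last by move: (D v v) => x; lia.
  have := pA (x := U *m delta_mx v 0); rewrite qform_mulmx -/D qform_diag//.
  rewrite (bigD1 v)//= big1 => [|w wv]; last by rewrite [delta_mx _ _ _ _]mxE (negbTE wv) expr0n
    mulr0.
  rewrite [delta_mx _ _ _ _]mxE !eqxx expr1n mulr1 addr0; apply;
    apply/eqP => /(congr1 (mulmx (\adj U))).
  rewrite mulmxA mul_adj_mx mulmx0 mul_scalar_mx => /matrixP/(_ v 0).
  by rewrite !mxE !eqxx mulr1 => /eqP; rewrite (negbTE dU).
have [C1 C10 hC1] := l1norm_mulmx U.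
pose d : R := (\det U)%:~R; have d0 : 0 < d ^+ 2.
  by rewrite lt0r sqr_ge0 andbT expf_neq0// intr_eq0.
exists (N%:R * ((B * C1) ^+ 2 * d ^+ 2)) => s l s0.
(* The adjugate keeps the new coordinates integral, at the price of the factor [\det U]. *)
pose y := \adj U *m l.
have yE : U *m y = \det U *: l by rewrite mulmxA mul_mx_adj mul_scalar_mx.
have q1 : \sum_i (y i 0)%:~R ^+ 2 <= d ^+ 2 * (qform A l)%:~R.
  have -> : d ^+ 2 * (qform A l)%:~R = (qform A (U *m y))%:~R.
    by rewrite yE qformZ intrM rmorphXn.
  rewrite qform_mulmx -/D qform_diag// raddf_sum /=; apply: ler_sum => i _.
  by rewrite intrM rmorphXn/= ler_peMl ?sqr_ge0// ler1z.
have n1 : l1norm l <= C1 * l1norm y.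
  apply: le_trans (hC1 y); rewrite yE; apply: ler_sum => v _.
  rewrite mxE ler_int normrM ler_peMl//.
  by move: dU; move: (\det U) => x; lia.
apply: le_trans (_ : B * s * (C1 * l1norm y) - s ^+ 2 * ((\sum_i (y i 0)%:~R ^+ 2) / d ^+ 2) <= _).
  apply: lerB; first by rewrite ler_wpM2l ?mulr_ge0.
  by rewrite ler_wpM2l ?sqr_ge0// ler_pdivrMr// mulrC.
have -> : B * s * (C1 * l1norm y) - s ^+ 2 * ((\sum_i (y i 0)%:~R ^+ 2) / d ^+ 2) =
  \sum_i (B * s * C1 * `|y i 0|%:~R - s ^+ 2 * (y i 0)%:~R ^+ 2 / d ^+ 2).
  rewrite sumrB -mulr_sumr -/(l1norm y) -mulrA; congr (_ - _); first by ring.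
  by rewrite mulrA mulr_sumr -mulr_suml.
rewrite mulr_natl -[N in _ *+ N]card_ord -sumr_const; apply: ler_sum => i _.
have -> : (y i 0)%:~R ^+ 2 = `|y i 0|%:~R ^+ 2 :> R.
  by rewrite intr_norm real_normK// num_real.
set x : R := `|y i 0|%:~R.
have -> : B * s * C1 * x - s ^+ 2 * x ^+ 2 / d ^+ 2 =
   (B * C1) ^+ 2 * d ^+ 2 / 4 - (s * x / d - B * C1 * d / 2) ^+ 2.
  by field; rewrite intr_eq0.
have := sqr_ge0 (s * x / d - B * C1 * d / 2).
have := mulr_ge0 (sqr_ge0 (B * C1)) (ltW d0); lra.
Qed.

(** Exponential growth in s |l| is harmless, as [gaussian_decay] absorbs it uniformly in [s]; what
    is recorded is the power of [s]. *)
Definition moderate w f := exists2 C, 0 <= C &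
  forall s l, 0 < s <= 1 -> `|f s l| <= C * s ^+ w * expR (C * s * l1norm l).

(* [f s l] is [O (s ^ w * expR (C s |l|))], and each of up to [n] differences in [l]
   gains a further factor [s]. *)
Fixpoint smooth n w f : Prop := moderate w f /\
  if n is m.+1 then forall a, smooth m w.+1 (fun s l => f s (l + a) - f s l) else True.

Lemma eq_smooth n w f g : (forall s l, f s l = g s l) -> smooth n w f -> smooth n w g.
Proof.
by move=> fg; have -> : f = g by apply/funext => s; apply/funext => l.
Qed.

Lemma moderate_leq w w' f : (w' <= w)%N -> moderate w f -> moderate w' f.
Proof.
move=> ww [C C0 h]; exists C => // s l hs; apply: le_trans (h s l hs) _.
case/andP: hs => s0 s1; rewrite ler_wpM2r ?expR_ge0// ler_wpM2l//.
by rewrite ler_wiXn2l// ltW.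
Qed.

Lemma moderateM w w' f g : moderate w f -> moderate w' g ->
  moderate (w + w') (fun s l => f s l * g s l).
Proof.
move=> [C C0 hC] [D D0 hD]; exists (C * D + C + D); first by rewrite !addr_ge0 ?mulr_ge0.
move=> s l hs; have := hC s l hs; have := hD s l hs.
case/andP: hs => s0 s1 h1 h2; rewrite normrM.
apply: le_trans (ler_pM _ _ h2 h1) _ => //.
rewrite exprD.
have -> : C * s ^+ w * expR (C * s * l1norm l) * (D * s ^+ w' * expR (D * s * l1norm l)) =
  (C * D) * (s ^+ w * s ^+ w') * expR (C * s * l1norm l + D * s * l1norm l).
  by rewrite expRD; ring.
apply: ler_pM; rewrite ?mulr_ge0 ?expR_ge0 ?exprn_ge0 ?(ltW s0)//.
  by rewrite ler_wpM2r ?mulr_ge0 ?exprn_ge0 ?(ltW s0)//; have := mulr_ge0 C0 D0; lra.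
rewrite ler_expR -!mulrDl -mulrA -[leRHS]mulrA ler_wpM2r ?mulr_ge0 ?l1norm_ge0 ?(ltW s0)//.
by have := mulr_ge0 C0 D0; lra.
Qed.

Lemma moderateD w f g : moderate w f -> moderate w g ->
  moderate w (fun s l => f s l + g s l).
Proof.
move=> [C C0 hC] [D D0 hD]; exists (C + D); first by rewrite addr_ge0.
move=> s l hs; have := hC s l hs; have := hD s l hs.
case/andP: hs => s0 s1 h1 h2; apply: le_trans (ler_normD _ _) _.
rewrite !mulrDl; have m0 := mulr_ge0 (ltW s0) (l1norm_ge0 l).
have k1 : expR (C * s * l1norm l) <= expR (C * s * l1norm l + D * s * l1norm l).
  by rewrite ler_expR -!mulrA lerDl mulr_ge0.
have k2 : expR (D * s * l1norm l) <= expR (C * s * l1norm l + D * s * l1norm l).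
  by rewrite ler_expR -!mulrA lerDr mulr_ge0.
apply: lerD; [apply: le_trans h2 _ | apply: le_trans h1 _];
  by rewrite ler_wpM2l// mulr_ge0 ?exprn_ge0// ltW.
Qed.

Lemma moderate_shift w f a : moderate w f -> moderate w (fun s l => f s (l + a)).
Proof.
move=> [C C0 hC]; set E := expR (C * l1norm a).
have E1 : 1 <= E by rewrite -expR0 ler_expR mulr_ge0 ?l1norm_ge0.
exists (C * E); first by rewrite mulr_ge0 ?expR_ge0.
move=> s l hs; apply: le_trans (hC s _ hs) _; case/andP: hs => s0 s1.
have -> : C * E * s ^+ w * expR (C * E * s * l1norm l) =
  C * s ^+ w * (E * expR (C * E * s * l1norm l)).
  by ring.
rewrite ler_wpM2l ?mulr_ge0 ?exprn_ge0 ?(ltW s0)// -expRD ler_expR.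
apply: le_trans (_ : C * s * (l1norm l + l1norm a) <= _).
  by rewrite ler_wpM2l ?l1normD// mulr_ge0// ltW.
rewrite mulrDr addrC; apply: lerD.
  by rewrite ler_wpM2r ?l1norm_ge0// ler_piMr.
by rewrite -!mulrA ler_wpM2l// ler_peMl// mulr_ge0 ?l1norm_ge0 ?(ltW s0).
Qed.

Lemma smooth_leq n n' w w' f : (n' <= n)%N -> (w' <= w)%N -> smooth n w f -> smooth n' w' f.
Proof.
elim: n n' w w' f => [|n IH] [|n'] w w' f //= nn ww [h1 h2]; split=> //;
  try exact: moderate_leq ww h1.
by move=> a; apply: (IH n' w.+1 w'.+1).
Qed.

Lemma smoothD n w f g : smooth n w f -> smooth n w g -> smooth n w (fun s l => f s l + g s l).
Proof.
elim: n w f g => [|n IH] w f g /= [f1 f2] [g1 g2]; split=> //; try exact: moderateD.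
move=> a; apply: eq_smooth (IH _ _ _ (f2 a) (g2 a)) => s l.
by rewrite opprD addrACA.
Qed.

Lemma smooth_shift n w f a : smooth n w f -> smooth n w (fun s l => f s (l + a)).
Proof.
elim: n w f => [|n IH] w f /= [f1 f2]; split=> //; try exact: moderate_shift.
by move=> b; apply: eq_smooth (IH _ _ (f2 b)) => s l; rewrite addrAC.
Qed.

(** Discrete Leibniz rule: the difference of a product is the difference of [f] times a translate of
    [g], plus [f] times the difference of [g]. *)
Lemma smoothM n w w' f g : smooth n w f -> smooth n w' g ->
  smooth n (w + w') (fun s l => f s l * g s l).
Proof.
elim: n w w' f g => [|n IH] w w' f g Hf Hg.
  by case: Hf Hg => [f1 _] [g1 _]; split=> //; exact: moderateM.
have [f1 f2] := Hf; have [g1 g2] := Hg; split; first exact: moderateM.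
move=> a; have Hg' : smooth n w' (fun s l => g s (l + a)).
  by apply: smooth_shift; apply: smooth_leq Hg.
have Hf' : smooth n w f by apply: smooth_leq Hf.
have := IH _ _ _ _ Hf' (g2 a); rewrite addnS => k.
have := IH _ _ _ _ (f2 a) Hg'; rewrite addSn => /smoothD/(_ k).
by apply: eq_smooth => s l; ring.
Qed.

Lemma smooth_const n w c : (w = 0%N \/ c = 0) -> smooth n w (fun _ _ => c).
Proof.
elim: n w c => [|n IH] w c hc; split=> //; last first.
- by move=> a; apply: eq_smooth (IH w.+1 0 _) => [s l|]; [rewrite subrr | right].
all: exists `|c| => // s l /andP[s0 s1].
all: case: hc => [->|->]; last by rewrite normr0 !mul0r.
all: by rewrite expr0 mulr1 ler_peMr// -expR0 ler_expR !mulr_ge0 ?l1norm_ge0// ltW.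
Qed.

Lemma expR_sub1_le (x y : R) : `|x| <= y -> `|expR x - 1| <= y * expR y.
Proof.
move=> xy; have y0 : 0 <= y by apply: le_trans xy.
have e1 : 1 <= expR y by rewrite -expR0 ler_expR.
have [x0|x0] := leP 0 x.
  rewrite ger0_norm in xy => //.
  rewrite ger0_norm ?subr_ge0; last by rewrite -expR0 ler_expR.
  have := expR_ge1Dx (- x); have := expR_gt0 x; have ee : expR x * expR (- x) = 1.
    by rewrite -expRD subrr expR0.
  move=> ex0 h; have : expR x * (1 - x) <= 1 by rewrite -[leRHS]ee ler_wpM2l// ltW.
  have : x * expR x <= y * expR y by apply: ler_pM; rewrite ?expR_ge0// ler_expR.
  by lra.
rewrite ltr0_norm in xy => //.
rewrite ler0_norm ?subr_le0; last by rewrite -expR0 ler_expR ltW.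
have := expR_ge1Dx x; have : y <= y * expR y by rewrite ler_peMr.
by lra.
Qed.

Definition gaussian s l : R := expR (- (s ^+ 2 * (qform A l)%:~R)).

(** The relative change of the Gaussian under translation by [a]; the terms of its exponent that are
    quadratic in [l] cancel. *)
Definition gratio a s l : R :=
  expR (- (s ^+ 2 * (2 * (bform A l a)%:~R + (qform A a)%:~R))) - 1.

Lemma gaussian_shift s l a : gaussian s (l + a) = gaussian s l * (1 + gratio a s l).
Proof.
rewrite /gratio [1 + _]addrC subrK -expRD; congr expR.
by rewrite qformD// !intrD intrM; ring.
Qed.

(** The exponent is s times O(s |l| + s), whence weight 1. Moreover [1 + gratio] is the exponential
    of an affine function of [l], so its difference is itself times [kap], which does not depend on
    [l] and has weight 2. *)
Lemma gratio_smooth n a : smooth n 1 (gratio a).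
Proof.
have mod1 : moderate 1 (gratio a).
  have [C C0 hC] := bform_le a; set q := `|(qform A a)%:~R| : R.
  have q0 : 0 <= q by rewrite /q normr_ge0.
  have e1 : 1 <= expR (2 * q) by rewrite -expR0 ler_expR mulr_ge0.
  exists (4 * C + expR (2 * q)); first by rewrite addr_ge0 ?mulr_ge0 ?expR_ge0.
  move=> s l /andP[s0 s1]; have m0 := mulr_ge0 (ltW s0) (l1norm_ge0 l).
  set m := s * l1norm l in m0; set y := s * (2 * C * m + q).
  have Y0 : 0 <= 2 * C * m + q by apply: addr_ge0 => //; do 2?[apply: mulr_ge0 => //].
  apply: le_trans (expR_sub1_le (y := y) _) _.
    rewrite normrN normrM ger0_norm ?sqr_ge0//.
    rewrite expr2 /y -[leLHS]mulrA ler_wpM2l ?(ltW s0)//.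
    apply: le_trans (ler_wpM2l (ltW s0) (ler_normD _ _)) _.
    rewrite normrM (@ger0_norm _ 2)// mulrDr; apply: lerD; last by rewrite ler_piMl.
    by have := ler_wpM2l (ltW s0) (hC l); rewrite /m; lra.
  set Y := (X in s * X) in y Y0 *.
  have yY : y <= Y by rewrite /y ler_piMl.
  have Ye : Y <= expR Y by apply: le_trans (expR_ge1Dx _); lra.
  apply: le_trans (_ : s * expR (Y + Y) <= _).
    rewrite {1}/y -[leLHS]mulrA ler_wpM2l ?(ltW s0)// expRD.
    by apply: ler_pM; rewrite ?expR_ge0// ler_expR.
  rewrite expr1 [X in _ <= X * _]mulrC -[leRHS]mulrA ler_wpM2l ?(ltW s0)//.
  have -> : Y + Y = 2 * q + 4 * C * m by rewrite /Y; ring.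
  rewrite expRD; apply: ler_pM; rewrite ?expR_ge0//.
    by have := mulr_ge0 (ler0n R 4) C0; lra.
  rewrite ler_expR -[leRHS]mulrA -/m ler_wpM2r//.
  by have := expR_ge0 (2 * q); lra.
elim: n => [|n IH]; split=> // c.
pose kap (s : R) (_ : 'cV[int]_N) : R := expR (- (s ^+ 2 * (2 * (bform A c a)%:~R))) - 1.
have kap_smooth m : smooth m 2 kap.
  have mk : moderate 2 kap.
    set B : R := `|2 * (bform A c a)%:~R|.
    have B0 : 0 <= B by rewrite /B normr_ge0.
    exists (B * expR B); first by rewrite mulr_ge0 ?expR_ge0.
    move=> s l /andP[s0 s1]; have s21 : s ^+ 2 <= 1 by rewrite expr_le1// ltW.
    apply: le_trans (expR_sub1_le (y := s ^+ 2 * B) _) _.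
      by rewrite normrN normrM (ger0_norm (sqr_ge0 s)).
    apply: le_trans (_ : B * expR B * s ^+ 2 <= _).
      rewrite [leRHS]mulrC -[leLHS]mulrA ler_wpM2l ?sqr_ge0// ler_wpM2l//.
      by rewrite ler_expR ler_piMl.
    have P0 : 0 <= B * expR B by rewrite mulr_ge0 ?expR_ge0.
    rewrite ler_peMr ?(mulr_ge0 P0 (sqr_ge0 s))// -expR0 ler_expR.
    by rewrite -mulrA mulr_ge0// mulr_ge0 ?l1norm_ge0 ?ltW.
  case: m => [|m]; split=> // b.
  apply: eq_smooth (_ : smooth m 3 (fun _ _ => 0)) => [s l|]; first by rewrite /kap subrr.
  by apply: smooth_const; right.
apply: eq_smooth (_ : smooth n 2 (fun s l => (1 + gratio a s l) * kap s l)) => [s l|].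
  have E : gratio a s (l + c) + 1 = (gratio a s l + 1) * (kap s l + 1).
    transitivity (expR (- (s ^+ 2 * (2 * (bform A l a)%:~R + (qform A a)%:~R)) +
       - (s ^+ 2 * (2 * (bform A c a)%:~R)))).
      rewrite /gratio subrK bformDl intrD; apply: (congr1 (@expR R)); ring.
    by rewrite expRD; congr (_ * _); rewrite /gratio /kap subrK.
  move: (gratio a s (l + c)) (gratio a s l) (kap s l) E => x y z E.
  by rewrite -[x](addrK 1) E; ring.
apply: (@smoothM n 0 2); last exact: kap_smooth.
apply: smoothD; first by apply: smooth_const; left.
exact: smooth_leq IH.
Qed.

(* Summation by parts only ever meets differences of [gaussian * f]; dividing them by
   [gaussian] gives again a smooth function, of weight one more. *)
Definition dshift a f s l : R :=
  gratio a s l * f s l + (1 + gratio a s l) * (f s (l + a) - f s l).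

Lemma gaussian_dshift a f s l :
  gaussian s (l + a) * f s (l + a) = gaussian s l * (f s l + dshift a f s l).
Proof. by rewrite gaussian_shift /dshift; ring. Qed.

Definition smooth_family w f := forall n, smooth n w f.

Lemma smooth_family_dshift w a f : smooth_family w f -> smooth_family w.+1 (dshift a f).
Proof.
move=> h n; apply: smoothD.
  by rewrite -add1n; apply: smoothM => //; exact: gratio_smooth.
rewrite -[w.+1]add0n; apply: smoothM; last exact: (h n.+1).2.
apply: smoothD; first by apply: smooth_const; left.
exact: smooth_leq (gratio_smooth n a).
Qed.

Lemma smooth_family1 : smooth_family 0 (fun _ _ => 1).
Proof. by move=> n; apply: smooth_const; left. Qed.

(** The rate [2 * s] is chosen so that one half of the exponential can pay for the growth of the
    kernels and the other half for the summation. *)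
Lemma gaussian_smooth_le w f : smooth_family w f -> exists2 C, 0 <= C &
  forall s l, 0 < s <= 1 ->
    `|gaussian s l * f s l| <= C * s ^+ w * \prod_v expR (- (2 * s * `|l v 0|%:~R)).
Proof.
move=> /(_ 0%N)[[C C0 hC] _].
have [D hD] := gaussian_decay (addr_ge0 C0 (ler0n R 2)).
exists (C * expR D); first by rewrite mulr_ge0 ?expR_ge0.
move=> s l hs; have /andP[s0 _] := hs.
rewrite normrM ger0_norm ?expR_ge0// -expR_sum sumrN -mulr_sumr -/(l1norm l).
apply: le_trans (ler_wpM2l (expR_ge0 _) (hC s l hs)) _.
have -> : gaussian s l * (C * s ^+ w * expR (C * s * l1norm l)) =
    C * s ^+ w * expR (C * s * l1norm l - s ^+ 2 * (qform A l)%:~R).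
  by rewrite /gaussian expRD; ring.
have -> : C * expR D * s ^+ w * expR (- (2 * s * l1norm l)) =
    C * s ^+ w * expR (D - 2 * s * l1norm l) by rewrite expRD; ring.
rewrite ler_wpM2l ?mulr_ge0 ?exprn_ge0 ?(ltW s0)// ler_expR.
by have := hD s l (ltW s0); lra.
Qed.

End SmoothFamilies.

(** * Growth of the coefficients determined by the difference recursion *)

Section Kernels.
Variables (R : realType) (c : nat -> int -> R[i]).
Hypothesis c_rec : forall n l, c n.+1 (l + 1) - c n.+1 (l - 1) = c n l.
Hypothesis c_one : forall l, c 1 l = (l == 0)%:R * 2.

Let c_next n l : c n.+1 (l + 1) = c n.+1 (l - 1) + c n l.
Proof. by rewrite -(c_rec n l) [RHS]addrC subrK. Qed.

Let c_one0 l : l != 0 -> c 1 l = 0.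
Proof. by move=> l0; rewrite c_one (negbTE l0) mul0r. Qed.

(** The recursion moves the argument by 2, so every argument descends to 0 or to one of 1 and -1 and
    collects values of [c n] on the way. The sign [e] treats both directions at once. *)
Let c_le_sum n (e : int) (k : nat) : (e == 1) || (e == -1) ->
  cabs (c n.+1 (e * k%:Z)) <= cabs (c n.+1 0) + cabs (c n.+1 1) +
    \sum_(i < k) cabs (c n (e * i%:Z)).
Proof.
move=> he; elim/ltn_ind: k => - [|[|k]] IH.
- by rewrite mulr0 big_ord0 addr0 lerDl cabs_ge0.
- rewrite mulr1 big_ord1 mulr0; case/orP: he => /eqP ->.
    by rewrite -[leLHS]addr0 lerD ?cabs_ge0// lerDr cabs_ge0.
  have := c_next n 0; rewrite add0r sub0r => e1.
  have -> : c n.+1 (-1) = c n.+1 1 - c n 0 by rewrite e1 addrK.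
  by apply: le_trans (cabsB _ _) _; rewrite lerD2r lerDr cabs_ge0.
have step : cabs (c n.+1 (e * k.+2%:Z)) <= cabs (c n.+1 (e * k%:Z)) + cabs (c n (e * k.+1%:Z)).
  have := c_next n (e * k.+1%:Z); case/orP: he => /eqP ->; rewrite ?mul1r ?mulN1r => h.
    have -> : k.+2%:Z = k.+1%:Z + 1 by rewrite -addn1 PoszD.
    have -> : k%:Z = k.+1%:Z - 1 by rewrite -addn1 PoszD addrK.
    by rewrite h cabsD.
  have -> : - k.+2%:Z = - k.+1%:Z - 1 by rewrite -[k.+2]addn1 PoszD opprD.
  have -> : - k%:Z = - k.+1%:Z + 1 by rewrite -[k.+1]addn1 PoszD opprD addrNK.
  by rewrite h; have := cabsB (c n.+1 (- k.+1%:Z - 1) + c n (- k.+1%:Z)) (c n (- k.+1%:Z));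
    rewrite addrK.
apply: le_trans step _; rewrite 2!big_ord_recr /= !addrA lerD2r.
apply: le_trans (IH k _) _; first by [].
by rewrite lerDl cabs_ge0.
Qed.

(** [c 1] is supported at 0, so [c 2] is bounded; each further summation raises the degree of growth
    by one. *)
Lemma kernel_poly_bound n : exists2 C : R, 0 <= C &
  forall l, cabs (c n.+2 l) <= C * (1 + `|l|%:~R) ^+ n.
Proof.
have red m (C : R) (B : nat -> R) : (forall k, \sum_(i < k) cabs (c m.+1 i%:Z) <= B k) ->
    (forall k, \sum_(i < k) cabs (c m.+1 (- i%:Z)) <= B k) ->
    forall l, cabs (c m.+2 l) <= cabs (c m.+2 0) + cabs (c m.+2 1) + B `|l|%N.
  move=> h1 h2 l; rewrite {1}[l]intEsg; case: (sgzP l) => _.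
  - rewrite mul0r -[leLHS]addr0 -addrA lerD2l addr_ge0 ?cabs_ge0//.
    by apply: le_trans (h1 _); apply: sumr_ge0 => i _; exact: cabs_ge0.
  - rewrite mul1r; have := @c_le_sum m.+1 1 `|l|%N isT; rewrite mul1r => /le_trans; apply.
    rewrite lerD2l; apply: le_trans (h1 _); apply: ler_sum => i _; by rewrite mul1r.
  - rewrite mulN1r; have := @c_le_sum m.+1 (-1) `|l|%N isT; rewrite mulN1r => /le_trans; apply.
    rewrite lerD2l; apply: le_trans (h2 _); apply: ler_sum => i _; by rewrite mulN1r.
elim: n => [|n [C C0 hC]].
  exists (cabs (c 2 0) + cabs (c 2 1) + 2); first by rewrite !addr_ge0 ?cabs_ge0.
  move=> l; rewrite expr0 mulr1; apply: (red 0%N 0 (fun=> 2)) => k.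
    elim: k => [|k IH]; first by rewrite big_ord0.
    rewrite big_ord_recl big1 => [|i _]; last by rewrite c_one0 ?cabs0.
    by rewrite addr0 c_one mul1r cabs_nat.
  case: k => [|k]; first by rewrite big_ord0.
  rewrite big_ord_recl big1 => [|i _]; last by rewrite c_one0 ?cabs0.
  by rewrite addr0 c_one oppr0 mul1r cabs_nat.
pose K := cabs (c n.+3 0) + cabs (c n.+3 1).
have K0 : 0 <= K by rewrite addr_ge0 ?cabs_ge0.
exists (K + C); first by rewrite addr_ge0.
move=> l; set x : R := `|l|%:~R.
have x0 : 0 <= x by rewrite ler0z.
have aux (i k : nat) : (i < k)%N -> (1 + `|i%:Z|%:~R) ^+ n <= (1 + k%:R) ^+ n :> R.
  move=> ik; rewrite lerXn2r// ?nnegrE ?addr_ge0 ?ler0z// lerD2l ger0_norm//.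
  by rewrite -pmulrn ler_nat ltnW.
apply: le_trans (red n.+1 0 (fun k => C * (1 + k%:R) ^+ n.+1) _ _ l) _.
- move=> k; apply: le_trans (_ : \sum_(i < k) C * (1 + k%:R) ^+ n <= _).
    apply: ler_sum => i _; apply: le_trans (hC _) _; rewrite ler_wpM2l//.
    exact: aux.
  rewrite sumr_const card_ord -[leLHS]mulr_natr -mulrA ler_wpM2l// exprSr.
  by rewrite ler_wpM2l ?exprn_ge0 ?addr_ge0// lerDr.
- move=> k; apply: le_trans (_ : \sum_(i < k) C * (1 + k%:R) ^+ n <= _).
    apply: ler_sum => i _; apply: le_trans (hC _) _; rewrite ler_wpM2l//.
    by rewrite normrN; exact: aux.
  rewrite sumr_const card_ord -[leLHS]mulr_natr -mulrA ler_wpM2l// exprSr.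
  by rewrite ler_wpM2l ?exprn_ge0 ?addr_ge0// lerDr.
have -> : `|l|%N%:R = x :> R by rewrite /x -[in RHS]abszE.
rewrite mulrDl -/K lerD2r ler_peMr// exprn_ege1// lerDl//.
Qed.

(** Growth of degree [n - 2] costs [n - 2] powers of [s], and the summation one more. For [n] equal
    to 0 or 1 the support is finite and nothing is lost, in agreement with the truncated
    predecessor. *)
Lemma kernel_zsum n : exists2 C : R, 0 <= C & forall (s : R) L, 0 < s <= 1 ->
  s ^+ n.-1 * zsum (fun l => cabs (c n l) * expR (- (2 * s * `|l|%:~R))) L <= C.
Proof.
have small m : (forall l, cabs (c m l) <= 8 * (1 / 2) ^+ `|l|%N) -> exists2 C : R, 0 <= C &
   forall (s : R) L, 0 < s <= 1 ->
    zsum (fun l => cabs (c m l) * expR (- (2 * s * `|l|%:~R))) L <= C.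
  move=> h; exists (8 * (2 / (1 - 1 / 2))); first by rewrite mulr_ge0// divr_ge0//; lra.
  move=> s L /andP[s0 _]; apply: zsum_le_geometric; [lra|lra|] => l.
  apply: le_trans (h l); rewrite ler_piMr ?cabs_ge0// -[leRHS]expR0 ler_expR oppr_le0.
  by rewrite mulr_ge0 ?ler0z// mulr_ge0// ltW.
case: n => [|[|n]].
- have [|C C0 hC] := small 0%N; last first.
    by exists C => // s L hs; rewrite expr0 mul1r hC.
  move=> l; rewrite -(c_rec 0 l) !c_one addr_eq0 subr_eq0.
  have [->|l1] := eqVneq l 1; first by rewrite mulr0n mulr1n mul0r mul1r sub0r cabsN cabs_nat
    expr1; lra.
  have [->|l2] := eqVneq l (-1); first by rewrite mulr1n mulr0n mul0r mul1r subr0 cabs_nat expr1;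
    lra.
  by rewrite !mulr0n !mul0r subrr cabs0 mulr_ge0// exprn_ge0//; lra.
- have [|C C0 hC] := small 1%N; last first.
    by exists C => // s L hs; rewrite expr0 mul1r hC.
  move=> l; rewrite c_one; have [->|l1] := eqVneq l 0;
    first by rewrite mulr1n mul1r cabs_nat expr0; lra.
  by rewrite mulr0n mul0r cabs0 mulr_ge0// exprn_ge0//; lra.
have [C C0 hC] := kernel_poly_bound n.
pose D := C * (n%:R ^+ n * expR 1); have D0 : 0 <= D by rewrite !mulr_ge0 ?exprn_ge0 ?expR_ge0.
exists (4 * D); first by rewrite mulr_ge0.
move=> s L /andP[s0 s1]; rewrite /= exprS -mulrA.
have -> : s ^+ n * zsum (fun l => cabs (c n.+2 l) * expR (- (2 * s * `|l|%:~R))) L =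
    zsum (fun l => s ^+ n * (cabs (c n.+2 l) * expR (- (2 * s * `|l|%:~R)))) L.
  by rewrite /zsum mulr_sumr.
apply: zsum_expR => //; first by rewrite s0.
move=> l; set x : R := s * `|l|%:~R; have x0 : 0 <= x by rewrite mulr_ge0 ?ler0z ?(ltW s0).
apply: le_trans (_ : s ^+ n * (C * (1 + `|l|%:~R) ^+ n * expR (- (2 * s * `|l|%:~R))) <= _).
  by rewrite ler_wpM2l ?exprn_ge0 ?(ltW s0)// ler_wpM2r ?expR_ge0.
(* One factor [expR (- x)] absorbs the polynomial, the other is summed by [zsum_expR]. *)
have -> : 2 * s * `|l|%:~R = x + x by rewrite /x; ring.
rewrite opprD expRD.
have -> : s ^+ n * (C * (1 + `|l|%:~R) ^+ n * (expR (- x) * expR (- x))) =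
  C * ((s + x) ^+ n * expR (- x)) * expR (- x).
  have -> : s + x = s * (1 + `|l|%:~R) by rewrite /x; ring.
  by rewrite exprMn; ring.
rewrite ler_wpM2r ?expR_ge0// ler_wpM2l//.
apply: le_trans (_ : (1 + x) ^+ n * expR (- (1 + x)) * expR 1 <= _).
  rewrite -mulrA -expRD opprD addrAC addNr add0r ler_wpM2r ?expR_ge0//.
  by rewrite lerXn2r ?nnegrE ?addr_ge0 ?(ltW s0)// lerD2r.
by rewrite ler_wpM2r ?expR_ge0// pow_expRN// addr_ge0.
Qed.

End Kernels.

(** * Gaussian sums of products of kernels twisted by unimodular numbers *)

Section LatticeSums.
Variables (R : realType) (N : nat) (A : 'M[int]_N) (c : nat -> int -> R[i]).
Hypotheses (sA : A^T = A) (pA : posdef A).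
Hypothesis c_rec : forall n l, c n.+1 (l + 1) - c n.+1 (l - 1) = c n l.
Hypothesis c_one : forall l, c 1 l = (l == 0)%:R * 2.
Implicit Types (l a : 'cV[int]_N) (s : R) (f : R -> 'cV[int]_N -> R) (n : 'I_N -> nat).
Implicit Types (u v : 'I_N) (w d e : nat).

Variable z : 'I_N -> R[i].
Hypothesis z1 : forall v, cabs (z v) = 1.

Let z0 v : z v != 0. Proof. by rewrite -cabs_eq0 z1 oner_eq0. Qed.

(* [n v] stands for the degree of [v] minus one. *)
Definition tterm n f s l : R[i] :=
  (\prod_v (c (n v) (l v 0) * z v ^ l v 0)) * (gaussian A s l * f s l)%:C%C.

Definition tsum n f s : R[i] := summability.sum (tterm n f s).

Lemma bounded_sumsZ (I : choiceType) (M : I -> R) B K : 0 <= K ->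
  bounded_sums M B -> bounded_sums (fun i => K * M i) (K * B).
Proof. by move=> K0 h F; rewrite -mulr_sumr ler_wpM2l. Qed.

(** The absolute estimate, blind to the oscillation of the [z v]: each variable loses [(n v).-1]
    powers of [s]. *)
Lemma tsum_basic n w f : smooth_family w f -> exists2 C : R, 0 <= C &
  forall s, 0 < s <= 1 -> has_sum (tterm n f s) (tsum n f s) /\
    s ^+ (\sum_v (n v).-1) * cabs (tsum n f s) <= C * s ^+ w.
Proof.
move=> hf; have [C C0 hC] := gaussian_smooth_le sA pA hf.
have /choice[K hK] : forall v, exists K : R, 0 <= K /\ forall s L, 0 < s <= 1 ->
  s ^+ (n v).-1 * zsum (fun l : int => cabs (c (n v) l) * expR (- (2 * s * `|l|%:~R))) L <= K.
  by move=> v; have [K K0 hK] := kernel_zsum c_rec c_one (n v); exists K.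
exists (C * \prod_v K v); first by rewrite mulr_ge0// prodr_ge0// => v _; case: (hK v).
move=> s hs; have /andP[s0 s1] := hs.
pose b v (l : int) := cabs (c (n v) l) * expR (- (2 * s * `|l|%:~R)).
have bB v L : zsum (b v) L <= K v / s ^+ (n v).-1.
  rewrite ler_pdivlMr ?exprn_gt0// mulrC; exact: (hK v).2.
have := bounded_sums_prod (fun v (l : int) => mulr_ge0 (cabs_ge0 _) (expR_ge0 _)) bB.
move=> /(bounded_sumsZ (mulr_ge0 C0 (exprn_ge0 w (ltW s0)))) hb.
have tM l : cabs (tterm n f s l) <= C * s ^+ w * \prod_v b v (l v 0).
  rewrite cabsM cabs_real cabs_prod.
  have -> : \prod_v cabs (c (n v) (l v 0) * z v ^ l v 0) = \prod_v cabs (c (n v) (l v 0)).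
    by apply: eq_bigr => v _; rewrite cabsM cabsXz z1 exp1rz mulr1.
  apply: le_trans (ler_wpM2l _ (hC s l hs)) _; first by rewrite prodr_ge0// => v _; exact: cabs_ge0.
  by rewrite big_split /= mulrCA.
have [S hS] := has_sum_ex tM hb; rewrite /tsum (has_sum_csum hS); split=> //.
have := has_sum_le tM hb hS => hle.
apply: le_trans (ler_wpM2l (exprn_ge0 _ (ltW s0)) hle) _.
rewrite prodf_div -prodrXr.
rewrite le_eqVlt; apply/orP; left; apply/eqP; field.
by apply/prodf_neq0 => v _; rewrite expf_neq0// gt_eqF.
Qed.

Lemma tsum_has n w f s : smooth_family w f -> 0 < s <= 1 -> has_sum (tterm n f s) (tsum n f s).
Proof. by move=> hf hs; have [C _ /(_ s hs)[]] := tsum_basic n hf. Qed.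

Definition upd n v m : 'I_N -> nat := fun u => if u == v then m else n u.

(* Summation by parts in the variable [l v]: raises [n v] at the cost of the factor
   [1 / z - z], up to terms with a differenced [f]. *)
Lemma tsum_step n v w f s : smooth_family w f -> 0 < s <= 1 ->
  let n' := upd n v (n v).+1 in
  tsum n f s = ((z v)^-1 - z v) * tsum n' f s
    + (z v)^-1 * tsum n' (dshift A (- delta_mx v 0) f) s - z v * tsum n' (dshift A (delta_mx v 0)
      f) s.
Proof.
move=> hf hs n'; set ev : 'cV[int]_N := delta_mx v 0.
have key a g : (forall l, g l = gaussian A s (l + a) * f s (l + a)) ->
    has_sum (fun l => (\prod_u (c (n' u) (l u 0) * z u ^ l u 0)) * (g l)%:C%C)
      (tsum n' f s + tsum n' (dshift A a f) s).
  move=> hg.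
  have h1 := @tsum_has n' _ _ _ hf hs; have h2 :=
    @tsum_has n' _ _ _ (smooth_family_dshift A a hf) hs.
  apply: eq_has_sum (has_sumD h1 h2) => l.
  by rewrite /tterm -mulrDr hg gaussian_dshift// -rmorphD -mulrDr.
pose P l := \prod_(u | u != v) (c (n u) (l u 0) * z u ^ l u 0).
have n'E l (r : int) : \prod_u (c (n' u) ((l + r *: ev) u 0) * z u ^ (l + r *: ev) u 0) =
    c (n v).+1 (l v 0 + r) * z v ^ (l v 0 + r) * P l.
  rewrite (bigD1 v)//= /n' /upd eqxx !mxE !eqxx mulr1; congr (_ * _).
  apply: eq_bigr => u uv; rewrite (negbTE uv).
  by rewrite !mxE (negbTE uv) mulr0 addr0.
have k1 := key (- ev) (fun l => gaussian A s (l - ev) * f s (l - ev)) (fun=> erefl).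
have k2 := key ev (fun l => gaussian A s (l + ev) * f s (l + ev)) (fun=> erefl).
have r1 := has_sum_reindex (addrK ev) (subrK ev) k1.
have r2 := has_sum_reindex (subrK ev) (addrK ev) k2.
have T : has_sum (tterm n f s)
   ((z v)^-1 * (tsum n' f s + tsum n' (dshift A (- ev) f) s) +
     - z v * (tsum n' f s + tsum n' (dshift A ev f) s)).
  apply: eq_has_sum (has_sumD (@has_sumZ _ _ _ _ ((z v)^-1) r1) (@has_sumZ _ _ _ _ (- z v) r2)) =>
    l /=.
  have := n'E l 1; have := n'E l (-1); rewrite scaleN1r scale1r => -> ->.
  rewrite addrK subrK /tterm (bigD1 v)//= -/(P l) -(c_rec (n v)).
  rewrite expfzDr// expfzDr// expr1z exprN1.
  move: (z v) (z0 v) (z v ^ _) (P l) (_%:C%C) (c _ _) (c _ _) => x x0 y p G c1 c2.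
  by field; rewrite x0.
by rewrite (has_sum_unique (@tsum_has n _ _ _ hf hs) T); ring.
Qed.

(* [tsum n f] loses at most [s ^- d] and gains [s ^+ e] over the size of [f]. *)
Definition tbound n d e := forall w f, smooth_family w f -> exists2 C : R, 0 <= C &
  forall s, 0 < s <= 1 -> s ^+ d * cabs (tsum n f s) <= C * s ^+ (w + e).

Lemma tbound_basic n : tbound n (\sum_v (n v).-1) 0.
Proof.
move=> w f hf; have [C C0 hC] := tsum_basic n hf; exists C => // s hs.
by rewrite addn0; case: (hC s hs).
Qed.

Lemma tbound_leq n d d' e : (d <= d')%N -> tbound n d e -> tbound n d' e.
Proof.
move=> dd h w f hf; have [C C0 hC] := h w f hf; exists C => // s hs.
apply: le_trans (hC s hs); case/andP: hs => s0 s1.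
by rewrite ler_wpM2r ?cabs_ge0// ler_wiXn2l// ltW.
Qed.

(* At a pole the main term of [tsum_step] vanishes. *)
Lemma tbound_leaf n v d e : z v ^+ 2 = 1 -> n v = 0%N ->
  tbound (upd n v 1) d e -> tbound n d e.+1.
Proof.
move=> zv nv h w f hf.
have zz : (z v)^-1 = z v by apply: (mulfI (z0 v)); rewrite divff// -expr2 zv.
have [C C0 hC] := h _ _ (smooth_family_dshift A (- delta_mx v 0) hf).
have [D D0 hD] := h _ _ (smooth_family_dshift A (delta_mx v 0) hf).
exists (C + D); first by rewrite addr_ge0.
move=> s hs; have := tsum_step n v hf hs; rewrite /= nv zz subrr mul0r add0r => ->.
have := hC s hs; have := hD s hs; rewrite addnS -addSn mulrDl.
set T1 := tsum _ _ _; set T2 := tsum _ _ _ => h1 h2.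
have /andP[s0 s1] := hs.
apply: le_trans (ler_wpM2l (exprn_ge0 _ (ltW s0)) (cabsB _ _)) _.
by rewrite !cabsM z1 !mul1r mulrDr; lra.
Qed.

(** Away from poles [(z v)^-1 - z v] is invertible and [tsum_step] can be solved for the sum with
    raised [n v]. In the error terms [f] has weight one more, which turns the assumed loss [d.+1]
    into [d]. *)
Lemma tbound_nonpole n v d e : z v ^+ 2 != 1 ->
  tbound n d e -> tbound (upd n v (n v).+1) d.+1 e -> tbound (upd n v (n v).+1) d e.
Proof.
move=> zv h0 h w f hf; set n' := upd _ _ _ in h *.
have zz : (z v)^-1 - z v != 0.
  apply: contra zv; rewrite subr_eq0 => /eqP e1.
  by rewrite expr2 -{1}e1 mulVf.
have [B B0 hB] := h0 _ _ hf.
have [C C0 hC] := h _ _ (smooth_family_dshift A (- delta_mx v 0) hf).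
have [D D0 hD] := h _ _ (smooth_family_dshift A (delta_mx v 0) hf).
set k := cabs ((z v)^-1 - z v).
have k0 : 0 < k by rewrite lt_neqAle eq_sym cabs_eq0 zz cabs_ge0.
exists (k^-1 * (B + C + D)); first by rewrite mulr_ge0 ?invr_ge0 ?(ltW k0) ?addr_ge0.
move=> s hs; have := tsum_step n v hf hs; rewrite /= -/n' => E.
have /andP[s0 s1] := hs.
rewrite -!mulrA ler_pdivlMl// mulrCA -cabsM.
set T0 := tsum n f s in E *; set T1 := tsum n' (dshift _ (- _) _) _ in E;
  set T2 := tsum n' (dshift _ _ _) _ in E.
have -> : ((z v)^-1 - z v) * tsum n' f s = T0 - (z v)^-1 * T1 + z v * T2 by rewrite E; ring.
have sd : 0 <= s ^+ d by rewrite exprn_ge0// ltW.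
apply: le_trans (ler_wpM2l sd (cabsD _ _)) _; rewrite mulrDr.
apply: le_trans (lerD (ler_wpM2l sd (cabsB _ _)) (lexx _)) _.
rewrite !cabsM cabsV z1 invr1 !mul1r mulrDr !mulrDl.
have h1 : s ^+ d * cabs T1 <= C * s ^+ (w + e).
  rewrite -(ler_pM2l s0) !mulrA -exprS [s * C]mulrC -mulrA -exprS -addSn; exact: hC.
have h2 : s ^+ d * cabs T2 <= D * s ^+ (w + e).
  rewrite -(ler_pM2l s0) !mulrA -exprS [s * D]mulrC -mulrA -exprS -addSn; exact: hD.
by rewrite !lerD// hB.
Qed.

Definition pole v := z v ^+ 2 == 1.

(** [tbound_leaf] is applied once at each polar vertex with [n v = 0]. Raising such an [n v] to 1
    leaves [(n v).-1] at 0, so the gain has no price. *)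
Lemma tbound_leaves n : tbound n (\sum_v (n v).-1) #|[pred v | pole v && (n v == 0)%N]|.
Proof.
move Ek : #|_| => k; elim: k n Ek => [|k IH] n Ek; first exact: tbound_basic.
have [v hv] : exists v, v \in [pred v | pole v && (n v == 0)%N].
  by apply/card_gt0P; rewrite Ek.
have /andP[/eqP pv /eqP nv] := hv.
apply: (tbound_leaf pv nv).
have -> : \sum_u (n u).-1 = \sum_u (upd n v 1 u).-1.
  by apply: eq_bigr => u _; rewrite /upd; case: eqP => [->|//]; rewrite nv.
apply: IH; move: Ek; rewrite (cardD1 v) hv add1n => -[<-].
apply: eq_card => u; rewrite !inE /upd; case: (eqVneq u v) => //= ->; by rewrite andbF.
Qed.

(** Vertices without a pole should lose nothing. By induction on their total loss, the sum with one
    [n v] lowered already obeys the bound; [tbound_nonpole] then transfers it to [n]. *)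
Lemma tbound_main n : tbound n (\sum_(v | pole v) (n v).-1) #|[pred v | pole v && (n v == 0)%N]|.
Proof.
move Ek : (\sum_(v | ~~ pole v) (n v).-1)%N => k.
elim: k n Ek => [|k IH] n Ek.
  by have := tbound_leaves n; rewrite (bigID pole)/= Ek addn0.
have [v vp nv] : exists2 v, ~~ pole v & (0 < (n v).-1)%N.
  have : (0 < \sum_(v | ~~ pole v) (n v).-1)%N by rewrite Ek.
  rewrite lt0n sum_nat_eq0 negb_forall => /existsP[v]; rewrite negb_imply => /andP[vp nv].
  by exists v => //; rewrite lt0n.
set d := (\sum_(v | pole v) _)%N; set e := #|_|.
pose n0 := upd n v (n v).-1.
have n0v : n0 v = (n v).-1 by rewrite /n0 /upd eqxx.
have nE : upd n0 v (n0 v).+1 = n.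
  apply/funext => u; rewrite /n0 /upd eqxx; case: eqP => [->|//]; by rewrite prednK//; lia.
have IH0 : tbound n0 d e.
  have -> : d = (\sum_(u | pole u) (n0 u).-1)%N.
    by apply: eq_bigr => u up; rewrite /n0 /upd; case: eqP => // uv; rewrite -uv up in vp.
  have -> : e = #|[pred u | pole u && (n0 u == 0)%N]|.
    apply: eq_card => u; rewrite !inE /n0 /upd; case: (eqVneq u v) => // ->.
    by rewrite (negbTE vp).
  apply: IH; move: Ek; rewrite (bigD1 v)//= [in X in _ -> X](bigD1 v)//= n0v.
  rewrite (eq_bigr (fun u => (n0 u).-1)) => [|u /andP[_ uv]]; last first.
    by rewrite /n0 /upd (negbTE uv).
  by move: (\sum_(u | _) _)%N => S; lia.
(* Any excess loss [j] is removed one unit at a time, so the absolute estimate is a sufficient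
   start. *)
have desc j : tbound n (d + j) e -> tbound n d e.
  elim: j => [|j IHj]; first by rewrite addn0.
  rewrite addnS => h; apply: IHj; rewrite -nE; apply: tbound_nonpole => //.
    by apply: tbound_leq IH0; rewrite leq_addr.
  by rewrite nE.
apply: (desc k.+1); rewrite -Ek /d -[(_ + _)%N](bigID pole xpredT) /=.
exact: tbound_leaves.
Qed.

(** * The limit of a twisted sum without poles *)

Section Limit.
Hypothesis nopole : forall v, ~~ pole v.

(** For [z v] = zeta_2k^(-mu_v) this is zeta_2k^(mu_v) - zeta_2k^(-mu_v), the factor in the sum for
    the invariant. *)
Let kap v : R[i] := (z v)^-1 - z v.

Let kap_neq0 v : kap v != 0.
Proof.
apply: contra (nopole v); rewrite /pole /kap subr_eq0 => /eqP e1.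
by rewrite expr2 -{1}e1 mulVf.
Qed.

Let tbound0 n : tbound n 0 0.
Proof.
have := tbound_main n; rewrite big_pred0 => [|v]; last exact/negbTE/nopole.
by rewrite eq_card0// => v; rewrite !inE (negbTE (nopole v)).
Qed.

Definition tlimit n : R[i] := 2 ^+ N * \prod_v kap v ^ (1 - (n v)%:Z).

Let tsum_cvg n := exists2 C : R, 0 <= C &
  forall s, 0 < s <= 1 -> cabs (tsum n (fun _ _ => 1) s - tlimit n) <= C * s.

Let tlimit_step n v : tlimit n = kap v * tlimit (upd n v (n v).+1).
Proof.
rewrite /tlimit mulrCA; congr (_ * _); rewrite (bigD1 v)//= [in RHS](bigD1 v)//= mulrA.
congr (_ * _); last by apply: eq_bigr => u uv; rewrite /upd (negbTE uv).
rewrite /upd eqxx -{2}[kap v]expr1z -expfzDr//; congr (_ ^ _).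
by rewrite -addn1 PoszD; ring.
Qed.

Let tsum_near n v : exists2 C : R, 0 <= C & forall s, 0 < s <= 1 ->
  cabs (tsum n (fun _ _ => 1) s - kap v * tsum (upd n v (n v).+1) (fun _ _ => 1) s) <= C * s.
Proof.
have h1 := @smooth_family1 R N; set n' := upd _ _ _.
have [C C0 hC] := @tbound0 n' _ _ (smooth_family_dshift A (- delta_mx v 0) h1).
have [D D0 hD] := @tbound0 n' _ _ (smooth_family_dshift A (delta_mx v 0) h1).
exists (C + D); first by rewrite addr_ge0.
move=> s hs; rewrite (tsum_step n v h1 hs) /= -/n' -/(kap v).
have -> x y t : kap v * x + (z v)^-1 * y - z v * t - kap v * x = (z v)^-1 * y - z v * t by ring.
have aux T1 T2 : cabs ((z v)^-1 * T1 - z v * T2) <= cabs T1 + cabs T2.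
  by apply: le_trans (cabsB _ _) _; rewrite (cabsM _ T1) (cabsM _ T2) cabsV z1 invr1 !mul1r.
apply: le_trans (aux _ _) _; rewrite [leRHS]mulrDl.
by apply: lerD; [move: (hC s hs) | move: (hD s hs)]; rewrite expr0 mul1r addn0 expr1.
Qed.

Let tsum_cvg_step n v : tsum_cvg n <-> tsum_cvg (upd n v (n v).+1).
Proof.
have [D D0 hD] := tsum_near n v; set n' := upd _ _ _ in hD *.
have k0 : 0 < cabs (kap v) by rewrite lt_neqAle eq_sym cabs_eq0 kap_neq0 cabs_ge0.
split=> -[C C0 hC].
  exists ((cabs (kap v))^-1 * (C + D)); first by rewrite mulr_ge0 ?invr_ge0 ?cabs_ge0 ?addr_ge0.
  move=> s hs; rewrite -mulrA ler_pdivlMl// -cabsM mulrBr -tlimit_step.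
  have -> : kap v * tsum n' (fun _ _ => 1) s - tlimit n =
    (tsum n (fun _ _ => 1) s - tlimit n) -
    (tsum n (fun _ _ => 1) s - kap v * tsum n' (fun _ _ => 1) s) by ring.
  by apply: le_trans (cabsB _ _) _; rewrite [leRHS]mulrDl; apply: lerD; [exact: hC | exact: hD].
exists (D + cabs (kap v) * C); first by rewrite addr_ge0 ?mulr_ge0 ?cabs_ge0.
move=> s hs; rewrite (tlimit_step n v).
have -> : tsum n (fun _ _ => 1) s - kap v * tlimit n' =
    (tsum n (fun _ _ => 1) s - kap v * tsum n' (fun _ _ => 1) s) +
    kap v * (tsum n' (fun _ _ => 1) s - tlimit n') by ring.
apply: le_trans (cabsD _ _) _; rewrite [leRHS]mulrDl; apply: lerD; first exact: hD.
by rewrite cabsM -[leRHS]mulrA ler_wpM2l ?cabs_ge0//; exact: hC.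
Qed.

Let tsum_cvg1 n : (forall v, n v = 1%N) -> tsum_cvg n.
Proof.
move=> n1; exists 0 => // s hs; rewrite mul0r.
have t0 l : l != 0 -> tterm n (fun _ _ => 1) s l = 0.
  move=> l0; have [v lv] : exists v, l v 0 != 0.
    apply/existsP; apply: contraNT l0 => /existsPn h; apply/eqP/matrixP => v j.
    by rewrite ord1 mxE; apply/eqP; have := h v; rewrite negbK.
  by rewrite /tterm (bigD1 v)//= n1 c_one (negbTE lv) mulr0n !mul0r.
have h : has_sum (tterm n (fun _ _ => 1) s) (2 ^+ N).
  apply/has_sumP => e e0; exists [fset (0 : 'cV[int]_N)]%fset => B; rewrite fsub1set => B0.
  rewrite (big_fsetD1 0)//= big_seq big1 => [|l]; last first.
    by rewrite !inE => /andP[l0 _]; exact: t0.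
  rewrite addr0 /tterm /gaussian /qform mulmx0 mxE mulr0 oppr0 expR0 mulr1 mulr1.
  rewrite (eq_bigr (fun=> 2)) => [|v _]; last by rewrite mxE n1 c_one eqxx mulr1n mul1r expr0z
    mulr1.
  by rewrite prodr_const card_ord subrr cabs0 ltW.
rewrite (has_sum_unique (@tsum_has n _ _ _ (@smooth_family1 R N) hs) h) /tlimit.
rewrite (eq_bigr (fun=> 1)) => [|v _]; last by rewrite n1 subrr expr0z.
by rewrite prodr_const expr1n mulr1 subrr cabs0.
Qed.

(** Changing one [n v] by 1 multiplies the sum, up to O(s), and the claimed limit by the same
    nonzero factor. This reduces all cases to [n = 1] everywhere, where only the term [l = 0]
    survives. *)
Lemma tsum_limit n : tsum_cvg n.
Proof.
(* The induction is on the distance of [n] from the constant function 1: leaves must be raised,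
   other vertices lowered. *)
move Ek : (\sum_v ((n v).-1 + (n v == 0)))%N => k.
elim: k n Ek => [|k IH] n Ek.
  apply: tsum_cvg1 => v; move/eqP: Ek; rewrite sum_nat_eq0 => /forallP/(_ v) /=.
  by rewrite addn_eq0; case: (n v) => [|[|m]].
have [v nv] : exists v, (0 < (n v).-1 + (n v == 0))%N.
  apply/existsP; apply: contraPT Ek => /existsPn h; apply/eqP; rewrite eq_sym gtn_eqF//.
  by rewrite big1// => v _; apply/eqP; rewrite -leqn0 leqNgt; exact: h.
move En : (n v) nv => m; case: m En => [|[|m]] En //= _.
  have := tsum_cvg_step n v; rewrite En => h; apply/h; apply: IH.
  move: Ek; rewrite (bigD1 v)//= En [in X in _ -> X](bigD1 v)//= /upd eqxx /=.
  rewrite [X in _ -> (_ + X)%N = _](eq_bigr (fun u => (n u).-1 + (n u == 0))%N) => [|u uv];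
    last first.
    by rewrite (negbTE uv).
  by move: (\sum_(u | _) _)%N => S; lia.
have nE : upd (upd n v m.+1) v (upd n v m.+1 v).+1 = n.
  by apply/funext => u; rewrite /upd eqxx; case: eqP => [->|//]; rewrite En.
have := tsum_cvg_step (upd n v m.+1) v; rewrite nE => h; apply/h; apply: IH.
move: Ek; rewrite (bigD1 v)//= En [in X in _ -> X](bigD1 v)//= /upd eqxx /=.
rewrite [X in _ -> (_ + X)%N = _](eq_bigr (fun u => (n u).-1 + (n u == 0))%N) => [|u uv];
  last first.
  by rewrite (negbTE uv).
by move: (\sum_(u | _) _)%N => S; lia.
Qed.

End Limit.

End LatticeSums.

(** * Principal value integrals *)

Section ComplexIntegralOnUnitInterval.
Variable R : realType.
Implicit Types (f g : R -> R) (F G : R -> R[i]) (t r : R).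

Notation ri f := (\int[lebesgue_measure]_(t in `[0%R, 1%R]) (f t)).

Lemma integrable01 f : continuous f ->
  lebesgue_measure.-integrable `[0%R, 1%R] (EFin \o f).
Proof.
move=> cf; apply: continuous_compact_integrable; first exact: segment_compact.
by apply: continuous_subspaceT.
Qed.

Lemma integral01r_cst (c : R) : ri (fun=> c) = c.
Proof.
have := @Rintegral_cst _ _ R lebesgue_measure `[0%R, 1%R] (measurable_itv _) c.
have E : fine (@lebesgue_measure R `[0%R, 1%R]%classic) = 1.
  have -> := @lebesgue_measure_itv R `[0%R, 1%R].
  by rewrite /= lte_fin ltr01 /= oppr0 addr0.
move=> ->; apply: etrans (mulr1 c); apply: congr1; exact: E.
Qed.

Lemma integral01rD f g : continuous f -> continuous g -> ri (fun t => f t + g t) = ri f + ri g.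
Proof. by move=> cf cg; rewrite RintegralD//; exact: integrable01. Qed.
Lemma integral01rB f g : continuous f -> continuous g -> ri (fun t => f t - g t) = ri f - ri g.
Proof. by move=> cf cg; rewrite RintegralB//; exact: integrable01. Qed.
Lemma integral01rZ c f : continuous f -> ri (fun t => c * f t) = c * ri f.
Proof. by move=> cf; rewrite RintegralZl//; exact: integrable01. Qed.

Lemma integral01r_le f (M : R) : continuous f -> (forall t, `|f t| <= M) -> `|ri f| <= M.
Proof.
move=> cf fM; have iM : lebesgue_measure.-integrable `[0%R, 1%R] (EFin \o (fun=> M : R)).
  by apply: integrable01 => t; exact: cvg_cst.
apply: le_trans (le_normr_Rintegral _ (integrable01 cf)) _ => //.
rewrite -[leRHS]integral01r_cst; apply: le_Rintegral => //.
by apply: (@integrable01 (fun t => `|f t|)) => t; apply: cvg_norm; exact: cf.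
Qed.

Definition ccontinuous F := continuous (fun t => complex.Re (F t)) /\
  continuous (fun t => complex.Im (F t)).

Lemma ccontinuousD F G : ccontinuous F -> ccontinuous G -> ccontinuous (fun t => F t + G t).
Proof.
move=> [F1 F2] [G1 G2]; split.
  have -> : (fun t => complex.Re (F t + G t)) = (fun t => complex.Re (F t) + complex.Re (G t)).
    by apply/funext => t; rewrite raddfD.
  by move=> t; apply: cvgD; [exact: F1 | exact: G1].
have -> : (fun t => complex.Im (F t + G t)) = (fun t => complex.Im (F t) + complex.Im (G t)).
  by apply/funext => t; rewrite raddfD.
by move=> t; apply: cvgD; [exact: F2 | exact: G2].
Qed.

Lemma ccontinuousM F G : ccontinuous F -> ccontinuous G -> ccontinuous (fun t => F t * G t).
Proof.
move=> [F1 F2] [G1 G2]; split.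
  have -> : (fun t => complex.Re (F t * G t)) =
    (fun t => complex.Re (F t) * complex.Re (G t) - complex.Im (F t) * complex.Im (G t)).
    by apply/funext => t; case: (F t); case: (G t).
  by move=> t; apply: cvgB; apply: cvgM; [exact: F1|exact: G1|exact: F2|exact: G2].
have -> : (fun t => complex.Im (F t * G t)) =
    (fun t => complex.Re (F t) * complex.Im (G t) + complex.Im (F t) * complex.Re (G t)).
  by apply/funext => t; case: (F t); case: (G t).
by move=> t; apply: cvgD; apply: cvgM; [exact: F1|exact: G2|exact: F2|exact: G1].
Qed.

Lemma ccontinuous_cst (c : R[i]) : ccontinuous (fun=> c).
Proof. by split=> t; exact: cvg_cst. Qed.

Lemma ccontinuousB (F G : R -> R[i]) : ccontinuous F -> ccontinuous G ->
  ccontinuous (fun t => F t - G t).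
Proof.
move=> cF cG; have -> : (fun t => F t - G t) = (fun t => F t + (-1) * G t).
  by apply/funext => t; rewrite mulN1r.
by apply: ccontinuousD => //; apply: ccontinuousM => //; exact: ccontinuous_cst.
Qed.

Lemma ccontinuousV F : (forall t, F t != 0) -> ccontinuous F -> ccontinuous (fun t => (F t)^-1).
Proof.
move=> F0 [F1 F2].
pose d t := complex.Re (F t) ^+ 2 + complex.Im (F t) ^+ 2.
have d0 t : d t != 0.
  apply: contra (F0 t); rewrite /d paddr_eq0 ?sqr_ge0// !sqrf_eq0.
  by rewrite [F t == 0]eq_complex.
have cd : continuous d.
  by move=> t; apply: cvgD; apply: cvgM; [exact: F1|exact: F1|exact: F2|exact: F2].
split.
  have -> : (fun t => complex.Re (F t)^-1) = (fun t => complex.Re (F t) * (d t)^-1).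
    by apply/funext => t; rewrite /d; case: (F t).
  by move=> t; apply: cvgM; [exact: F1 | apply: cvgV; [exact: d0 | exact: cd]].
have -> : (fun t => complex.Im (F t)^-1) = (fun t => (- complex.Im (F t)) * (d t)^-1).
  by apply/funext => t; rewrite /d; case: (F t) => a b /=; rewrite mulNr.
by move=> t; apply: cvgM; [apply: cvgN; exact: F2 | apply: cvgV; [exact: d0 | exact: cd]].
Qed.

Lemma ccontinuousX F (n : nat) : ccontinuous F -> ccontinuous (fun t => F t ^+ n).
Proof.
move=> cF; elim: n => [|n IH]; first exact: ccontinuous_cst.
have -> : (fun t => F t ^+ n.+1) = (fun t => F t * F t ^+ n) by apply/funext => t; rewrite exprS.
exact: ccontinuousM.
Qed.

Lemma ccontinuousXz F (l : int) : (forall t, F t != 0) -> ccontinuous F ->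
  ccontinuous (fun t => F t ^ l).
Proof.
move=> F0 cF; case: l => n; first exact: ccontinuousX.
have -> : (fun t => F t ^ Negz n) = (fun t => (F t ^+ n.+1)^-1) by [].
by apply: ccontinuousV; [move=> t; rewrite expf_neq0 | exact: ccontinuousX].
Qed.

Lemma ccontinuous_ee (a : R) : ccontinuous (fun t => ee (t * a)).
Proof.
have c t : {for t, continuous (fun t => 2 * pi * (t * a))}.
  by apply: cvgM; [exact: cvg_cst | apply: cvgM; [exact: cvg_id | exact: cvg_cst]].
split=> t /=; [apply: (continuous_comp (c t)); exact: continuous_cos |
  apply: (continuous_comp (c t)); exact: continuous_sin].
Qed.

Lemma integral01D F G : ccontinuous F -> ccontinuous G ->
  integral01 (fun t => F t + G t) = integral01 F + integral01 G.
Proof.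
move=> [F1 F2] [G1 G2]; rewrite /integral01; apply/eqP; rewrite eq_complex /=.
rewrite -(integral01rD F1 G1) -(integral01rD F2 G2); apply/andP; split; apply/eqP;
  by apply: eq_Rintegral => t _; rewrite raddfD.
Qed.

Lemma integral01Z c F : ccontinuous F ->
  integral01 (fun t => c * F t) = c * integral01 F.
Proof.
move=> [F1 F2]; case: c => a b; rewrite /integral01; apply/eqP; rewrite eq_complex /=.
have k x f : continuous f -> continuous (fun t => x * f t).
  by move=> cf t; apply: cvgM; [exact: cvg_cst | exact: cf].
rewrite -(integral01rZ a F1) -(integral01rZ b F2) -(integral01rZ a F2) -(integral01rZ b F1).
rewrite -(integral01rB (k a _ F1) (k b _ F2)) -(integral01rD (k a _ F2) (k b _ F1)); apply/andP;
  split; apply/eqP;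
  by apply: eq_Rintegral => t _; case: (F t).
Qed.

Lemma integral01B F G : ccontinuous F -> ccontinuous G ->
  integral01 (fun t => F t - G t) = integral01 F - integral01 G.
Proof.
move=> cF cG; have cN := ccontinuousM (ccontinuous_cst (-1)) cG.
have -> : (fun t => F t - G t) = (fun t => F t + (-1) * G t).
  by apply/funext => t; rewrite mulN1r.
by rewrite integral01D// integral01Z// mulN1r.
Qed.

(** The factor 2 comes from estimating the real and imaginary parts separately. *)
Lemma integral01_le F (M : R) : ccontinuous F -> (forall t, cabs (F t) <= M) ->
  cabs (integral01 F) <= 2 * M.
Proof.
move=> [F1 F2] FM; apply: le_trans (cabs_le_ReIm _) _; rewrite mulr2n mulrDl !mul1r.
by apply: lerD; apply: integral01r_le => // t; apply: le_trans (FM t);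
  [exact: Re_le_cabs|exact: Im_le_cabs].
Qed.

Lemma integral01_cst (c : R[i]) : integral01 (fun=> c) = c.
Proof. by rewrite /integral01 !integral01r_cst; case: c. Qed.

Lemma integral01_sum (I : Type) (s : seq I) (F : I -> R -> R[i]) :
  (forall i, ccontinuous (F i)) -> ccontinuous (fun t => \sum_(i <- s) F i t) /\
  integral01 (fun t => \sum_(i <- s) F i t) = \sum_(i <- s) integral01 (F i).
Proof.
move=> cF; elim: s => [|i s [IH1 IH2]].
  under eq_fun do rewrite big_nil.
  by split; [exact: ccontinuous_cst | rewrite big_nil integral01_cst].
under eq_fun do rewrite big_cons.
by split; [exact: ccontinuousD | rewrite integral01D// IH2 big_cons].
Qed.

Lemma integral01_ee (l : int) : integral01 (fun t => ee (t * l%:~R) : R[i]) = (l == 0)%:R.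
Proof.
have [->|l0] := eqVneq l 0.
  by under [X in integral01 X]eq_fun do rewrite mulr0 ee0; rewrite integral01_cst.
pose a : R := 2 * pi * l%:~R.
have a0 : a != 0 by rewrite !mulf_neq0 ?intr_eq0 ?pnatr_eq0 ?(gt_eqF (pi_gt0 R)).
have sa : sin a = 0 /\ cos a = 1.
  have := ee_int R l; rewrite /ee => /eqP; rewrite eq_complex /= -/a.
  by case/andP => /eqP -> /eqP ->.
have ftc (f F : R -> R) : continuous f ->
    (forall t : R, is_derive (t : R) 1 F (f t)) -> ri f = F 1 - F 0.
  move=> cf dF; have cF : continuous F.
    by move=> t; apply/differentiable_continuous/derivable1_diffP; apply: ex_derive.
  rewrite /Rintegral (@continuous_FTC2 _ f F 0 1)//.
  - exact: continuous_subspaceT.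
  - split.
    + by move=> x _; apply: ex_derive.
    + by apply: cvg_at_right_filter; exact: cF.
    + by apply: cvg_at_left_filter; exact: cF.
  - by move=> x _; rewrite derive1E; apply: derive_val.
have dl (t : R) : is_derive t 1 (fun t : R => 2 * pi * (t * l%:~R)) a.
  by apply: is_derive_eq; rewrite /a /GRing.scale /=; ring.
have cl (t : R) : {for t, continuous (fun t : R => 2 * pi * (t * l%:~R))}.
  by apply/differentiable_continuous/derivable1_diffP; apply: ex_derive.
have dsin (t : R) : is_derive t 1 (fun t : R => a^-1 * sin (2 * pi * (t * l%:~R)))
    (cos (2 * pi * (t * l%:~R))).
  have := is_deriveZ (a^-1) (@is_derive1_comp _ _ (fun t : R =>
    2 * pi * (t * l%:~R)) t _ _ (is_derive_sin (2 * pi * (t * l%:~R))) (dl t)).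
  by move/(@is_derive_eq _ _ _ _ _ _ _ _); apply; rewrite /GRing.scale /= mulrCA mulVf// mulr1.
have dcos (t : R) : is_derive t 1 (fun t : R => (- a^-1) * cos (2 * pi * (t * l%:~R)))
    (sin (2 * pi * (t * l%:~R))).
  have := is_deriveZ (- a^-1) (@is_derive1_comp _ _ (fun t : R =>
    2 * pi * (t * l%:~R)) t _ _ (is_derive_cos (2 * pi * (t * l%:~R))) (dl t)).
  by move/(@is_derive_eq _ _ _ _ _ _ _ _); apply;
    rewrite /GRing.scale /= mulNr mulNr mulrN opprK mulrCA mulVf// mulr1.
rewrite /integral01 mulr0n; apply/eqP; rewrite eq_complex /=.
rewrite (ftc _ _ _ dsin); last first.
  by move=> t; apply: (continuous_comp (cl t)); exact: continuous_cos.
rewrite (ftc _ _ _ dcos); last first.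
  by move=> t; apply: (continuous_comp (cl t)); exact: continuous_sin.
rewrite !mul1r !mul0r !mulr0 -/a sin0 cos0; case: sa => -> ->.
by rewrite mulr0 subrr subrr !eqxx.
Qed.

End ComplexIntegralOnUnitInterval.

(** * Termwise integration of uniformly convergent sums *)

Section IntegralOfSums.
Variable R : realType.

Lemma continuous_approx (f : R -> R) :
  (forall e : R, 0 < e -> exists2 g : R -> R, continuous g & forall t, `|f t - g t| <= e) ->
  continuous f.
Proof.
move=> app t; apply/cvgrPdist_le => e e0.
have e3 : 0 < e / 3 by rewrite divr_gt0.
have [g cg fg] := app _ e3.
have := cg t => /cvgrPdist_le /(_ _ e3); apply: filterS => x gx.
have -> : f t - f x = (f t - g t) + (g t - g x) - (f x - g x) by ring.
apply: le_trans (ler_normB _ _) _; rewrite (_ : e = (e / 3 + e / 3) + e / 3); last by field.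
by apply: lerD => //; apply: le_trans (ler_normD _ _) _; apply: lerD.
Qed.

Lemma ccontinuous_approx (F : R -> R[i]) :
  (forall e : R, 0 < e -> exists2 G, ccontinuous G & forall t, cabs (F t - G t) <= e) ->
  ccontinuous F.
Proof.
move=> app; split; apply: continuous_approx => e /app[G [G1 G2] FG].
  by exists (fun t => complex.Re (G t)) => // t; apply: le_trans (FG t); rewrite -raddfB Re_le_cabs.
by exists (fun t => complex.Im (G t)) => // t; apply: le_trans (FG t); rewrite -raddfB Im_le_cabs.
Qed.

Variables (I : choiceType) (f : I -> R -> R[i]) (F : R -> R[i]) (M : I -> R) (B : R).
Hypothesis f_cont : forall i, ccontinuous (f i).
Hypothesis f_le : forall i t, cabs (f i t) <= M i.
Hypothesis M_sum : bounded_sums M B.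
Hypothesis f_sum : forall t, has_sum (f^~ t) (F t).

Let unif (e : R) : 0 < e -> exists A : {fset I}, forall C : {fset I}, (A `<=` C)%fset ->
  forall t, cabs (F t - \sum_(i <- C) f i t) <= e.
Proof.
move=> e0.
have M0 i : 0 <= M i by apply: le_trans (f_le i 0); exact: cabs_ge0.
have [A hA] := bounded_sums_tail M0 M_sum e0.
have key C1 C2 t : (A `<=` C1)%fset -> (C1 `<=` C2)%fset ->
    cabs (\sum_(i <- C2) f i t - \sum_(i <- C1) f i t) <= e.
  move=> AC1 C12; rewrite sum_fset_setD//; apply: le_trans (cabs_sum _ _ _) _.
  apply: le_trans (hA C2 (fsubset_trans AC1 C12)).
  apply: le_trans (ler_sum _ (fun i _ => f_le i t)) _.
  rewrite -(sum_fset_setD M C12) -(sum_fset_setD M (fsubset_trans AC1 C12)) lerD2l lerN2.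
  by rewrite -subr_ge0 sum_fset_setD// sumr_ge0.
exists A => C AC t.
apply/ler_addgt0Pr => d d0.
have [A' hA'] := (has_sumP _ _).1 (@f_sum t) d d0.
have h1 := hA' (A' `|` C)%fset (fsubsetUl _ _).
have h2 := key C (A' `|` C)%fset t AC (fsubsetUr _ _).
rewrite [leRHS]addrC; apply: (le_trans _ (lerD h1 h2)).
rewrite (cabs_distC _ (F t)); apply: (le_trans _ (cabsD _ _)).
by rewrite subrKA.
Qed.

(** Weierstrass test: the majorant makes the finite sums converge uniformly in [t], so the limit is
    continuous and its integral is approximated by theirs. *)
Lemma integral01_has_sum : ccontinuous F /\ has_sum (fun i => integral01 (f i)) (integral01 F).
Proof.
have cF : ccontinuous F.
  apply: ccontinuous_approx => e /unif[A hA]; exists (fun t => \sum_(i <- A) f i t); last exact: hA.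
  by case: (integral01_sum (enum_fset A) f_cont).
split=> //; apply/has_sumP => e e0; have e2 : 0 < e / 2 by rewrite divr_gt0.
have [A hA] := unif e2; exists A => C AC.
have [c1 <-] := integral01_sum (enum_fset C) f_cont.
rewrite cabs_distC -integral01B//.
have -> : e = 2 * (e / 2) by field.
by apply: integral01_le; [exact: ccontinuousB | exact: hA].
Qed.

End IntegralOfSums.

(** * One-variable circle integrals and their principal values *)

Section CircleKernels.
Variable R : realType.
Implicit Types (r t : R) (n : nat) (l : int).

Definition circle_pt r t : R[i] := r%:C%C * ee t.
Definition sub_inv (z : R[i]) := z - z^-1.
Definition circle_kernel n l (z : R[i]) : R[i] :=
  z ^ l * (sub_inv z ^ (1 - n%:Z) / (two_pi_i R * z)).
Definition circle_coef r n l : R[i] := integral01 (fun t =>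
  circle_pt r t ^ l * sub_inv (circle_pt r t) ^ (1 - n%:Z)).

Lemma cabs_circle_pt r t : 0 < r -> cabs (circle_pt r t) = r.
Proof. by move=> r0; rewrite cabsM cabs_ee mulr1 cabs_real gtr0_norm. Qed.

Lemma circle_pt_neq0 r t : 0 < r -> circle_pt r t != 0.
Proof. by move=> r0; rewrite -cabs_eq0 cabs_circle_pt// gt_eqF. Qed.

Lemma two_pi_i_neq0 : two_pi_i R != 0.
Proof. by rewrite eq_complex /= negb_and orbC mulf_neq0 // ?pnatr_eq0// gt_eqF// pi_gt0. Qed.

Lemma circle_integral_kernel r n l : 0 < r -> circle_integral r (circle_kernel n l) =
  circle_coef r n l.
Proof.
move=> r0; congr integral01; apply/funext => t.
rewrite /= e2pi_real -/(circle_pt r t) /circle_kernel -mulrA divfK//.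
by rewrite mulf_neq0 ?two_pi_i_neq0 ?circle_pt_neq0.
Qed.

Lemma cabs_sub_inv_ge (z : R[i]) : z != 0 -> `|cabs z - (cabs z)^-1| <= cabs (sub_inv z).
Proof.
move=> z0; have tri (x y : R[i]) : cabs x - cabs y <= cabs (x - y).
  by rewrite lerBlDr; apply: le_trans (cabsD _ _); rewrite subrK.
rewrite -cabsV ler_norml lerNl opprB; apply/andP; split; last exact: tri.
by rewrite /sub_inv cabs_distC; exact: tri.
Qed.

Lemma cabs_sub_inv_circle_ge r t : 0 < r -> `|r - r^-1| <= cabs (sub_inv (circle_pt r t)).
Proof. by move=> r0; rewrite -{1 2}(cabs_circle_pt t r0) cabs_sub_inv_ge// circle_pt_neq0. Qed.

Lemma radius_gap r : 0 < r -> r != 1 -> 0 < `|r - r^-1|.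
Proof.
move=> r0 r1; rewrite normr_gt0 subr_eq0; apply: contra r1 => /eqP e.
have : r ^+ 2 == 1 by rewrite expr2 {2}e divff// gt_eqF.
by rewrite sqrf_eq1 => /orP[//|/eqP e1]; rewrite e1 in r0; lra.
Qed.

Lemma sub_inv_circle_neq0 r t : 0 < r -> r != 1 -> sub_inv (circle_pt r t) != 0.
Proof.
move=> r0 r1; rewrite -cabs_eq0 gt_eqF//.
exact: lt_le_trans (radius_gap r0 r1) (cabs_sub_inv_circle_ge t r0).
Qed.

Lemma sub_inv_pow_bound r n : 0 < r -> r != 1 -> exists2 B : R, 0 <= B &
  forall t, cabs (sub_inv (circle_pt r t) ^ (1 - n%:Z)) <= B.
Proof.
move=> r0 r1; case: n => [|n].
  exists (r + r^-1); first by rewrite addr_ge0 ?invr_ge0 ?(ltW r0).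
  move=> t; rewrite subr0 expr1z; apply: le_trans (cabsB _ _) _.
  by rewrite cabsV cabs_circle_pt.
exists (`|r - r^-1| ^- n); first by rewrite invr_ge0 exprn_ge0.
move=> t; have -> : 1 - n.+1%:Z = - n%:Z by lia.
rewrite cabsXz -exprnN lef_pV2 ?posrE ?exprn_gt0 ?radius_gap//; last first.
  by rewrite lt_neqAle cabs_ge0 eq_sym cabs_eq0 sub_inv_circle_neq0.
by rewrite lerXn2r ?nnegrE ?cabs_ge0 ?cabs_sub_inv_circle_ge.
Qed.

Lemma ccontinuous_circle_pt r : ccontinuous (circle_pt r).
Proof.
apply: ccontinuousM; first exact: ccontinuous_cst.
have -> : @ee R = (fun t => ee (t * 1)) by apply/funext => t; rewrite mulr1.
exact: ccontinuous_ee.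
Qed.

Lemma ccontinuous_integrand r n l : 0 < r -> r != 1 ->
  ccontinuous (fun t => circle_pt r t ^ l * sub_inv (circle_pt r t) ^ (1 - n%:Z)).
Proof.
move=> r0 r1; apply: ccontinuousM; apply: ccontinuousXz.
- by move=> t; exact: circle_pt_neq0.
- exact: ccontinuous_circle_pt.
- by move=> t; exact: sub_inv_circle_neq0.
apply: ccontinuousB; first exact: ccontinuous_circle_pt.
by apply: ccontinuousV; [move=> t; exact: circle_pt_neq0 | exact: ccontinuous_circle_pt].
Qed.

(** The bound decays as [l] tends to minus infinity if [r > 1], and to plus infinity if [r < 1].
    This decay pins the coefficients down among all solutions of the recursion. *)
Lemma circle_coef_bound r n : 0 < r -> r != 1 -> exists2 B : R, 0 <= B &
  forall l, cabs (circle_coef r n l) <= B * r ^ l.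
Proof.
move=> r0 r1; have [B B0 hB] := sub_inv_pow_bound n r0 r1.
exists (2 * B); first by rewrite mulr_ge0.
move=> l; rewrite -mulrA; apply: integral01_le; first exact: ccontinuous_integrand.
move=> t; rewrite cabsM cabsXz cabs_circle_pt// mulrC ler_wpM2r ?exprz_ge0 ?(ltW r0)//.
Qed.

Lemma circle_coef_rec r n l : 0 < r -> r != 1 -> circle_coef r n.+1 (l +
  1) - circle_coef r n.+1 (l - 1) = circle_coef r n l.
Proof.
move=> r0 r1; rewrite -integral01B; try exact: ccontinuous_integrand.
congr integral01; apply/funext => t.
have c0 := circle_pt_neq0 t r0; have h0 := sub_inv_circle_neq0 t r0 r1.
have -> : 1 - n%:Z = 1 + (1 - n.+1%:Z) by lia.
move: (circle_pt r t) (1 - n.+1%:Z) c0 h0 => z m c0 h0.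
rewrite (expfzDr 1 m h0) (expfzDr l 1 c0) (expfzDr l (-1) c0) !expr1z exprN1.
by rewrite -mulrBl -mulrBr mulrA.
Qed.

Lemma circle_coef_one r l : 0 < r -> circle_coef r 1 l = (l == 0)%:R.
Proof.
move=> r0; rewrite /circle_coef.
have -> : (fun t => circle_pt r t ^ l * sub_inv (circle_pt r t) ^ (1 - 1%:Z)) =
    (fun t => (r%:C%C ^ l) * ee (t * l%:~R)).
  apply/funext => t; move: (sub_inv _) => h; rewrite (eeMz t l) /circle_pt.
  move: (ee t) (r%:C%C) => x y; rewrite expfzMl; exact: mulr1.
rewrite integral01Z ?integral01_ee; last exact: ccontinuous_ee.
by case: eqP => [->|_]; rewrite ?expr0z ?mulr1 ?mulr0.
Qed.

Lemma le0_geometric (x C q : R) : 0 <= q < 1 -> (forall k : nat, x <= C * q ^+ k) -> x <= 0.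
Proof.
move=> /andP[q0 q1] h.
have qC : geometric C q @ \oo --> 0 by apply: cvg_geometric; rewrite ger0_norm.
by apply: (cvgr_to_ge qC); apply: nearW => k; exact: h.
Qed.

(** Takes the place of Cauchy's theorem for two radii on the same side of 1, the side being encoded
    by the sign of [e]. By induction on the order, the difference [d] of the two coefficients takes
    equal values at arguments differing by 2; since both coefficients decay in one direction, [d]
    vanishes. *)
Lemma circle_coef_indep r r' (e : int) n l : 0 < r -> 0 < r' -> 1 < r ^ e -> 1 < r' ^ e ->
  circle_coef r n l = circle_coef r' n l.
Proof.
have pos (x : R) : 0 < x -> 1 < x ^ e -> x != 1.
  by move=> _; apply: contraL => /eqP ->; rewrite exp1rz ltxx.
move=> r0 r0' e1 e1'; have r1 := pos _ r0 e1; have r1' := pos _ r0' e1'.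
suff main m k : circle_coef r m.+1 k = circle_coef r' m.+1 k.
  by case: n => [|n//]; rewrite -(circle_coef_rec 0 l r0 r1) -(circle_coef_rec 0 l r0' r1') !main.
elim: m k => [|m IH] k; first by rewrite !circle_coef_one.
pose d (j : int) := circle_coef r m.+2 j - circle_coef r' m.+2 j.
have dstep (j : int) : d (j + 1) = d (j - 1).
  apply/eqP; rewrite -subr_eq0 /d.
  have AC (a b c' g : R[i]) : a - b - (c' - g) = (a - c') - (b - g) by ring.
  rewrite AC {AC}.
  rewrite subr_eq0; apply/eqP; apply: etrans (circle_coef_rec m.+1 j r0 r1) _.
  by apply: etrans (IH j) _; apply: esym; exact: circle_coef_rec.
have dper (i : nat) (j : int) : d (j - 2 * i%:Z) = d j /\ d (j + 2 * i%:Z) = d j.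
  split; elim: i j => [|i IHi] j; rewrite ?mulr0 ?subr0 ?addr0//.
    have -> : j - 2 * i.+1%:Z = (j - 2 * i%:Z - 1) - 1 by lia.
    by rewrite -dstep subrK IHi.
  have -> : j + 2 * i.+1%:Z = (j + 2 * i%:Z + 1) + 1 by lia.
  by rewrite dstep addrK IHi.
(* Moving by multiples of [2 * e] goes in the direction of decay, whichever side of 1 the radii lie
   on. *)
have dE (i : nat) (j : int) : d (j - 2 * i%:Z * e) = d j.
  have -> : j - 2 * i%:Z * e = if 0 <= e then j - 2 * (i * `|e|)%N%:Z else j + 2 * (i * `|e|)%N%:Z.
    by case: e {e1 e1' pos} => e; rewrite PoszM /= ?NegzE; lia.
  by case: ifP => _; case: (dper (i * `|e|)%N j).
have [B B0 hB] := circle_coef_bound m.+2 r0 r1; have [B' B0' hB'] := circle_coef_bound m.+2 r0' r1'.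
pose q := Num.max (r ^ (- e)) (r' ^ (- e)).
have V (x : R) : 1 < x ^ e -> 0 <= x ^ (- e) < 1.
  move=> xe; rewrite -invr_expz invr_ge0 invf_lt1 ?xe ?(lt_trans ltr01 xe)//.
  by rewrite ltW ?(lt_trans ltr01 xe).
have q01 : 0 <= q < 1.
  by rewrite le_max gt_max; case/andP: (V _ e1) => -> ->; case/andP: (V _ e1') => _ ->.
apply/eqP; rewrite -subr_eq0 -/(d k) -cabs_eq0 eq_le cabs_ge0 andbT.
apply: (le0_geometric (C := B * r ^ k + B' * r' ^ k) q01) => i.
rewrite -(dE i k); apply: le_trans (cabsB _ _) _.
have bnd (x b : R) : 0 < x -> 0 <= b -> x ^ (- e) <= q -> 1 < x ^ e ->
    b * x ^ (k - 2 * i%:Z * e) <= b * x ^ k * q ^+ i.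
  move=> x0 b0 xq xe; rewrite -[leRHS]mulrA; apply: ler_wpM2l => //.
  rewrite expfzDr ?(gt_eqF x0)//; apply: ler_wpM2l; first by rewrite exprz_ge0// ltW.
  have -> : - (2 * i%:Z * e) = (- e) * (2 * i)%N%:Z by rewrite PoszM mulNr [e * _]mulrC.
  rewrite -exprz_exp -exprnP exprM; case/andP: (V _ xe) => y0 y1.
  rewrite lerXn2r ?nnegrE ?sqr_ge0//; first by case/andP: q01.
  by apply: le_trans xq; rewrite expr2 ler_piMr// ltW.
rewrite [leRHS]mulrDl; apply: lerD.
  by apply: le_trans (hB _) _; apply: bnd; rewrite // le_max lexx.
by apply: le_trans (hB' _) _; apply: bnd; rewrite // le_max lexx orbT.
Qed.

(* The principal value of [z ^ l * (z - 1/z) ^ (1 - n) / (2 pi i z)].  It vanishes unless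
   [l] has the parity of [n + 1]; building this in spares a half-turn symmetry argument. *)
Definition pv_coef n l : R[i] := (2 %| l + n%:Z + 1)%Z%:R * (circle_coef 2 n l +
  circle_coef 2^-1 n l).

Lemma two_radii : [/\ 0 < 2 :> R, 0 < 2^-1 :> R, (2 : R) != 1 & (2^-1 : R) != 1].
Proof. by rewrite invr_gt0 invr_eq1 ltr0n pnatr_eq1. Qed.

Lemma pv_coef_rec n l : pv_coef n.+1 (l + 1) - pv_coef n.+1 (l - 1) = pv_coef n l.
Proof.
have [p1 p2 n1 n2] := two_radii; rewrite /pv_coef -(circle_coef_rec n l p1 n1) -(circle_coef_rec n
  l p2 n2).
have -> : (2 %| l + 1 + n.+1%:Z + 1)%Z = (2 %| l + n%:Z + 1)%Z by lia.
have -> : (2 %| l - 1 + n.+1%:Z + 1)%Z = (2 %| l + n%:Z + 1)%Z by lia.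
move: (circle_coef _ n.+1 (l + 1)) (circle_coef _ n.+1 (l - 1)) (circle_coef _ n.+1 (l +
  1)) (circle_coef _ n.+1 (l - 1)) => a b a' b'.
by move: (_%:R) => x; ring.
Qed.

Lemma pv_coef_one l : pv_coef 1 l = (l == 0)%:R * 2.
Proof.
have [p1 p2 _ _] := two_radii; rewrite /pv_coef !circle_coef_one//.
have [->|_] := eqVneq l 0; last by rewrite mulr0n addr0 mulr0 mul0r.
by rewrite (_ : (2 %| 0 + 1%:Z + 1)%Z = true)// !mul1r.
Qed.

Lemma pv_coef_bound n : exists2 B : R, 0 <= B & forall l, cabs (pv_coef n l) <= B * 2 ^+ `|l|%N.
Proof.
have [p1 p2 n1 n2] := two_radii.
have [B B0 hB] := circle_coef_bound n p1 n1; have [B' B0' hB'] := circle_coef_bound n p2 n2.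
exists (B + B'); first exact: addr_ge0.
move=> l; have le1 : cabs (pv_coef n l) <= cabs (circle_coef 2 n l + circle_coef 2^-1 n l).
  by rewrite /pv_coef cabsM cabs_nat; case: (_ %| _)%Z; rewrite ?mul1r ?mul0r ?cabs_ge0.
apply: le_trans le1 _; apply: le_trans (cabsD _ _) _; rewrite mulrDl.
have pw (x : R) (j : int) : 1 <= x -> x ^ j <= x ^+ `|j|%N.
  by move=> x1; rewrite [leRHS]exprnP ler_weXz2l// lez_abs.
apply: lerD; [apply: le_trans (hB _) _ | apply: le_trans (hB' _) _]; rewrite ler_wpM2l//.
  by apply: pw; lra.
by rewrite exprz_inv -(abszN l); apply: pw; lra.
Qed.

Lemma circle_integral_pair n l (e : R) : 0 < e < 1 -> (2 %| l + n%:Z + 1)%Z ->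
  circle_integral (1 + e) (circle_kernel n l) + circle_integral (1 - e) (circle_kernel n l) =
    pv_coef n l.
Proof.
move=> /andP[e0 e1] par; rewrite !circle_integral_kernel ?subr_gt0 ?ltr_pDr ?addr_gt0//.
rewrite /pv_coef par.
have -> : circle_coef (1 + e) n l = circle_coef 2 n l by apply: (@circle_coef_indep _ _ 1);
  rewrite ?expr1z; lra.
have -> : circle_coef (1 - e) n l = circle_coef 2^-1 n l.
  by apply: (@circle_coef_indep _ _ (-1)); rewrite ?exprN1 ?invrK ?invf_gt1; lra.
by move: (circle_coef 2 n l) (circle_coef _ n l) => a b; rewrite mul1r.
Qed.

End CircleKernels.

(** * Iterated principal values of a rapidly convergent series *)

Section IteratedIntegral.
Variables (R : realType) (N : nat) (I : choiceType).
Variables (n : 'I_N -> nat) (ell : I -> 'I_N -> int) (a : I -> R[i]).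
Variable F : ('I_N -> R[i]) -> R[i].
Hypothesis ell_parity : forall m v, (2 %| ell m v + (n v)%:Z + 1)%Z.
Hypothesis a_decay : forall rho : 'I_N -> R, (forall v, 1 <= rho v) ->
  exists B, bounded_sums (fun m => cabs (a m) * \prod_v rho v ^+ `|ell m v|%N) B.
Hypothesis F_sum : forall z : 'I_N -> R[i], (forall v, z v != 0) ->
  has_sum (fun m => a m * \prod_v circle_kernel (n v) (ell m v) (z v)) (F z).

(** The one-variable factors against which the coefficients [a] remain summable. They include the
    kernel at a fixed point, its bound on a circle, and the principal values. *)
Definition growth (phi : int -> R) := exists C rho : R,
  [/\ 0 <= C, 1 <= rho & forall l, 0 <= phi l <= C * rho ^+ `|l|%N].

Lemma growth_bounded_sums (phi : 'I_N -> int -> R) : (forall v, growth (phi v)) ->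
  exists B, bounded_sums (fun m => cabs (a m) * \prod_v phi v (ell m v)) B.
Proof.
move=> gphi; have [C /fin_all_exists[rho hC]] := fin_all_exists gphi.
have [B hB] : exists B, bounded_sums (fun m => cabs (a m) * \prod_v rho v ^+ `|ell m v|%N) B.
  by apply: a_decay => v; case: (hC v).
have C0 : 0 <= \prod_v C v by apply: prodr_ge0 => v _; case: (hC v).
exists (\prod_v C v * B) => A; apply: le_trans (ler_wpM2l C0 (hB A)).
rewrite mulr_sumr; apply: ler_sum => m _; rewrite mulrCA ler_wpM2l ?cabs_ge0//.
rewrite -big_split /=; apply: ler_prod => v _; by case: (hC v).
Qed.

Lemma growth_exprz (C x : R) : 0 <= C -> 0 < x -> growth (fun l => C * x ^ l).
Proof.
move=> C0 x0; exists C, (Num.max 1 (x + x^-1)); split=> //; first by rewrite le_max lexx.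
move=> l; rewrite mulr_ge0 ?exprz_ge0 ?(ltW x0)//= ler_wpM2l//.
have V : 0 < x^-1 by rewrite invr_gt0.
have [l0|l0] := leP 0 l.
  rewrite -{1}(gez0_abs l0) -exprnP lerXn2r ?nnegrE ?(ltW x0) ?le_max ?ler01//.
  by rewrite lerDl (ltW V) orbT.
have -> : x ^ l = x^-1 ^+ `|l|%N by rewrite exprnP exprz_inv ltz0_abs// opprK.
rewrite lerXn2r ?nnegrE ?(ltW V) ?le_max ?ler01//.
by rewrite lerDr (ltW x0) orbT.
Qed.

Lemma growth_circle_kernel k (x : R[i]) : x != 0 -> growth (fun l => cabs (circle_kernel k l x)).
Proof.
move=> x0; have p0 : 0 < cabs x by rewrite lt_neqAle eq_sym cabs_eq0 x0 cabs_ge0.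
have -> : (fun l => cabs (circle_kernel k l x)) =
    (fun l => cabs (sub_inv x ^ (1 - k%:Z) / (two_pi_i R * x)) * cabs x ^ l).
  by apply/funext => l; rewrite /circle_kernel cabsM cabsXz mulrC.
by apply: growth_exprz; rewrite ?cabs_ge0.
Qed.

Lemma growth_pv_coef k : growth (fun l => cabs (pv_coef R k l)).
Proof.
have [B B0 hB] := pv_coef_bound R k; exists B, 2; split=> //; first by rewrite ler1n.
by move=> l; rewrite cabs_ge0 hB.
Qed.

(** The variables in [s] have been integrated out; the others are still evaluated at [z]. *)
Let fac (s : seq 'I_N) (z : 'I_N -> R[i]) m v :=
  if v \in s then pv_coef R (n v) (ell m v) else circle_kernel (n v) (ell m v) (z v).

(* In each variable the two circle integrals add up to a value independent of the radius,
   so that the principal value is attained before the limit. *)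
Lemma pv_iterated_has_sum s z : uniq s -> (forall v, z v != 0) ->
  has_sum (fun m => a m * \prod_v fac s z m v) (pv_iterated s F z).
Proof.
elim: s z => [|v s IH] z /=; first by move=> _; exact: F_sum.
move=> /andP[vs us] z0.
pose b m := a m * \prod_(u | u != v) fac s z m u.
pose Phi x := pv_iterated s F [eta z with v |-> x].
have hPhi (x : R[i]) : x != 0 -> has_sum (fun m => b m * circle_kernel (n v) (ell m v) x) (Phi x).
  move=> x0; apply: eq_has_sum (IH [eta z with v |-> x] us _); last first.
    by move=> u /=; case: ifP.
  move=> m; rewrite (bigD1 v)//= /b /fac /= (negbTE vs) eqxx mulrCA mulrC; congr (_ * _ * _).
  by apply: eq_bigr => u /negbTE uv; rewrite uv.
have gb (phi : int -> R) : growth phi ->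
    exists B, bounded_sums (fun m => cabs (b m) * phi (ell m v)) B.
  move=> gphi; pose ph u := if u == v then phi else if u \in s then
    (fun l => cabs (pv_coef R (n u) l)) else (fun l => cabs (circle_kernel (n u) l (z u))).
  have [u|B hB] := @growth_bounded_sums ph.
    by rewrite /ph; case: ifP => // _; case: ifP => _; [exact: growth_pv_coef |
      exact: growth_circle_kernel].
  exists B; suff -> : (fun m => cabs (b m) * phi (ell m v)) =
    (fun m => cabs (a m) * \prod_u ph u (ell m u)) by [].
  apply/funext => m; rewrite (bigD1 v)//= [ph v]/ph eqxx /b cabsM cabs_prod.
  rewrite [RHS]mulrA [LHS]mulrAC; congr (_ * _); apply: eq_bigr => u /negbTE uv;
    rewrite /ph uv /fac.
  by case: ifP.
have hC r : 0 < r -> r != 1 ->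
    has_sum (fun m => b m * circle_coef r (n v) (ell m v)) (circle_integral r Phi).
  move=> r0 r1; have [B B0 hB] := sub_inv_pow_bound (n v) r0 r1.
  have [S hS] := gb _ (growth_exprz B0 r0).
  pose f m t := b m * (circle_pt r t ^ ell m v * sub_inv (circle_pt r t) ^ (1 - (n v)%:Z)).
  have ci t : circle_pt r t != 0 by exact: circle_pt_neq0.
  have fc m : ccontinuous (f m).
    by apply: ccontinuousM; [exact: ccontinuous_cst | exact: ccontinuous_integrand].
  have fl m t : cabs (f m t) <= cabs (b m) * (B * r ^ ell m v).
    rewrite cabsM ler_wpM2l ?cabs_ge0// cabsM cabsXz cabs_circle_pt// mulrC.
    by rewrite ler_wpM2r ?exprz_ge0 ?(ltW r0).
  have fs t : has_sum (f^~ t) (Phi (circle_pt r t) * (two_pi_i R * circle_pt r t)).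
    have := has_sumZ (c := two_pi_i R * circle_pt r t) (hPhi _ (ci t)).
    have := mulf_neq0 (two_pi_i_neq0 R) (ci t).
    rewrite /f /circle_kernel; move: (two_pi_i R * _) (Phi _) (sub_inv _ ^ _) => w S' h w0.
    rewrite [w * S']mulrC; apply: eq_has_sum => m; move: (circle_pt r t ^ _) => x.
    by rewrite mulrCA [w * _]mulrCA [w * _]mulrC divfK.
  have [_] := integral01_has_sum fc fl hS fs.
  have -> : integral01 (fun t => Phi (circle_pt r t) * (two_pi_i R * circle_pt r t)) =
    circle_integral r Phi.
    by congr integral01; apply/funext => t; rewrite /= e2pi_real.
  by apply: eq_has_sum => m; rewrite /f integral01Z//; exact: ccontinuous_integrand.
have [B hB] := gb _ (growth_pv_coef (n v)).
have [S hS] : exists S, has_sum (fun m => b m * pv_coef R (n v) (ell m v)) S.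
  by apply: has_sum_ex hB => m; rewrite cabsM.
suff -> : pv_integral Phi = S.
  apply: eq_has_sum hS => m; rewrite [in RHS](bigD1 v)//= /b /fac mem_head /=.
  rewrite [RHS]mulrA [LHS]mulrAC; congr (_ * _); apply: eq_bigr => u uv.
  by rewrite inE (negbTE uv).
apply: cvg_lim; first exact: norm_hausdorff.
apply: cvg_near_cst; near=> e.
have e0 : 0 < e by near: e; exact: nbhs_right_gt.
have e1 : e < 1 by near: e; exact: nbhs_right_lt.
have p1 : 0 < 1 + e by rewrite addr_gt0.
have p2 : 0 < 1 - e by rewrite subr_gt0.
have n1 : 1 + e != 1 by rewrite gt_eqF// ltrDl.
have n2 : 1 - e != 1 by rewrite lt_eqF// ltrBlDr ltrDl.
apply: has_sum_unique hS; apply: eq_has_sum (has_sumD (hC _ p1 n1) (hC _ p2 n2)) => m.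
rewrite -mulrDr; congr (_ * _).
rewrite -(@circle_integral_pair _ (n v) (ell m v) e) ?e0 ?e1 ?ell_parity//.
by rewrite !circle_integral_kernel.
Unshelve. all: by end_near.
Qed.

End IteratedIntegral.

Lemma map_qform (A B : pzRingType) (phi : {rmorphism A -> B}) N (M : 'M[A]_N) x :
  qform (map_mx phi M) (map_mx phi x) = phi (qform M x).
Proof. by rewrite /qform map_trmx -!map_mxM mxE. Qed.

Lemma map_invmx_int (F : fieldType) N (M : 'M[int]_N) : M \in unitmx ->
  invmx (map_mx intr M) = map_mx (intr : int -> F) (invmx M).
Proof.
move=> uM; have E : map_mx (intr : int -> F) M *m map_mx intr (invmx M) = 1%:M.
  by rewrite -map_mxM mulmxV// map_mx1.
have [u1 _] := mulmx1_unit E.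
by rewrite -[LHS]mulmx1 -E mulmxA mulVmx// mul1mx.
Qed.

(** * The radial limit *)

Section HomologicalBlock.
Variables (R : realType) (N : nat) (G : plumbing_graph N) (n : 'I_N -> nat).
Hypothesis deg_n : forall v, degree G v = (n v).+1.
Let W := linking G.
Let A := - invmx W.
Hypothesis uW : W \in unitmx.
Hypotheses (sA : A^T = A) (pA : posdef A).
Variables (k : nat) (s : R).
Hypotheses (k0 : (0 < k)%N) (s0 : 0 < s).

Definition coset_pt (m : 'cV[int]_N) : 'cV[int]_N := \col_v (2 * m v 0 + (degree G v)%:Z).
(* [|q ^ (Q / 4)| = expR (- sigma ^ 2 * Q)] at [q = e (1/k + i s)]. *)
Definition sigma : R := Num.sqrt (pi * s / 2).

Lemma sigma_gt0 : 0 < sigma.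
Proof. by rewrite sqrtr_gt0 divr_gt0// mulr_gt0 ?pi_gt0. Qed.

Lemma qpow_radial (x : R) : qpow (Complex k%:R^-1 s) x =
  (expR (- (2 * pi * (s * x))))%:C%C * ee (x / k%:R).
Proof.
have -> : qpow (Complex k%:R^-1 s) x = e2pi (Complex (x / k%:R) (s * x)).
  congr e2pi; apply/eqP; rewrite eq_complex /=; apply/andP; split; apply/eqP; ring.
exact: e2piE.
Qed.

Definition theta_coef (l : 'cV[int]_N) : R[i] :=
  ee ((qform A l)%:~R / (4 * k)%:R) * (gaussian A sigma l)%:C%C.

Lemma qpow_theta_coef l :
  qpow (Complex k%:R^-1 s) (- qform (invmx (map_mx intr W)) (map_mx intr l) / 4) = theta_coef l.
Proof.
rewrite map_invmx_int// map_qform qpow_radial /theta_coef mulrC.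
have -> : - (qform (invmx W) l)%:~R = (qform A l)%:~R :> R by rewrite qformN rmorphN.
have kR : (k%:R : R) != 0 by rewrite pnatr_eq0 -lt0n.
congr (ee _ * (expR (- _))%:C%C); first by rewrite natrM; field.
by rewrite sqr_sqrtr ?divr_ge0 ?mulr_ge0 ?pi_ge0 ?(ltW s0)//; field.
Qed.

Lemma cabs_theta_coef l : cabs (theta_coef l) = gaussian A sigma l.
Proof. by rewrite cabsM cabs_ee mul1r cabs_real ger0_norm// expR_ge0. Qed.

Let ell (m : 'cV[int]_N) (v : 'I_N) : int := coset_pt m v 0.

Let ell_ge (m : 'cV[int]_N) v : `|m v 0|%:~R - (degree G v)%:R <= (`|ell m v|%N)%:R :> R.
Proof.
rewrite /ell mxE lerBlDr -natrD -mulrz_nat ler_int.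
by lia.
Qed.

(** At fixed [sigma] the Gaussian beats every exponential in the coordinates, which is what termwise
    integration over arbitrary circles requires. *)
Lemma theta_coef_decay (rho : 'I_N -> R) : (forall v, 1 <= rho v) ->
  exists B, bounded_sums (fun m => cabs (theta_coef (coset_pt m)) * \prod_v rho v ^+ `|ell m v|%N)
    B.
Proof.
(* As [rho v <= expR (rho v)], the product of powers is at most the exponential of the sum of the
   [rho v] times [l1norm R l]. The extra 1 leaves a decaying exponential for the summation. *)
move=> rho1; pose b := \sum_v rho v + 1.
have b0 : 0 <= b by rewrite addr_ge0// sumr_ge0// => v _; exact: le_trans (rho1 v).
have [C hC] := gaussian_decay sA pA (divr_ge0 b0 (ltW sigma_gt0)).
have step (l : 'cV[int]_N) : cabs (theta_coef l) * \prod_v rho v ^+ `|l v 0%R|%N <=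
  expR C * \prod_v expR (- (`|l v 0%R|%N)%:R).
  rewrite -expR_sum sumrN -expRD cabs_theta_coef.
  have -> : \sum_v (`|l v 0%R|%N)%:R = l1norm R l.
    by apply: eq_bigr => v _; rewrite natr_absz.
  have h : \prod_v rho v ^+ `|l v 0%R|%N <= expR ((\sum_v rho v) * l1norm R l).
    rewrite mulr_sumr expR_sum; apply: ler_prod => v _.
    rewrite exprn_ge0 ?(le_trans ler01)//=.
    rewrite -natr_absz mulrC expRM_natl lerXn2r ?nnegrE ?expR_ge0 ?(le_trans ler01)//.
    apply: le_trans (_ : _ <= expR (rho v)) _.
      by apply: le_trans (expR_ge1Dx _); rewrite lerDr.
    rewrite ler_expR (bigD1 v)//= lerDl sumr_ge0// => i _; exact: le_trans (rho1 i).
  apply: le_trans (ler_wpM2l (expR_ge0 _) h) _; rewrite -expRD ler_expR.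
  have := hC sigma l (ltW sigma_gt0); rewrite divfK ?(gt_eqF sigma_gt0)// /b.
  lra.
pose K : R := \prod_(v < N) (expR (degree G v)%:R * 4).
exists (expR C * K).
have K1 : bounded_sums (fun m : 'cV[int]_N => \prod_v
    (expR (degree G v)%:R * expR (- `|m v 0|%:~R)) : R) K.
  apply: (bounded_sums_prod (b := fun v l => expR (degree G v)%:R * expR (- `|l|%:~R))).
    by move=> v l; rewrite mulr_ge0 ?expR_ge0.
  move=> v L; have := @zsum_expR R (fun l => expR (degree G v)%:R * expR (- `|l|%:~R))
    (expR (degree G v)%:R) 1 L.
  rewrite ltr01 lexx mul1r [4 * _]mulrC; apply=> [//||l]; first exact: expR_ge0.
  by rewrite mul1r.
move=> D; apply: le_trans (ler_wpM2l (expR_ge0 C) (K1 D)); rewrite mulr_sumr.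
apply: ler_sum => m _; apply: le_trans (step (coset_pt m)) _.
rewrite ler_wpM2l ?expR_ge0//; apply: ler_prod => v _; rewrite expR_ge0/= -expRD ler_expR.
by have := ell_ge m v; rewrite /ell; lra.
Qed.

Lemma Zhat_has_sum :
  has_sum (fun m => theta_coef (coset_pt m) * \prod_v pv_coef R (n v) (coset_pt m v 0))
   (pv_torus (fun z => theta G (Complex k%:R^-1 s) z *
    \prod_v ((z v - (z v)^-1) ^ (2 - (degree G v)%:Z) / (two_pi_i R * z v)))).
Proof.
have := @pv_iterated_has_sum R N 'cV[int]_N n ell (theta_coef \o coset_pt)
  (fun z => theta G (Complex k%:R^-1 s) z *
    \prod_v ((z v - (z v)^-1) ^ (2 - (degree G v)%:Z) / (two_pi_i R * z v))) _ theta_coef_decay _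
  (enum 'I_N) (fun=> 1) (enum_uniq _) (fun=> oner_neq0 _).
move=> h; apply: eq_has_sum (h _ _).
- move=> m /=; congr (_ * _); apply: eq_bigr => v _.
  by rewrite mem_enum.
- by move=> m v; rewrite /ell mxE deg_n; lia.
move=> z z0.
have [B hB] : exists B, bounded_sums (fun m => cabs ((theta_coef \o coset_pt) m) *
    \prod_v (1 * cabs (z v) ^ ell m v)) B.
  apply: (growth_bounded_sums theta_coef_decay (phi := fun v l => 1 * cabs (z v) ^ l)) => v.
  by apply: growth_exprz; rewrite ?ler01// lt_neqAle cabs_ge0 eq_sym cabs_eq0 z0.
have [S hS] : exists S, has_sum (fun m => theta_coef (coset_pt m) * \prod_v z v ^ ell m v) S.
  apply: has_sum_ex hB => m; rewrite cabsM cabs_prod /=.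
  by under eq_bigr do rewrite cabsXz -[_ ^ _]mul1r.
have -> : theta G (Complex k%:R^-1 s) z = S.
  apply: has_sum_csum; apply: eq_has_sum hS => m.
  by rewrite /= qpow_theta_coef.
rewrite mulrC; apply: eq_has_sum (has_sumZ (c := _) hS) => m.
rewrite mulrCA; congr (_ * _); rewrite -big_split /=; apply: eq_bigr => v _.
rewrite mulrC /circle_kernel deg_n /sub_inv; congr (_ * (_ ^ _ / _)); lia.
Qed.

End HomologicalBlock.

Lemma posdef_inv N (W : 'M[int]_N) : W^T = W -> W \in unitmx -> posdef (- W) ->
  (- invmx W)^T = - invmx W /\ posdef (- invmx W).
Proof.
move=> sW uW pW; have sV : (invmx W)^T = invmx W by rewrite trmx_inv sW.
split; first by rewrite linearN /= sV.
move=> x x0; have -> : qform (- invmx W) x = qform (- W) (invmx W *m x).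
  by rewrite qform_mulmx sV mulmxN mulNmx mulVmx// mul1mx.
apply: pW; apply: contra x0 => /eqP e.
by rewrite -[x]mul1mx -(mulmxV uW) -mulmxA e mulmx0.
Qed.

Lemma qform_diff (A : comPzRingType) N (M : 'M[A]_N) (x y : 'cV[A]_N) : M^T = M ->
  qform M y - qform M x = bform M (y - x) (y + x).
Proof.
move=> sM; rewrite bformDl !bformDr [bform M (- x) y]bformC// -[- x]scaleN1r.
rewrite !bformZr !bformZl -[qform M y]/(bform M y y) -[qform M x]/(bform M x x).
by move: (bform M y y) (bform M x x) (bform M y x) => a b c; ring.
Qed.

Lemma pv_coef0_supp (R : realType) l : pv_coef R 0 l != 0 -> l = 1 \/ l = -1.
Proof.
rewrite -pv_coef_rec !pv_coef_one -mulrBl.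
have [e|n1] := eqVneq (l + 1) 0; first by right; lia.
have [e|n2] := eqVneq (l - 1) 0; first by left; lia.
by rewrite subrr mul0r eqxx.
Qed.

(** * Leaves against hubs: removal of the polar terms and the radial limit *)

Section RadialLimit.
Variables (R : realType) (N : nat) (W : 'M[int]_N) (n : 'I_N -> nat) (k : nat).
Variables (L : {set 'I_N}) (p : 'I_N -> 'I_N).
Hypotheses (sW : W^T = W) (uW : W \in unitmx) (pW : posdef (- W)) (k0 : (0 < k)%N).
Hypothesis leaf_n : forall i, i \in L -> n i = 0%N.
Hypothesis leaf_hub : forall i, i \in L -> p i \notin L.
Hypothesis leaf_adj : forall i j, i \in L -> j != i -> j != p i -> W i j = 0.
Hypothesis hub_n : forall u, u \notin L -> #|[set i in L | p i == u]| = n u.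
Implicit Types (x l : 'cV[int]_N) (v : 'I_N).
Let A := - invmx W.
Let sA : A^T = A. Proof. by case: (posdef_inv sW uW pW). Qed.
Let pA : posdef A. Proof. by case: (posdef_inv sW uW pW). Qed.
Let k2 : (0 < 2 * k)%N. Proof. by rewrite muln_gt0. Qed.

(* The leaves whose hub [p v] carries a pole. *)
Definition tied x v := (v \in L) && (k%:Z %| x (p v) 0%R)%Z.
(** At a tied leaf the phase for [l v = 1] is moved into [root_weight]; what remains is the root
    1. *)
Definition root_pt x v : R[i] := if tied x v then 1 else ee (- ((x v 0)%:~R / (2 * k)%:R)).
Definition root_weight x : R[i] := psi R W k x * \prod_(v |
  tied x v) ee (- ((x v 0)%:~R / (2 * k)%:R)).
(** On the phase, changing the sign of [x v] has the same effect as replacing [l v = -1] by 1. *)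
Definition flip l x : 'cV[int]_N :=
  \col_v (if tied x v && (l v 0 == -1) then - x v 0 else x v 0).

Lemma flip_hub l x v : v \notin L -> flip l x v 0 = x v 0.
Proof. by move=> vL; rewrite mxE /tied (negbTE vL). Qed.

Lemma tied_cong x y v : cong (2 * k) x y -> tied x v = tied y v.
Proof.
move=> /forallP h; rewrite /tied; congr andb.
have := h (p v); move=> /dvdzP[q e].
have -> : x (p v) 0 = y (p v) 0 + q * 2 * k%:Z by lia.
by rewrite rpredDr// dvdz_mull.
Qed.

Lemma tied_flip l x v : tied (flip l x) v = tied x v.
Proof.
rewrite /tied; case: (boolP (v \in L)) => //= vL.
by rewrite flip_hub// leaf_hub.
Qed.

(** [flip l] fixes the hub coordinates, which alone decide the leaves that are tied; so the same
    signs are changed in [x] and in [y]. *)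
Lemma flip_inj l x y : cong (2 * k) (flip l x) (flip l y) -> cong (2 * k) x y.
Proof.
move=> h; have t v : tied x v = tied y v.
  by rewrite -(tied_flip l x) (tied_cong v h) tied_flip.
apply/forallP => v; move/forallP: h => /(_ v); rewrite !mxE t.
by case: ifP => // _; rewrite -opprD rpredN.
Qed.

(* A tied leaf [i] is adjacent, apart from itself, to a vertex with [k | x (p i)] only;
   flipping the sign of [x i] changes the form by [-4 x_i x_(p i)]. *)
Lemma psi_flip l x : psi R W k (flip l x) = psi R W k x.
Proof.
apply: ee_eqmod; first by rewrite muln_gt0.
rewrite qform_diff// bformE; apply: rpred_sum => v _.
have [c|c] := boolP (tied x v && (l v 0 == -1)); last first.
  by rewrite mxE [flip l x v 0]mxE (negbTE c) mxE subrr mul0r dvdz0.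
have fv : flip l x v 0 = - x v 0 by rewrite mxE c.
have /andP[/andP[vL kv] _] := c.
have pv : p v != v by apply: contraNneq (leaf_hub vL) => ->.
have -> : (W *m (flip l x + x)) v 0 = W v (p v) * (2 * x (p v) 0).
  rewrite mxE (bigD1 (p v))//= (bigD1 v) 1?eq_sym//= [X in _ + (_ + X)]big1 => [|j /andP[j1 j2]].
    have E j : (flip l x + x) j 0 = flip l x j 0 + x j 0 by rewrite mxE.
    by rewrite !E fv flip_hub ?leaf_hub//; ring.
  by rewrite leaf_adj// mul0r.
have /dvdzP[q ->] := kv; rewrite mxE fv [(- x) v 0]mxE.
by apply/dvdzP; exists (- x v 0 * W v (p v) * q); rewrite PoszM; ring.
Qed.

(* After summation over [x] the coefficient of [l] is even in the tied coordinates, hence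
   does not change if these are set to 1; this creates new poles at the tied leaves. *)
Lemma boxsum_flip l : (forall v, v \in L -> l v 0 = 1 \/ l v 0 = -1) ->
  boxsum (2 * k) (fun x => psi R W k x * ee (- ((dot l x)%:~R / (2 * k)%:R))) =
  boxsum (2 * k) (fun x => root_weight x * \prod_v root_pt x v ^ l v 0).
Proof.
move=> hl; pose f x := psi R W k x * ee (- ((dot l x)%:~R / (2 * k)%:R)) : R[i].
have pf : periodic (2 * k) f.
  move=> x y xy; rewrite /f (psi_periodic R sW k0 xy); congr (_ * _).
  by rewrite !eeN (dot_periodic R l k2 xy).
rewrite -(boxsum_reindex k2 pf (@flip_inj l)); apply: eq_boxsum => x.
rewrite /f /= psi_flip /root_weight -mulrA; congr (_ * _).
rewrite [\prod_(_ | tied _ _) _]big_mkcond -big_split /= /dot.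
rewrite rmorph_sum /= mulr_suml -sumrN ee_sum; apply: eq_bigr => v _.
rewrite mxE /root_pt; have [tv|_] /= := boolP (tied x v); last first.
  rewrite mul1r -eeMz intrM; congr ee; move: (_%:~R) (_%:R^-1) => a b; ring.
rewrite exp1rz mulr1; have /andP[vL _] := tv.
case: (hl v vL) => -> /=; first by rewrite mul1r.
by rewrite mulN1r opprK.
Qed.

Definition root_sum x s := tsum A (pv_coef R) (root_pt x) n (fun _ _ => 1) s.

Lemma cabs_root_pt x v : cabs (root_pt x v) = 1.
Proof. by rewrite /root_pt; case: ifP => _; rewrite ?cabs1 ?cabs_ee. Qed.

(** The Fourier expansion of the phase is a finite sum over [x], so it may be exchanged with the sum
    over [l]. *)
Lemma theta_coef_has_sum s : 0 < s <= 1 ->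
  has_sum (fun l => (ee ((qform A l)%:~R / (4 * k)%:R) * (gaussian A s l)%:C%C)
      * \prod_v pv_coef R (n v) (l v 0))
    ((gauss R W k)^-1 * boxsum (2 * k) (fun x => root_weight x * root_sum x s)).
Proof.
move=> s1.
have h (mu : {ffun 'I_N -> 'I_(2 * k)}) : has_sum (fun l => root_weight (bvec mu) *
    tterm A (pv_coef R) (root_pt (bvec mu)) n (fun _ _ =>
      1) s l) (root_weight (bvec mu) * root_sum (bvec mu) s).
  apply: has_sumZ; apply: (tsum_has sA pA (@pv_coef_rec R) (@pv_coef_one R) (cabs_root_pt _) _ s1).
  exact: smooth_family1.
have := has_sumZ (c := (gauss R W k)^-1) (has_sum_sum (r := index_enum _) (P := xpredT)
   (fun mu _ => h mu)).
apply: eq_has_sum => l /=.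
rewrite /tterm mulr1; set g := (gaussian A s l)%:C%C; set K := \prod_v pv_coef R (n v) (l v 0).
have -> : \sum_(mu : {ffun 'I_N -> 'I_(2 * k)}) root_weight (bvec mu) * (\prod_v (pv_coef R (n v)
  (l v 0) * root_pt (bvec mu) v ^ l v 0) * g)
  = K * g * boxsum (2 * k) (fun x => root_weight x * \prod_v root_pt x v ^ l v 0).
  rewrite mulr_sumr; apply: eq_bigr => mu _; rewrite big_split /= -/K.
  by move: (root_weight _) (\prod_v _) => a b; ring.
(* Where the kernels do not all survive, both sides vanish; elsewhere every leaf has [l v] equal to
   1 or -1, as [boxsum_flip] requires. *)
have [->|K0] := eqVneq K 0; first by rewrite mulr0 !mul0r mulr0.
rewrite -boxsum_flip ?gauss_fourier//; last first.
  move=> v vL; apply: (@pv_coef0_supp R); apply: contraNneq K0 => e.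
  by rewrite /K (bigD1 v)//= leaf_n// e mul0r.
have := gauss_neq0 R sW uW k0; move: (gauss R W k) (ee _) => G e G0.
by move: K g {K0} => a b; field.
Qed.

Definition good x := [forall v, ~~ (k%:Z %| x v 0%R)%Z].
Definition root_sum_lim x : R[i] := if good x then tlimit (root_pt x) n else 0.

Lemma pole_root_pt x v : pole (root_pt x) v = tied x v || (k%:Z %| x v 0%R)%Z.
Proof.
rewrite /pole /root_pt; case: ifP => tv; first by rewrite expr1n eqxx.
rewrite -eeMn.
have kR : (k%:R : R) != 0 by rewrite pnatr_eq0 -lt0n.
have -> : - ((x v 0)%:~R / (2 * k)%:R) *+ 2 = (- x v 0)%:~R / k%:R :> R.
  by rewrite natrM rmorphN /=; field.
apply/eqP/idP => [/ee_eq1 e|/dvdzP[q ->]]; first by rewrite -rpredN; apply: e.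
by rewrite -mulNr intrM mulfK// ee_int.
Qed.

Lemma pole_hub x u : u \notin L -> pole (root_pt x) u = (k%:Z %| x u 0%R)%Z.
Proof. by move=> uL; rewrite pole_root_pt /tied (negbTE uL). Qed.

(* The poles at the leaves outweigh those at the hubs. *)
Lemma pole_count x : ~~ good x ->
  (\sum_(v | pole (root_pt x) v) (n v).-1 < #|[pred v | pole (root_pt x) v && (n v == 0)%N]|)%N.
Proof.
move=> bad; set P := pole (root_pt x).
(* A pole at a hub [u] ties all of its [n u] leaves, and every tied leaf is itself a pole. *)
have sumL : (\sum_(u | P u && (u \notin L)) n u <= \sum_(v in L | P v) 1)%N.
  have -> : (\sum_(u | P u && (u \notin L)) n u = \sum_(i in L | P (p i)) 1)%N.
    rewrite [RHS](partition_big p (fun u => P u && (u \notin L))) /=; last first.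
      by move=> i /andP[iL ->]; rewrite leaf_hub.
    apply: eq_bigr => u /andP[Pu uL]; rewrite -hub_n// -sum1_card; apply: eq_bigl => i.
    by rewrite inE; case: eqP => [->|_]; rewrite ?andbF ?andbT// Pu andbT.
  rewrite big_mkcond [leqRHS]big_mkcond /=; apply: leq_sum => i _.
  case: (boolP (i \in L)) => //= iL; rewrite /P pole_hub ?leaf_hub//.
  by case: ifP => // ki; rewrite pole_root_pt /tied iL ki.
have -> : #|[pred v | P v && (n v == 0)%N]| =
    (\sum_(v in L | P v) 1 + \sum_(u | P u && (u \notin L)) (n u == 0))%N.
  rewrite -sum1_card (bigID (fun v => v \in L)) /=; congr addn.
    apply: eq_bigl => v; rewrite !inE; case: (boolP (v \in L)) => vL; rewrite ?andbF//.
    by rewrite leaf_n// eqxx !andbT.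
  rewrite [LHS]big_mkcond [RHS]big_mkcond /=; apply: eq_bigr => v _; rewrite !inE.
  by case: (P v); case: (v \in L); case: (n v == 0)%N.
have -> : (\sum_(v | P v) (n v).-1 = \sum_(u | P u && (u \notin L)) (n u).-1)%N.
  rewrite (bigID (fun v => v \in L)) /= big1 ?add0n// => v /andP[_ vL].
  by rewrite leaf_n.
have [u /andP[Pu uL]|none] := pickP (fun u => P u && (u \notin L)).
  (* The inequality is strict at [u]: either [n u > 0] and its predecessor is smaller, or [n u = 0]
     and the hub itself is counted among the gains. *)
  apply: leq_trans (leq_add sumL (leqnn _)); rewrite -big_split /=.
  rewrite (bigD1 u) ?Pu//= [ltnRHS](bigD1 u) ?Pu//= -addSn; apply: leq_add.
    by case: (n u) => [|m] /=; rewrite ?addn0 ?ltnSn.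
  by apply: leq_sum => i _; rewrite (leq_trans (leq_pred _)) ?leq_addr.
(* No hub carries a pole, so nothing is lost; the failure of [good] supplies a leaf with a pole. *)
rewrite !(big_pred0 _ _ _ _ none) addn0.
have /forallPn[v] := bad; rewrite negbK => kv.
have Pv : P v by rewrite /P pole_root_pt kv orbT.
have vL : v \in L by have := none v; rewrite Pv => /negbFE.
by rewrite (bigD1 v) ?vL.
Qed.

Lemma root_sum_cvg x : exists2 C : R, 0 <= C &
  forall s, 0 < s <= 1 -> cabs (root_sum x s - root_sum_lim x) <= C * s.
Proof.
rewrite /root_sum_lim; case: ifP => gx.
  apply: (tsum_limit sA pA (@pv_coef_rec R) (@pv_coef_one R) (cabs_root_pt x)) => v.
  move/forallP: gx => gx; rewrite pole_root_pt negb_or gx andbT negb_and; apply/orP.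
  by right; apply: gx.
have [C C0 hC] := tbound_main sA pA (@pv_coef_rec R) (@pv_coef_one R) (cabs_root_pt x) n
  (@smooth_family1 R N).
exists C => // s /andP[s0 s1]; rewrite subr0.
have := hC s; rewrite s0 s1 => /(_ isT).
have := pole_count (negbT gx); move: (\sum_(v | _) _)%N (#|_|) => D E DE.
rewrite add0n => h; rewrite -(ler_pM2l (exprn_gt0 D s0)); apply: le_trans h _.
rewrite mulrCA ler_wpM2l// -exprSr; apply: ler_wiXn2l => //; exact: ltW.
Qed.

Lemma boxsum_cvg : exists2 C : R, 0 <= C & forall s, 0 < s <= 1 ->
  cabs (boxsum (2 * k) (fun x => root_weight x * root_sum x s) - boxsum (2 * k) (fun x =>
    root_weight x * root_sum_lim x))
    <= C * s.
Proof.
have /fin_all_exists2[C C0 hC] (mu : {ffun 'I_N -> 'I_(2 * k)}) := root_sum_cvg (bvec mu).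
exists (\sum_mu cabs (root_weight (bvec mu)) * C mu).
  by apply: sumr_ge0 => mu _; rewrite mulr_ge0 ?cabs_ge0.
move=> s s1; rewrite /boxsum -sumrB mulr_suml; apply: le_trans (cabs_sum _ _ _) _.
apply: ler_sum => mu _; rewrite -mulrBr cabsM -mulrA ler_wpM2l ?cabs_ge0//; exact: hC.
Qed.

Lemma boxsum_lim : boxsum (2 * k) (fun x => root_weight x * root_sum_lim x) =
  2 ^+ N * \sum_(mu : {ffun 'I_N -> 'I_(2 * k)} | [forall v, ~~ (k %| mu v)%N])
    (zeta R (4 * k) ^ qform W (bvec mu) *
     \prod_v (zeta R (2 * k) ^+ mu v - zeta R (2 * k) ^- mu v) ^ (1 - (n v)%:Z)).
Proof.
rewrite mulr_sumr [RHS]big_mkcond; apply: eq_bigr => mu _; rewrite /root_sum_lim.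
have -> : good (bvec mu) = [forall v, ~~ (k %| mu v)%N].
  by apply: eq_forallb => v; rewrite mxE.
case: ifP => [/forallP gd|_]; last by rewrite mulr0.
have nt v : tied (bvec mu) v = false.
  by rewrite /tied mxE; apply/negbTE; rewrite negb_and; apply/orP; right; apply: gd.
rewrite /root_weight big1 ?mulr1; last by move=> v; rewrite nt.
rewrite /tlimit mulrCA; congr (_ * (_ * _)); first by rewrite /psi zeta_exp.
apply: eq_bigr => v _; rewrite /root_pt nt mxE eeN invrK.
by rewrite -(zeta_exp R (2 * k) (mu v : nat)%:Z) exprnP.
Qed.

End RadialLimit.

Lemma posdef_of_negative_definite (R : realType) N (W : 'M[int]_N) :
  negative_definite R W -> posdef (- W).
Proof.
move=> neg x x0; have := neg (map_mx intr x).
rewrite map_qform ltrz0 qformN oppr_gt0; apply.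
apply: contra x0 => /eqP e; apply/eqP/matrixP => i j.
by have := congr1 (fun y : 'cV[R]_N => y i j) e; rewrite !mxE => /eqP; rewrite intr_eq0 => /eqP.
Qed.

Lemma linking_sym N (G : plumbing_graph N) : (linking G)^T = linking G.
Proof.
apply/matrixP => i j; rewrite !mxE eq_sym adj_sym.
by case: eqP => [->|].
Qed.

(** * Hubs and leaves of an H-shaped graph *)

Section HShapedGraphs.
Variables (N N' : nat) (G : plumbing_graph N).
Hypotheses (N'2 : (2 <= N')%N) (N'N : (N' <= N)%N) (hG : H_shaped N' G).

Let N2 : (2 <= N)%N. Proof. exact: leq_trans N'N. Qed.
Definition hub1 : 'I_N := Ordinal (ltnW N2).
Definition hub2 : 'I_N := Ordinal N2.
Definition leaves : {set 'I_N} := [set i : 'I_N | (2 <= i)%N].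
(** The element [i] carries the label [i.+1], so [i < N'] says that its label is at most [N']. *)
Definition leaf_nbr (i : 'I_N) : 'I_N := if (i < N')%N then hub1 else hub2.
Definition other_hub (u : 'I_N) : 'I_N := if u == 0%N :> nat then hub2 else hub1.

Lemma leaf_nbr_hub i : leaf_nbr i \notin leaves.
Proof. by rewrite inE /leaf_nbr; case: ifP. Qed.

Lemma other_hub_hub i : other_hub i \notin leaves.
Proof. by rewrite inE /other_hub; case: ifP. Qed.

Lemma adj_leaf i j : i \in leaves -> adj G i j = (j == leaf_nbr i).
Proof.
rewrite inE hG /H_edge -val_eqE /leaf_nbr /= => i2.
have iN := ltn_ord i; have jN := ltn_ord j.
case: ifP => iN'; apply/idP/idP; rewrite /=; lia.
Qed.

Lemma adj_hub u j : u \notin leaves ->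
  adj G u j = (j == other_hub u) || ((j \in leaves) && (leaf_nbr j == u)).
Proof.
rewrite !inE hG /H_edge -!val_eqE /leaf_nbr /other_hub /= => u2.
have uN := ltn_ord u; have jN := ltn_ord j.
case: ifP => u0; case: ifP => jN'; rewrite /=; apply/idP/idP; lia.
Qed.

Lemma degree_leaf i : i \in leaves -> degree G i = 1%N.
Proof.
move=> iL; rewrite /degree (_ : [set _ | _]%SET = [set leaf_nbr i]%SET) ?cards1//.
by apply/setP => j; rewrite !inE adj_leaf.
Qed.

Lemma degree_hub u : u \notin leaves ->
  degree G u = #|[set i in leaves | leaf_nbr i == u]|.+1.
Proof.
move=> uL; rewrite /degree.
rewrite (_ : [set _ | _]%SET = other_hub u |: [set i in leaves | leaf_nbr i == u])%SET.
  by rewrite cardsU1 inE negb_and other_hub_hub.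
by apply/setP => j; rewrite !inE adj_hub// inE.
Qed.

Lemma degree_gt0 v : (0 < degree G v)%N.
Proof. by have [/degree_leaf->|/degree_hub->] := boolP (v \in leaves). Qed.

Lemma linking_leaf i j : i \in leaves -> j != i -> j != leaf_nbr i -> linking G i j = 0.
Proof. by move=> iL ji jp; rewrite mxE eq_sym (negbTE ji) adj_leaf// (negbTE jp). Qed.

End HShapedGraphs.

Lemma sigma_le (R : realType) (s d : R) : 0 < s -> 0 < d -> s <= d ^+ 2 / pi -> sigma s <= d.
Proof.
move=> s0 d0 sd; rewrite -[leRHS]ger0_norm ?(ltW d0)// -sqrtr_sqr ler_wsqrtr//.
rewrite -(ler_pM2r (x := pi^-1)) ?invr_gt0 ?pi_gt0//; apply: le_trans sd.
have -> : pi * s / 2 / pi = s / 2.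
  by rewrite mulrAC [pi * s]mulrC mulfK ?(gt_eqF (pi_gt0 R)).
by rewrite ler_pdivrMr// ler_peMr ?(ltW s0)// ler1n.
Qed.

Lemma qpow_radial_cvg (R : realType) (k : nat) (x : R) :
  qpow (Complex k%:R^-1 s) x @[s --> (0 : R)^'+] --> ee (x / k%:R).
Proof.
have c : expR (- (2 * pi * (s * x))) @[s --> (0 : R)^'+] --> (1 : R).
  apply: cvg_at_right_filter.
  have {2}-> : 1 = expR (- (2 * pi * (0 * x))) :> R by rewrite mul0r mulr0 oppr0 expR0.
  have c : {for 0, continuous (fun s : R => - (2 * pi * (s * x)))}.
    apply: cvgN; apply: cvgM; first exact: cvg_cst.
    by apply: cvgM; [exact: cvg_id | exact: cvg_cst].
  by apply: (continuous_comp c); exact: continuous_expR.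
apply/cvg_cabsP => e e0; move/cvgrPdist_le : c => /(_ e e0); apply: filterS => s.
rewrite qpow_radial -{2}[ee _]mul1r -mulrBl cabsM cabs_ee mulr1 distrC.
by rewrite -cabs_real rmorphB rmorph1.
Qed.

(** The parity condition built into [pv_coef] confines the support of [f] to the coset, so a sum
    over Z^N is also the sum over the coset. *)
Lemma coset_pt_sum (R : realType) N (G : plumbing_graph N) (n : 'I_N -> nat)
    (f : 'cV[int]_N -> R[i]) S : (forall v, degree G v = (n v).+1) ->
  (forall l, f l != 0 -> forall v, pv_coef R (n v) (l v 0) != 0) ->
  has_sum f S -> has_sum (f \o coset_pt G) S.
Proof.
move=> deg_n fk; pose g (l : 'cV[int]_N) : 'cV[int]_N :=
  \col_v ((l v 0%R - (degree G v)%:Z) %/ 2)%Z.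
apply: (@has_sum_inj _ _ _ f (coset_pt G) g) => [m|l /fk lk].
  by apply/matrixP => v j; rewrite ord1 !mxE addrK mulKz.
apply/matrixP => v j; rewrite ord1 !mxE mulrC divzK ?subrK//.
have : (2 %| l v 0%R + (n v)%:Z + 1)%Z.
  by have := lk v; rewrite /pv_coef; case: (2 %| _)%Z => //; rewrite mul0r eqxx.
by rewrite deg_n; move: (l v 0) (n v) => a b; lia.
Qed.

Theorem theorem1p2 (R : realType) (N N' : nat) (hN' : (2 <= N')%N)
    (hN : (N' <= N)%N) (G : plumbing_graph N) (hG : H_shaped N' G)
    (hneg : negative_definite R (linking G))
    (hdet : \det (linking G) = 1 \/ \det (linking G) = -1)
    (k : nat) (hk : (2 <= k)%N) :
  cvg (Zhat_radial G k s @[s --> (0 : R)^'+]) /\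
  WRT R G k =
    (2 * (zeta R (2 * k) - (zeta R (2 * k))^-1))^-1 *
    lim (Zhat_radial G k s @[s --> (0 : R)^'+]).
Proof.
have k0 : (0 < k)%N by exact: ltnW.
pose W := linking G; pose n v := (degree G v).-1.
have deg_n v : degree G v = (n v).+1 by rewrite prednK// (degree_gt0 hN' hN hG).
have sW : W^T = W := linking_sym G.
have uW : W \in unitmx by rewrite unitmxE; case: hdet => ->.
have pW : posdef (- W) := posdef_of_negative_definite hneg.
have [sA pA] := posdef_inv sW uW pW.
pose L := leaves N; pose p := leaf_nbr hN' hN.
have leaf_n i : i \in L -> n i = 0%N by move=> iL; rewrite /n (degree_leaf hN' hN hG).
have leaf_hub i : i \in L -> p i \notin L by move=> _; exact: leaf_nbr_hub.
have leaf_adj i j : i \in L -> j != i -> j != p i -> W i j = 0.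
  exact: linking_leaf.
have hub_n u : u \notin L -> #|[set i in L | p i == u]| = n u.
  by move=> uL; rewrite /n (degree_hub hN' hN hG).
pose x0 : R := - (\sum_v (weight G v + 3))%:~R / 4.
pose PV s := pv_torus (fun z => theta G (Complex k%:R^-1 s) z *
    \prod_v ((z v - (z v)^-1) ^ (2 - (degree G v)%:Z) / (two_pi_i R * z v))).
pose S s := boxsum (2 * k) (fun x => root_weight R W k L p x * root_sum W n k L p x s).
pose S0 := boxsum (2 * k) (fun x => root_weight R W k L p x * root_sum_lim R n k L p x).
have PVE s : 0 < s -> sigma s <= 1 -> PV s = (gauss R W k)^-1 * S (sigma s).
  move=> s0 s1; have := Zhat_has_sum deg_n uW sA pA k0 s0.
  move/has_sum_unique; apply; apply: (coset_pt_sum deg_n _ (theta_coef_has_sum sW uW pW k0 leaf_n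
    leaf_hub leaf_adj (s := sigma s) _)).
    by move=> l + v; apply: contraNneq => e; rewrite (bigD1 v)//= e mul0r mulr0.
  by rewrite sigma_gt0.
have [C C0 hC] := boxsum_cvg R sW uW pW k0 leaf_n leaf_hub hub_n.
have PVcvg : PV s @[s --> (0 : R)^'+] --> (gauss R W k)^-1 * S0.
  apply/cvg_cabsP => e e0.
  pose K := cabs (gauss R W k)^-1 * C + 1.
  have K0 : 0 < K by rewrite ltr_wpDl// mulr_ge0 ?cabs_ge0.
  pose d := Num.min 1 (e / K).
  have d0 : 0 < d by rewrite lt_min ltr01 divr_gt0.
  near=> s.
  have s0 : 0 < s by near: s; exact: nbhs_right_gt.
  have sd : sigma s <= d.
    apply: sigma_le => //; near: s; apply: nbhs_right_le.
    by rewrite divr_gt0 ?exprn_gt0 ?pi_gt0.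
  have [s1 s2] : sigma s <= 1 /\ sigma s <= e / K by apply/andP; rewrite -le_min.
  rewrite PVE// -mulrBr cabsM.
  have := hC (sigma s); rewrite sigma_gt0// s1 => /(_ isT) h.
  apply: le_trans (ler_wpM2l (cabs_ge0 _) h) _; rewrite mulrA.
  apply: le_trans (_ : _ <= K * (e / K)) _; last by rewrite mulrC divfK// gt_eqF.
  apply: ler_pM => //; rewrite ?mulr_ge0 ?cabs_ge0 ?(ltW (sigma_gt0 s0))//.
  by rewrite /K lerDl.
pose Z := 2 ^- N * ee (x0 / k%:R) * ((gauss R W k)^-1 * S0).
have Zcvg : Zhat_radial G k s @[s --> (0 : R)^'+] --> Z.
  apply: (@cvgM R[i]); last exact: PVcvg.
  apply: (@cvgM R[i]); [exact: cvg_cst | exact: qpow_radial_cvg].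
split; first by apply/cvg_ex; exists Z.
have -> : lim (Zhat_radial G k s @[s --> (0 : R)^'+]) = Z.
  by apply: cvg_lim => //; exact: norm_hausdorff.
rewrite /Z /S0 boxsum_lim// gauss_negdef// /WRT.
have -> : e2pi (N%:R / 8) = ee (N%:R / 8 : R).
  by rewrite -e2pi_real rmorphM fmorphV !rmorph_nat.
have -> : zeta R (4 * k) ^ (- \sum_v (weight G v + 3)) = ee (x0 / k%:R).
  rewrite zeta_exp; congr ee; rewrite /x0 rmorphN natrM invfM; ring.
have -> : \sum_(mu : {ffun 'I_N -> 'I_(2 * k)} | [forall v, ~~ (k %| mu v)%N])
      (zeta R (4 * k) ^ qform (linking G) (\col_v (mu v : nat)%:Z)
       * \prod_v (zeta R (2 * k) ^+ mu v - zeta R (2 * k) ^- mu v)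
                   ^ (2 - (degree G v)%:Z)) =
    \sum_(mu : {ffun 'I_N -> 'I_(2 * k)} | [forall v, ~~ (k %| mu v)%N])
      (zeta R (4 * k) ^ qform W (bvec mu) *
     \prod_v (zeta R (2 * k) ^+ mu v - zeta R (2 * k) ^- mu v) ^ (1 - (n v)%:Z)).
  apply: eq_bigr => mu _; congr (_ * _); apply: eq_bigr => v _; congr (_ ^ _).
  by rewrite deg_n; lia.
move: (\sum_(mu | _) _) (_ - _) (ee (x0 / _)) => X d b.
(* The phase e(-N/8) of the Gauss sum, inverted, is the prefactor e(N/8) of the invariant, and the
   modulus of the Gauss sum is its power of sqrt(2k). The factor 2^-N of the block cancels the 2^N
   of the limit. *)
rewrite eeN; move: (ee _) ((_)%:C%C ^+ N) => a t.
have T : 2 ^- N * 2 ^+ N = 1 :> R[i] by rewrite mulVf// expf_neq0// pnatr_eq0.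
move: ((2 : R[i]) ^+ N) T => T TT; rewrite !invfM invrK.
transitivity (2^-1 * d^-1 * (b * (t^-1 * a * ((T^-1 * T) * X)))); last by ring.
by rewrite TT; ring.
Unshelve. all: by end_near.
Qed.
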